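(* Property $(N)$ is not generally preserved under taking the composite of two fields. More concretely: for $i\ge 1$ let $p_i$ be the $(i+1)$-th prime number and set $d_i=[\sqrt{\log p_i}]$. Let $$L_1=\mathbb{Q}(p_1^{1/d_1},p_2^{1/d_2},p_3^{1/d_3},\ldots),\qquad L_2=\mathbb{Q}(p_1^{1/(d_1+1)},p_2^{1/(d_2+1)},p_3^{1/(d_3+1)},\ldots).$$ Then $L_1$ and $L_2$ both have property $(N)$, but their composite field $L_1L_2$ does not have property $(N)$.
   Context: All fields lie in a fixed algebraic closure $\overline{\mathbb{Q}}\subset\mathbb{C}$ of $\mathbb{Q}$. $H(\cdot)$ denotes the non-logarithmic absolute Weil height on $\overline{\mathbb{Q}}$: for $\alpha$ in a number field $F$, $H(\alpha)=\prod_v \max\{1,|\alpha|_v\}^{[F_v:\mathbb{Q}_v]/[F:\mathbb{Q}]}$, the product over all places $v$ of $F$, with $|\cdot|_v$ extending the usual absolute values of $\mathbb{Q}$. A subset $\mathcal{A}\subseteq\overline{\mathbb{Q}}$ has the Northcott property (property $(N)$) if for each positive real $X$ there are only finitely many $\alpha\in\mathcal{A}$ with $H(\alpha)\le X$. For positive integers $a,b$, $a^{1/b}$ denotes the positive real $b$-th root of $a$. $[x]$ denotes the integer part (floor) of a real number $x$, and $\log$ is the natural logarithm; so $p_1=3$, $p_2=5$, and so on. *)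

(* Defs.v *)
From HB Require Import structures.
From mathcomp Require Import all_boot all_order all_algebra all_field.
From mathcomp Require Import all_classical all_reals all_analysis.

Set Implicit Arguments.
Unset Strict Implicit.
Unset Printing Implicit Defensive.

Import Order.TTheory GRing.Theory Num.Theory.
Import numFieldNormedType.Exports.

Local Open Scope classical_set_scope.
Local Open Scope ring_scope.

(* The algebraic closure of Q inside C is [algC]; number fields are           *)
(* [fieldExtType rat].                                                        *)

Section Places.
Variable R : realType.

Definition archimedean_abs (q : rat) : R := ratr `|q|.

(* [logn p] of the numerator minus [logn p] of the denominator is the p-adic  *)
(* valuation of q.                                                            *)
Definition padic_abs (p : nat) (q : rat) : R :=
  if q == 0 then 0
  else p%:R ^ ((logn p `|denq q|)%:Z - (logn p `|numq q|)%:Z).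

Definition usual_abs : set (rat -> R) :=
  [set w | w = archimedean_abs \/ exists2 p, prime p & w = padic_abs p].

Variable F : fieldExtType rat.

Definition absolute_value : set (F -> R) :=
  [set v | [/\ forall x, 0 <= v x,
               forall x, v x = 0 <-> x = 0,
               forall x y, v (x * y) = v x * v y &
               forall x y, v (x + y) <= v x + v y]].

Definition restrict_abs (v : F -> R) (q : rat) : R := v q%:A.

(* A place, i.e. an equivalence class of nontrivial absolute values, is       *)
(* represented by its unique member that extends a usual absolute value of Q. *)
Definition places : set (F -> R) :=
  [set v | absolute_value v /\ usual_abs (restrict_abs v)].

Definition cauchy_for (V : zmodType) (w : V -> R) (x : nat -> V) : Prop :=
  forall e : R, 0 < e -> \forall m & n \near \oo, w (x m - x n) < e.

Definition null_for (V : zmodType) (w : V -> R) (x : nat -> V) : Prop :=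
  w (x n) @[n --> \oo] --> (0 : R).

(* The completion F_v consists of the v-Cauchy sequences of F modulo the null *)
(* ones, and Q_v likewise of the sequences of rationals that are Cauchy for   *)
(* the restriction of v.  The classes of the e i form a basis of F_v over     *)
(* Q_v.                                                                       *)
Definition completion_basis (v : F -> R) (d : nat) (e : 'I_d -> nat -> F) :
    Prop :=
  [/\ forall i, cauchy_for v (e i),
      forall x : nat -> F, cauchy_for v x ->
        exists2 c : 'I_d -> nat -> rat,
          forall i, cauchy_for (restrict_abs v) (c i) &
          null_for v (fun k => x k - \sum_(i < d) c i k *: e i k) &
      forall c : 'I_d -> nat -> rat,
        (forall i, cauchy_for (restrict_abs v) (c i)) ->
        null_for v (fun k => \sum_(i < d) c i k *: e i k) ->
        forall i, null_for (restrict_abs v) (c i)].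

(* [F_v : Q_v]; the default 0 is never reached at a place of F.               *)
Definition local_degree (v : F -> R) : nat :=
  xget 0%N [set d | exists e : 'I_d -> nat -> F, completion_basis v e].

(* Almost all factors are 1, so this finitely supported product is the        *)
(* product over all places.                                                   *)
Definition field_height (x : F) : R :=
  \big[*%R/1]_(v \in places)
    (Num.max 1 (v x)) `^ ((local_degree v)%:R / (\dim {:F})%:R).

End Places.

(* The height does not depend on the number field containing a; we take Q(a), *)
(* as provided by [num_field_exists]: x is the element of F that embeds as a, *)
(* and it generates F over Q.                                                 *)
Definition weil_height (R : realType) (a : algC) : R :=
  let: existT F (existT _ (exist2 s _ _)) := num_field_exists [:: a] in
  field_height R (head 0 s : F).

Definition northcott (R : realType) (A : set algC) : Prop :=
  forall X : R, 0 < X -> finite_set [set a | A a /\ weil_height R a <= X].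

Definition subfield : set (set algC) :=
  [set K : set algC | GRing.divring_closed (mem K)].

(* A subfield of [algC] contains Q, so this is Q(S).                          *)
Definition adjoin (S : set algC) : set algC := smallest subfield S.

Definition compositum (K L : set algC) : set algC := adjoin (K `|` L).

Lemma exists_prime_above (n : nat) : exists p, (n < p)%N && prime p.
Proof. by have [p np pp] := prime_above n; exists p; rewrite np. Qed.

Definition next_prime (n : nat) : nat := ex_minn (exists_prime_above n).

(* The (i+1)-th prime; as i = 0 gives 2, only the indices i >= 1 are used.    *)
Definition nth_prime (i : nat) : nat := iter i next_prime 2.

(* [Num.truncn] is the integer part of a nonnegative real.                    *)
Definition root_degree (R : realType) (i : nat) : nat :=
  Num.truncn (Num.sqrt (ln ((nth_prime i)%:R : R))).

(* On nonnegative reals [n.-root] is the nonnegative real n-th root.          *)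
Definition L1 (R : realType) : set algC :=
  adjoin [set (root_degree R i).-root (nth_prime i)%:R
         | i in [set i | (1 <= i)%N]].

Definition L2 (R : realType) : set algC :=
  adjoin [set (root_degree R i).+1.-root (nth_prime i)%:R
         | i in [set i | (1 <= i)%N]].

(* Main.v *)
(* Write K_i for the field generated by the first i radicals.  For a in K_i but
   not in K_(i-1), choose an automorphism sigma over K_(i-1) with sigma a <> a.
   As p_i is unramified in K_(i-1), expanding a in powers of p_i^(1/d) shows
   |a - sigma a| <= p_i^(-1/d) max(1,|a|) max(1,|sigma a|) above p_i, and the
   product formula yields p_i^(1/d) <= 2 H(a)^2.  As p_i^(1/d) tends to infinity,
   elements of bounded height lie in a fixed K_i, where there are finitely many
   of them.  The compositum contains the numbers p_i^(1/(d_i (d_i + 1))), whose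
   heights are at most e^2 because log p_i < (d_i + 1)^2.

   Lower bounds for the height only require that the local degree at v is at
   least the number of embeddings inducing v, and upper bounds only that the
   local degrees above infinity add up to at most the degree of the field. *)

Require Import Defs.
From HB Require Import structures.
From mathcomp Require Import all_boot all_order all_algebra all_field all_fingroup cyclic.
From mathcomp Require Import all_classical all_reals all_analysis.
From mathcomp Require Import ring lra zify.

Set Implicit Arguments.
Unset Strict Implicit.
Unset Printing Implicit Defensive.

Import Order.TTheory GRing.Theory Num.Theory.
Import numFieldNormedType.Exports.

Local Open Scope classical_set_scope.
Local Open Scope ring_scope.

(** * Absolute values and completions *)

(** No ideal theory enters. Each place of Q is extended once to [algC], over p by a subring that is
    maximal without 1/p and at infinity by Dedekind cuts. Lower bounds for heights use only the
    places obtained by composing these extensions with embeddings. A Vandermonde determinant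
    compares a local degree with the number of embeddings inducing the place, and weak approximation
    bounds sums of local degrees.

    That p_i is unramified in K_(i-1) is read off from a congruence y^N = y modulo p_i in the ring
    generated by the earlier radicals. It holds because p_i divides neither the earlier primes nor
    the earlier degrees, the latter since d_k + 1 <= p_k < p_i.

    The square root in d_i separates two scales. Property (N) needs C^(d_i + 1) < p_i for every C
    and all large i, which holds as d_i is of order sqrt(log p_i). The product d_i (d_i + 1) is of
    order log p_i, exactly the degree at which roots of p_i have bounded height. *)

Definition absval (R : realType) (K : fieldType) (v : K -> R) : Prop :=
  [/\ forall x, 0 <= v x,
      forall x, v x = 0 <-> x = 0,
      forall x y, v (x * y) = v x * v y &
      forall x y, v (x + y) <= v x + v y].

Section AbsVal.
Variables (R : realType) (K : fieldType) (v : K -> R).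
Hypothesis vP : absval v.

Lemma absval_ge0 x : 0 <= v x. Proof. by case: vP. Qed.

Lemma absval0 : v 0 = 0. Proof. by case: vP => _ /(_ 0)[_ ->]. Qed.

Lemma absval_eq0 x : (v x == 0) = (x == 0).
Proof. by case: vP => _ /(_ x) v0 _ _; apply/eqP/eqP => /v0. Qed.

Lemma absvalM x y : v (x * y) = v x * v y. Proof. by case: vP. Qed.

Lemma absvalD x y : v (x + y) <= v x + v y. Proof. by case: vP. Qed.

Lemma absval_gt0 x : (0 < v x) = (x != 0).
Proof. by rewrite lt_def absval_ge0 andbT absval_eq0. Qed.

Lemma absval1 : v 1 = 1.
Proof.
have v1 : v 1 != 0 by rewrite absval_eq0 oner_neq0.
by apply: (mulfI v1); rewrite -absvalM !mulr1.
Qed.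

Lemma absvalN1 : v (-1) = 1.
Proof.
have : v (-1) ^+ 2 == 1 by rewrite expr2 -absvalM mulrNN mulr1 absval1.
rewrite sqrf_eq1 => /orP[/eqP //|/eqP h].
by have := absval_ge0 (-1); rewrite h ler0N1.
Qed.

Lemma absvalN x : v (- x) = v x.
Proof. by rewrite -mulN1r absvalM absvalN1 mul1r. Qed.

Lemma absvalB x y : v (x - y) <= v x + v y.
Proof. by rewrite -(absvalN y) absvalD. Qed.

Lemma absval_distC x y : v (x - y) = v (y - x).
Proof. by rewrite -absvalN opprB. Qed.

Lemma absvalX x n : v (x ^+ n) = v x ^+ n.
Proof. by elim: n => [|n IHn]; rewrite ?expr0 ?absval1 // !exprS absvalM IHn. Qed.

Lemma absvalV x : v x^-1 = (v x)^-1.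
Proof.
have [->|x0] := eqVneq x 0; first by rewrite invr0 absval0 invr0.
have vx0 : v x != 0 by rewrite absval_eq0.
by apply: (mulfI vx0); rewrite -absvalM !divff // absval1.
Qed.

Lemma absval_prod I (r : seq I) (P : pred I) (f : I -> K) :
  v (\prod_(i <- r | P i) f i) = \prod_(i <- r | P i) v (f i).
Proof. by apply: big_morph; [exact: absvalM | exact: absval1]. Qed.

Lemma absval_sum I (r : seq I) (P : pred I) (f : I -> K) :
  v (\sum_(i <- r | P i) f i) <= \sum_(i <- r | P i) v (f i).
Proof.
elim/big_ind2: _ => [|x x' y y' hx hy|i _]; rewrite ?absval0 //.
exact: le_trans (absvalD _ _) (lerD hx hy).
Qed.

Lemma absval_triangle y x z : v (x - z) <= v (x - y) + v (y - z).
Proof. by rewrite -(subrKA y) absvalD. Qed.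

Lemma absval_near_ge x y : v y - v (x - y) <= v x.
Proof.
rewrite lerBlDr -{1}(subKr x y); exact: absvalB.
Qed.

End AbsVal.

Lemma absval_comp (R : realType) (K L : fieldType) (v : L -> R)
    (f : {rmorphism K -> L}) : absval v -> absval (v \o f).
Proof.
move=> vP; split=> /= [x|x|x y|x y]; first exact: absval_ge0.
- split=> [/eqP|->]; last by rewrite rmorph0 (absval0 vP).
  by rewrite (absval_eq0 vP) fmorph_eq0 => /eqP.
- by rewrite rmorphM (absvalM vP).
- by rewrite rmorphD (absvalD vP).
Qed.

Section VFree.
Variables (R : realType) (F : fieldExtType rat) (v : F -> R).
Hypothesis vP : absval v.
Let w := restrict_abs v.

Lemma restrict_absval : absval w.
Proof. exact: (absval_comp (in_alg F) vP). Qed.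

Lemma absvalZ a x : v (a *: x) = w a * v x.
Proof. by rewrite -mulr_algl (absvalM vP). Qed.

(* Linear independence over the completion of Q: by completeness of finite
   dimensional normed spaces it amounts to a lower bound on rational
   combinations. *)
Definition vfree_with (c : R) d (e : 'I_d -> F) : Prop :=
  forall (a : 'I_d -> rat) i, c * w (a i) <= v (\sum_j a j *: e j).

Definition vfree d (e : 'I_d -> F) : Prop := exists2 c, 0 < c & vfree_with c e.

Lemma vfree_size d (e : 'I_d -> F) : vfree e -> (d <= \dim {:F})%N.
Proof.
case=> c c0 ce; pose X := [tuple e i | i < d].
have fX : free X.
  apply/freeP => k k0 i; apply/eqP; rewrite -(absval_eq0 restrict_absval).
  have := ce k i; rewrite (eq_bigr (fun j => k j *: X`_j)); last first.
    by move=> j _; rewrite -tnth_nth tnth_mktuple.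
  rewrite k0 (absval0 vP) pmulr_rle0 // => h.
  by rewrite eq_le h (absval_ge0 restrict_absval).
have := fX; rewrite /free size_tuple => /eqP <-.
by rewrite dimvS // subvf.
Qed.

(** The distance [eps] controls the coefficient of the new vector. Removing that term, of size at
    most M times the coefficient, costs the other coefficients the factor 1 + M / eps. The bound M
    is kept apart from [v (e ord0)] so that the constant stays uniform when the vectors run along a
    Cauchy sequence. *)
Lemma vfree_with_ext d (e : 'I_d.+1 -> F) (c eps M : R) :
  0 < c -> 0 < eps -> 0 <= M -> v (e ord0) <= M ->
  vfree_with c (fun i => e (lift ord0 i)) ->
  (forall a : 'I_d -> rat, eps <= v (e ord0 - \sum_j a j *: e (lift ord0 j))) ->
  vfree_with (Num.min eps (c / (1 + M / eps))) e.
Proof.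
move=> c0 eps0 M0 vM cfree far a i.
rewrite big_ord_recl; set S := \sum_(_ < d) _.
have wP := restrict_absval.
have b_le : eps * w (a ord0) <= v (a ord0 *: e ord0 + S).
  have [->|b0] := eqVneq (a ord0) 0.
    by rewrite (absval0 wP) mulr0 (absval_ge0 vP).
  have -> : a ord0 *: e ord0 + S =
    a ord0 *: (e ord0 - \sum_j (- (a ord0)^-1 * a (lift ord0 j)) *: e (lift ord0 j)).
    rewrite scalerBr; congr (_ + _); rewrite scaler_sumr -sumrN.
    by apply: eq_bigr => j _; rewrite scalerA mulrA mulrN divff // mulN1r scaleNr opprK.
  by rewrite absvalZ mulrC ler_wpM2l ?(absval_ge0 wP).
have D0 : 0 < 1 + M / eps by rewrite ltr_wpDr // divr_ge0 // ltW.
case: (unliftP ord0 i) => [j|] ->; last first.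
  by apply: le_trans b_le; rewrite ler_wpM2r ?(absval_ge0 wP) // ge_min lexx.
apply: (@le_trans _ _ (c / (1 + M / eps) * w (a (lift ord0 j)))).
  by rewrite ler_wpM2r ?(absval_ge0 wP) // ge_min lexx orbT.
rewrite mulrAC ler_pdivrMr //.
apply: le_trans (cfree (fun j => a (lift ord0 j)) j) _; rewrite -/S.
have {1}-> : S = (a ord0 *: e ord0 + S) - a ord0 *: e ord0 by rewrite addrAC subrr add0r.
apply: le_trans (absvalB vP _ _) _.
rewrite mulrDr mulr1 lerD2l absvalZ.
apply: (@le_trans _ _ (w (a ord0) * M)); first by rewrite ler_wpM2l ?(absval_ge0 wP).
rewrite mulrCA mulrC ler_wpM2l // ler_pdivlMr //.
by rewrite mulrC.
Qed.

End VFree.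

Lemma invS_lt (R : realType) (eps : R) : 0 < eps ->
  exists N, forall n, (N <= n)%N -> n.+1%:R^-1 < eps.
Proof.
move=> eps0; exists (Num.truncn eps^-1) => n Nn.
rewrite -(invrK eps) ltf_pV2 ?posrE ?invr_gt0 //.
by apply: lt_le_trans (truncnS_gt _) _; rewrite ler_nat ltnS.
Qed.

Section CauchyNull.
Variables (R : realType) (V : zmodType) (w : V -> R).

Lemma cauchy_forP (x : nat -> V) :
  cauchy_for w x <-> forall e : R, 0 < e ->
    exists N, forall m n, (N <= m)%N -> (N <= n)%N -> w (x m - x n) < e.
Proof.
split=> [cx e e0 | cx e e0].
  have [[A B] /= [[N _ NA] [M _ MB]] AB] := cx e e0.
  exists (maxn N M) => m n; rewrite !geq_max => /andP[mN _] /andP[_ nM].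
  by apply: (AB (m, n)); split; [apply: NA | apply: MB].
have [N hN] := cx e e0.
exists ([set m | (N <= m)%N], [set m | (N <= m)%N]) => /=.
  by split; exists N.
by move=> [m n] /= [mN nN]; apply: hN.
Qed.

Lemma null_forP (x : nat -> V) : (forall y, 0 <= w y) ->
  null_for w x <-> forall e : R, 0 < e ->
    exists N, forall n, (N <= n)%N -> w (x n) < e.
Proof.
move=> w0; split=> [/cvgrPdist_lt nx e e0 | nx].
  have [N _ hN] := nx e e0; exists N => n Nn.
  by have := hN n Nn; rewrite /= sub0r normrN ger0_norm.
apply/cvgrPdist_lt => e e0; have [N hN] := nx e e0.
by exists N => // n Nn /=; rewrite sub0r normrN ger0_norm //; apply: hN.
Qed.

End CauchyNull.

Section CompletionBasis.
Variables (R : realType) (F : fieldExtType rat) (v : F -> R).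
Hypothesis vP : absval v.
Let w := restrict_abs v.
Let wP : absval w := restrict_absval vP.

Lemma cauchy_bounded (x : nat -> F) :
  cauchy_for v x -> exists N M, 0 <= M /\ forall n, (N <= n)%N -> v (x n) <= M.
Proof.
move=> /cauchy_forP /(_ 1 ltr01)[N hN]; exists N, (v (x N) + 1).
split=> [|n Nn]; first by rewrite addr_ge0 // (absval_ge0 vP).
have := absval_near_ge vP (x N) (x n); rewrite lerBlDr => /le_trans; apply.
by rewrite lerD2l ltW // hN.
Qed.

(** The k-th term of a Cauchy sequence is approximated within 1 / (k + 1) by a rational combination;
    the lower bound of [vfree] turns the closeness of these combinations into closeness of their
    coefficients. *)
Lemma vfree_dense_basis d (e : 'I_d -> F) : vfree v e ->
    (forall f eps, 0 < eps ->
       exists a : 'I_d -> rat, v (f - \sum_j a j *: e j) < eps) ->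
  completion_basis v (fun i (_ : nat) => e i).
Proof.
case=> c c0 ce dense; split.
- move=> i; apply/cauchy_forP => eps eps0; exists 0%N => m n _ _.
  by rewrite subrr (absval0 vP).
- move=> x /cauchy_forP cx.
  have /choice[a ha] : forall k, exists a : 'I_d -> rat,
      v (x k - \sum_j a j *: e j) < k.+1%:R^-1.
    by move=> k; apply: dense; rewrite invr_gt0.
  exists (fun i k => a k i); last first.
    apply/null_forP => [|eps eps0]; first exact: (absval_ge0 vP).
    have [N hN] := invS_lt eps0; exists N => n Nn.
    exact: lt_trans (ha n) (hN n Nn).
  move=> i; apply/cauchy_forP => eps eps0.
  (* The three errors c eps / 2, c eps / 4 and c eps / 4 add up to c eps, and the lower bound
     divides by c. *)
  have [N1 hN1] := cx (c * eps / 2) (divr_gt0 (mulr_gt0 c0 eps0) (ltr0n _ 2)).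
  have [N2 hN2] := @invS_lt R (c * eps / 4) (divr_gt0 (mulr_gt0 c0 eps0) (ltr0n _ 4)).
  exists (maxn N1 N2) => m n; rewrite !geq_max => /andP[m1 m2] /andP[n1 n2].
  rewrite -(ltr_pM2l c0).
  apply: le_lt_trans (ce (fun j => a m j - a n j) i) _.
  rewrite (eq_bigr (fun j => a m j *: e j - a n j *: e j)); last first.
    by move=> j _; rewrite scalerBl.
  rewrite sumrB; set S := \sum_j _; set T := \sum_j _.
  have h1 := absval_triangle vP (x m) S T; have h2 := absval_triangle vP (x n) (x m) T.
  have h3 := hN1 _ _ m1 n1; have h4 := hN2 _ m2; have h5 := hN2 _ n2.
  have h6 := ha m; have h7 := ha n; rewrite -/S -/T in h6 h7.
  rewrite (absval_distC vP) in h6.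
  have h8 := lt_trans h6 h4; have h9 := lt_trans h7 h5.
  by clear -h1 h2 h3 h8 h9; lra.
- move=> a _ /(null_forP _ (absval_ge0 vP)) na i; apply/null_forP => [|eps eps0];
  first exact: (absval_ge0 wP).
  have [N hN] := na (c * eps) (mulr_gt0 c0 eps0).
  exists N => n Nn; rewrite -(ltr_pM2l c0).
  exact: le_lt_trans (ce (fun j => a j n) i) (hN n Nn).
Qed.

(* A maximal [vfree] family is dense, since a vector at positive distance from
   its span would enlarge it. *)
Lemma completion_basis_exists :
  exists d (e : 'I_d -> nat -> F), completion_basis v e.
Proof.
pose P d := `[< exists e : 'I_d -> F, vfree v e >].
have P0 : exists d, P d.
  by exists 0%N; apply/asboolP; exists (fun=> 0), 1 => // a [].
have Pmax d : P d -> (d <= \dim {:F})%N.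
  by move=> /asboolP[e]; exact: vfree_size.
case: (ex_maxnP P0 Pmax) => d /asboolP[e [c c0 ce]] dmax.
exists d, (fun i _ => e i); apply: vfree_dense_basis; first by exists c.
move=> f eps eps0; apply: contrapT => /forallNP far.
suff : P d.+1 by move=> /dmax; rewrite ltnn.
apply/asboolP.
pose e' i := if unlift ord0 i is Some j then e j else f.
exists e', (Num.min eps (c / (1 + v f / eps))).
  rewrite lt_min eps0 divr_gt0 // ltr_wpDr // divr_ge0 ?(absval_ge0 vP) //.
  exact: ltW.
have e'0 : e' ord0 = f by rewrite /e' unlift_none.
have e'l i : e' (lift ord0 i) = e i by rewrite /e' liftK.
apply: vfree_with_ext => //; first exact: (absval_ge0 vP).
- by rewrite e'0.
- by move=> a i; rewrite (eq_bigr (fun j => a j *: e j)) // => j _; rewrite e'l.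
- move=> a; rewrite e'0 (eq_bigr (fun j => a j *: e j)); last by move=> j _; rewrite e'l.
  by rewrite leNgt; apply/negP; exact: far.
Qed.

(** Existence of a basis keeps [xget] from its default. The later estimates hold for every
    completion basis, hence for whichever size [xget] selects. *)
Lemma local_degreeP :
  exists e : 'I_(local_degree v) -> nat -> F, completion_basis v e.
Proof.
have [d [e he]] := completion_basis_exists.
have := @xgetPex _ 0%N [set d | exists e : 'I_d -> nat -> F, completion_basis v e].
by apply; exists d, e.
Qed.

(* Induction on d: rational combinations approaching the vector e ord0 have
   bounded, hence Cauchy, coefficients, and would yield a dependence relation
   between the e i in the completion. *)
Lemma completion_basis_vfree d (e : 'I_d -> nat -> F) :
    (forall i, cauchy_for v (e i)) ->
    (forall a : 'I_d -> nat -> rat,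
        (forall i, cauchy_for w (a i)) ->
        null_for v (fun k => \sum_(i < d) a i k *: e i k) ->
        forall i, null_for w (a i)) ->
  exists c, 0 < c /\ exists N, forall n, (N <= n)%N ->
    vfree_with v c (fun i => e i n).
Proof.
elim: d e => [|d IHd] e ce fe; first by exists 1; split=> //; exists 0%N => n _ a [].
have v0 := absval_ge0 vP; have w0 := absval_ge0 wP.
have [|b cb nb i|c [c0 [N0 cfree]]] := IHd (fun i => e (lift ord0 i)).
- by move=> i; apply: ce.
- have := fe (fun j => if unlift ord0 j is Some i then b i else fun=> 0).
  move=> /(_ _ _ (lift ord0 i)); rewrite liftK; apply.
    move=> j; case: unliftP => [k|] _ //; apply/cauchy_forP => eps eps0.
    by exists 0%N => m n _ _; rewrite subrr (absval0 wP).
  apply: cvg_trans nb; apply: near_eq_cvg; near=> k.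
  congr (v _); rewrite big_ord_recl unlift_none scale0r add0r.
  by apply: eq_bigr => j _; rewrite liftK.
have [N1 [M [M0 hM]]] := cauchy_bounded (ce ord0).
suff [eps [eps0 [N2 hN2]]] : exists eps, 0 < eps /\ exists N, forall n, (N <= n)%N ->
    forall a : 'I_d -> rat, eps <= v (e ord0 n - \sum_j a j *: e (lift ord0 j) n).
  exists (Num.min eps (c / (1 + M / eps))); split.
    rewrite lt_min eps0 divr_gt0 // ltr_wpDr // divr_ge0 //; exact: ltW.
  exists (maxn N0 (maxn N1 N2)) => n; rewrite !geq_max => /and3P[n0 n1 n2].
  by apply: vfree_with_ext => //; [apply: hM | apply: cfree | apply: hN2].
apply: contrapT => /forallNP near0.
have /choice[ka hka] : forall m : nat, exists ka : nat * ('I_d -> rat),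
    (maxn m (maxn N0 N1) <= ka.1)%N /\
    v (e ord0 ka.1 - \sum_j ka.2 j *: e (lift ord0 j) ka.1) < m.+1%:R^-1.
  move=> m; apply: contrapT => /forallNP h.
  apply: (near0 m.+1%:R^-1); split; first by rewrite invr_gt0.
  exists (maxn m (maxn N0 N1)) => n hn a; rewrite leNgt; apply/negP => lt.
  by apply: (h (n, a)).
pose k m := (ka m).1; pose a m := (ka m).2.
have km m : (m <= k m)%N by have [] := hka m; rewrite geq_max => /andP[].
have k0 m : (N0 <= k m)%N by have [] := hka m; rewrite !geq_max => /and3P[].
have k1 m : (N1 <= k m)%N by have [] := hka m; rewrite !geq_max => /and3P[].
have ha m : v (e ord0 (k m) - \sum_j a m j *: e (lift ord0 j) (k m)) < m.+1%:R^-1.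
  by have [] := hka m.
pose A := (M + 1) / c.
have A0 : 0 < A by rewrite divr_gt0 // ltr_wpDl.
have aA m i : w (a m i) <= A.
  rewrite ler_pdivlMr // mulrC; apply: le_trans (cfree _ (k0 m) (a m) i) _.
  set S := \sum_j _.
  have h1 := absvalB vP (e ord0 (k m)) (e ord0 (k m) - S); rewrite subKr in h1.
  apply: le_trans h1 _; apply: lerD; first exact: hM.
  apply: le_trans (ltW (ha m)) _; rewrite invf_le1 // ler1n //.
pose dlt (m n : nat) := v (e ord0 m - e ord0 n) +
  A * \sum_j v (e (lift ord0 j) m - e (lift ord0 j) n).
have dlt_small eps : 0 < eps ->
    exists N, forall m n, (N <= m)%N -> (N <= n)%N -> dlt m n < eps.
  move=> eps0.
  have /choice[Nf hNf] : forall i : 'I_d.+1, exists N, forall m n,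
      (N <= m)%N -> (N <= n)%N -> v (e i m - e i n) < eps / (1 + A * d.+1%:R).
    move=> i; have /cauchy_forP := ce i; apply.
    by rewrite divr_gt0 // ltr_wpDr // mulr_ge0 // ltW.
  exists (\max_i Nf i) => m n hm hn; rewrite /dlt.
  have h i : v (e i m - e i n) < eps / (1 + A * d.+1%:R).
    by apply: hNf; [apply: leq_trans hm | apply: leq_trans hn]; apply: leq_bigmax.
  set r := eps / _ in h.
  have le1 : \sum_j v (e (lift ord0 j) m - e (lift ord0 j) n) <= r * d%:R.
    rewrite mulr_natr -[d in leRHS]card_ord -sumr_const.
    by apply: ler_sum => j _; apply: ltW.
  have r0 : 0 < r by rewrite divr_gt0 // ltr_wpDr // mulr_ge0 // ltW.
  have -> : eps = r + A * (r * d.+1%:R).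
    rewrite /r; field; apply: lt0r_neq0; rewrite ltr_wpDr // mulr_ge0 // ltW //.
  apply: ltr_leD; first exact: h.
  rewrite ler_wpM2l // ?(ltW A0) //; apply: le_trans le1 _.
  by rewrite ler_wpM2l ?(ltW r0) // ler_nat.
(* A combination chosen at index [k m] remains good at later indices: its coefficients are bounded
   by A and the vectors are Cauchy. *)
have resid m n : (m <= n)%N ->
    v (e ord0 n - \sum_j a m j *: e (lift ord0 j) n) < m.+1%:R^-1 + dlt (k m) n.
  move=> mn.
  have -> : e ord0 n - \sum_j a m j *: e (lift ord0 j) n =
    (e ord0 (k m) - \sum_j a m j *: e (lift ord0 j) (k m)) -
    (e ord0 (k m) - e ord0 n) +
    \sum_j a m j *: (e (lift ord0 j) (k m) - e (lift ord0 j) n).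
    rewrite [X in _ = _ + X](eq_bigr (fun j => a m j *: e (lift ord0 j) (k m) -
                                            a m j *: e (lift ord0 j) n)).
      have alg (p q s t : F) : q - t = (p - s) - (p - q) + (s - t) by ring.
      by rewrite sumrB; exact: alg.
    by move=> j _; rewrite scalerBr.
  apply: le_lt_trans (absvalD vP _ _) _; rewrite /dlt addrA.
  apply: ltr_leD; last first.
    apply: le_trans (absval_sum vP _ _ _) _; rewrite mulr_sumr; apply: ler_sum => j _.
    by rewrite absvalZ // ler_wpM2r.
  apply: le_lt_trans (absvalB vP _ _) _; rewrite ltrD2r; exact: ha.
have resid_small eps : 0 < eps -> exists N, forall m n, (N <= m)%N -> (m <= n)%N ->
    v (e ord0 n - \sum_j a m j *: e (lift ord0 j) n) < eps.
  move=> eps0; have e20 : 0 < eps / 2 by rewrite divr_gt0.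
  have [Na hNa] := invS_lt e20; have [Nb hNb] := dlt_small _ e20.
  exists (maxn Na Nb) => m n; rewrite geq_max => /andP[ma mb] mn.
  apply: lt_trans (resid m n mn) _; rewrite [ltRHS](splitr eps); apply: ltrD.
    exact: hNa.
  by apply: hNb; [apply: leq_trans mb (km m) | apply: leq_trans mb mn].
(* This is the dependence relation in the completion. Its coefficient at [ord0] is constantly 1, so
   it is not null, contrary to [fe]. *)
pose b j m := if unlift ord0 j is Some i then - a m i else 1.
have cb j : cauchy_for w (b j).
  rewrite /b; apply/cauchy_forP => eps eps0; case: unliftP => [i|] _; last first.
    by exists 0%N => m n _ _; rewrite subrr (absval0 wP).
  have ce0 : 0 < c * eps / 2 by rewrite divr_gt0 // mulr_gt0.
  have [N hN] := resid_small _ ce0.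
  exists (maxn N0 N) => m n; rewrite !geq_max => /andP[m0 mN] /andP[n0 nN].
  set l := maxn m n.
  have l0 : (N0 <= l)%N by apply: leq_trans m0 (leq_maxl _ _).
  rewrite -(ltr_pM2l c0) -opprD (absvalN wP).
  apply: le_lt_trans (cfree l l0 (fun j => a m j - a n j) i) _.
  have h1 := hN m l mN (leq_maxl _ _); have h2 := hN n l nN (leq_maxr _ _).
  rewrite (eq_bigr (fun j => a m j *: e (lift ord0 j) l - a n j *: e (lift ord0 j) l)).
    rewrite sumrB; set S := \sum_j _ in h1 *; set T := \sum_j _ in h2 *.
    rewrite (absval_distC vP) in h1.
    have := absval_triangle vP (e ord0 l) S T; lra.
  by move=> j' _; rewrite scalerBl.
have nb : null_for v (fun n => \sum_j b j n *: e j n).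
  apply/null_forP => [//|eps eps0].
  have [N hN] := resid_small _ eps0; exists N => n Nn; rewrite /b.
  rewrite big_ord_recl unlift_none scale1r.
  rewrite (eq_bigr (fun j => - (a n j *: e (lift ord0 j) n))); last first.
    by move=> j _; rewrite liftK scaleNr.
  by rewrite sumrN; apply: hN.
have := fe b cb nb ord0;
  rewrite /b unlift_none => /(null_forP _ w0)/(_ 1 ltr01)[N /(_ N (leqnn N))].
by rewrite (absval1 wP) ltxx.
Unshelve. all: by end_near.
Qed.

End CompletionBasis.

(** * Weak approximation and the degree inequality *)

Lemma expr_unbounded (R : realType) (T a : R) : 1 < T -> exists k, a < T ^+ k.
Proof.
move=> T1; have T10 : 0 < T - 1 by rewrite subr_gt0.
have ber k : 1 + k%:R * (T - 1) <= T ^+ k.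
  elim: k => [|k IHk]; first by rewrite mul0r addr0 expr0.
  rewrite exprSr mulrSr; have h : 0 <= (k%:R : R) by [].
  have T0 : 0 <= T by lra.
  apply: le_trans (ler_wpM2r T0 IHk).
  have := mulr_ge0 h (sqr_ge0 (T - 1)); lra.
exists (Num.truncn (a / (T - 1))).+1; apply: lt_le_trans (ber _).
apply: ltr_wpDl => //; rewrite -ltr_pdivrMr //; exact: truncnS_gt.
Qed.

Lemma near_all (T : eqType) (s : seq T) (P : T -> nat -> Prop) :
  (forall x, x \in s -> \forall m \near \oo, P x m) ->
  \forall m \near \oo, forall x, x \in s -> P x m.
Proof.
elim: s => [|y s IHs] Ps; first by near=> m => x.
have Py := Ps y (mem_head y s).
have {}IHs : \forall m \near \oo, forall x, x \in s -> P x m.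
  by apply: IHs => x xs; apply: Ps; rewrite inE xs orbT.
near=> m => x; rewrite inE => /predU1P[->|xs]; first by near: m.
by move: x xs; near: m.
Unshelve. all: by end_near.
Qed.

Section Approximation.
Variables (R : realType) (K : fieldType).
Implicit Types v : K -> R.

Lemma expr_near0 (a b eps : R) : 0 <= a -> a < 1 -> 0 < eps ->
  \forall m \near \oo, a ^+ m * b < eps.
Proof.
move=> a0 a1 eps0.
have : (fun m => a ^+ m * b) @ \oo --> 0 * b.
  by apply: cvgMl; apply: cvg_expr; rewrite ger0_norm.
rewrite mul0r => /cvgrPdist_lt /(_ eps eps0).
apply: filterS => m; rewrite sub0r normrN; apply: le_lt_trans; exact: ler_norm.
Qed.

(** The approximate idempotent of weak approximation: as m grows it tends to 1 where x has absolute
    value above 1 and to 0 where it is below 1. *)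
Definition bump (x : K) m := x ^+ m / (1 + x ^+ m).

Lemma bump_near1 v x eps : absval v -> 1 < v x -> 0 < eps ->
  \forall m \near \oo, v (bump x m - 1) < eps.
Proof.
move=> vP x1 eps0; have x0 : 0 < v x by apply: lt_trans x1.
have := @expr_near0 (v x)^-1 (1 + eps^-1) 1.
rewrite invr_ge0 (ltW x0) invf_lt1 // => /(_ isT x1 ltr01).
apply: filterS => m; rewrite exprVn ltr_pdivrMl ?exprn_gt0 // mulr1 => xm.
have h : eps^-1 < v (1 + x ^+ m).
  rewrite addrC; have := absval_near_ge vP (x ^+ m + 1) (x ^+ m).
  rewrite addrAC subrr add0r (absval1 vP) (absvalX vP); lra.
have n0 : 1 + x ^+ m != 0.
  rewrite -(absval_gt0 vP); apply: lt_trans h; by rewrite invr_gt0.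
rewrite /bump -{2}(divff n0) -mulrBl opprD addrCA subrr addr0 mulN1r.
rewrite (absvalN vP) (absvalV vP) -(invrK eps) ltf_pV2 ?posrE ?invr_gt0 //.
by rewrite (absval_gt0 vP).
Qed.

Lemma bump_near0 v x eps : absval v -> v x < 1 -> 0 < eps ->
  \forall m \near \oo, v (bump x m) < eps.
Proof.
move=> vP x1 eps0.
(* The factor 1 + 1/eps is chosen so that a (1 + 1/eps) < 1 means a < eps (1 - a), with 1 - a the
   lower bound for the denominator. *)
apply: filterS (@expr_near0 (v x) (1 + eps^-1) 1 (absval_ge0 vP x) x1 ltr01).
move=> m; set a := v x ^+ m => am.
have a0 : 0 <= a by rewrite exprn_ge0 // (absval_ge0 vP).
have ie0 : 0 < eps^-1 by rewrite invr_gt0.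
have a1 : a < 1 by nra.
have h : 1 - a <= v (1 + x ^+ m).
  have := absval_near_ge vP (1 + x ^+ m) 1.
  by rewrite addrAC subrr add0r (absval1 vP) (absvalX vP).
have p0 : 0 < v (1 + x ^+ m) by lra.
rewrite /bump (absvalM vP) (absvalV vP) (absvalX vP) -/a ltr_pdivrMr //.
apply: (@lt_le_trans _ _ (eps * (1 - a))); last by rewrite ler_pM2l.
rewrite -(ltr_pM2l ie0) mulrA mulVf ?gt_eqF // mul1r; lra.
Qed.

(** Induction on s in the manner of Artin and Whaples. If x handles the tail and y handles the new
    v1, then x ^+ m * y works for large m when v1 x <= 1, and [bump x m * y] works when v1 x > 1,
    since the bump is then close to 1 at both v and v1. *)
Lemma separating_element v (s : seq (K -> R)) :
    absval v -> (exists x, 1 < v x) -> (forall v', v' \in s -> absval v') ->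
    (forall v', v' \in s -> exists2 x, v' x < 1 & 1 < v x) ->
  exists2 x, 1 < v x & forall v', v' \in s -> v' x < 1.
Proof.
move=> vP [x0 vx0]; elim: s => [|v1 s IHs] sP sep; first by exists x0.
have v1P : absval v1 by apply: sP; rewrite mem_head.
have {}IHs : exists2 x, 1 < v x & forall v', v' \in s -> v' x < 1.
  by apply: IHs => v' v's; [apply: sP | apply: sep]; rewrite inE v's orbT.
have {}sP v' : v' \in s -> absval v' by move=> v's; apply: sP; rewrite inE v's orbT.
have [y y1 vy] := sep v1 (mem_head _ _).
have [x vx sx] := IHs.
have [x1|x1] := leP (v1 x) 1.
  have : \forall m \near \oo, forall v', v' \in s -> v' (x ^+ m * y) < 1.
    apply: near_all => v' v's; have v'P := sP _ v's.
    apply: filterS (@expr_near0 (v' x) (v' y) 1 _ _ _) => //.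
    - by move=> m; rewrite (absvalM v'P) (absvalX v'P).
    - exact: absval_ge0.
    - exact: sx.
  case=> m _ /(_ m (leqnn m)) hm; exists (x ^+ m * y).
    rewrite (absvalM vP) (absvalX vP); apply: lt_le_trans vy _.
    by rewrite ler_peMl ?(absval_ge0 vP) // exprn_ege1 // ltW.
  move=> v'; rewrite inE => /predU1P[->|]; last exact: hm.
  rewrite (absvalM v1P) (absvalX v1P).
  apply: le_lt_trans (ler_piMl _ _) y1; first exact: absval_ge0.
  by rewrite exprn_ile1 // absval_ge0.
have e1 : \forall m \near \oo, forall v', v' \in s -> v' (bump x m * y) < 1.
  apply: near_all => v' v's; have v'P := sP _ v's.
  have d0 : 0 < (1 + v' y)^-1 by rewrite invr_gt0 ltr_wpDr // absval_ge0.
  apply: filterS (bump_near0 v'P (sx _ v's) d0) => m hm.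
  have : v' (bump x m) * (1 + v' y) < 1 by rewrite -ltr_pdivlMr ?div1r // -invr_gt0.
  rewrite (absvalM v'P); have := absval_ge0 v'P (bump x m); lra.
have vy0 : 0 < v y by apply: lt_trans vy.
have e2 : \forall m \near \oo, 1 < v (bump x m * y).
  have d0 : 0 < 1 - (v y)^-1 by rewrite subr_gt0 invf_lt1.
  apply: filterS (bump_near1 vP vx d0) => m hm.
  rewrite (absvalM vP) -ltr_pdivrMr // mul1r.
  have := absval_near_ge vP (bump x m) 1; rewrite (absval1 vP); lra.
have e3 : \forall m \near \oo, v1 (bump x m * y) < 1.
  have d0 : 0 < 1 - v1 y by rewrite subr_gt0.
  apply: filterS (bump_near1 v1P x1 d0) => m hm.
  rewrite (absvalM v1P).
  have h : v1 (bump x m) <= 1 + v1 (bump x m - 1).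
    by have := absvalD v1P 1 (bump x m - 1); rewrite (absval1 v1P) addrCA subrr addr0.
  have := absval_ge0 v1P y; have := absval_ge0 v1P (bump x m); nra.
have : \forall m \near \oo, 1 < v (bump x m * y) /\
    forall v', v' \in v1 :: s -> v' (bump x m * y) < 1.
  near=> m; split; first by near: m.
  move=> v'; rewrite inE => /predU1P[->|]; first by near: m.
  by move: v'; near: m.
by case=> m _ /(_ m (leqnn m))[h1 h2]; exists (bump x m * y).
Unshelve. all: by end_near.
Qed.

Lemma weak_approximation v (s : seq (K -> R)) eps : 0 < eps ->
    absval v -> (exists x, 1 < v x) -> (forall v', v' \in s -> absval v') ->
    (forall v', v' \in s -> exists2 x, v' x < 1 & 1 < v x) ->
  exists u, v (u - 1) < eps /\ forall v', v' \in s -> v' u < eps.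
Proof.
move=> eps0 vP v1 sP sep; have [x vx sx] := separating_element vP v1 sP sep.
have e1 := bump_near1 vP vx eps0.
have e2 : \forall m \near \oo, forall v', v' \in s -> v' (bump x m) < eps.
  by apply: near_all => v' v's; apply: bump_near0 => //; [apply: sP | apply: sx].
have : \forall m \near \oo, v (bump x m - 1) < eps /\
    forall v', v' \in s -> v' (bump x m) < eps.
  by near=> m; split; [near: m | near: m].
by case=> m _ /(_ m (leqnn m)) h; exists (bump x m).
Unshelve. all: by end_near.
Qed.

End Approximation.

Section PlacesAbove.
Variables (R : realType) (F : fieldExtType rat) (w : rat -> R).
Hypothesis w_nontrivial : exists t, 1 < w t.

(** If v x < v' x, a high power of x makes the ratio of the two values exceed w t, so some power of
    t falls between them; dividing by it separates v from v'. Equality of the restrictions is what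
    lets rational scalars shift both values alike. *)
Lemma absval_separate (v v' : F -> R) : absval v -> absval v' ->
  restrict_abs v = w -> restrict_abs v' = w -> v != v' -> exists2 x, v x < 1 & 1 < v' x.
Proof.
move=> vP v'P vw v'w vv'.
have [t t1] := w_nontrivial.
have wP : absval w by rewrite -vw; apply: restrict_absval.
have vz q x : v (q *: x) = w q * v x by rewrite absvalZ // vw.
have v'z q x : v' (q *: x) = w q * v' x by rewrite absvalZ // v'w.
suff key x : v x < v' x -> exists2 x, v x < 1 & 1 < v' x.
  have [x /eqP vx] : exists x, v x <> v' x.
    apply: contrapT => /forallNP h; move/eqP: vv'; apply; apply/funext => x.
    by apply: contrapT; apply: h.
  case: (ltrgtP (v x) (v' x)) vx => // h _; first exact: key h.
  have x0 : x != 0 by rewrite -(absval_gt0 vP); apply: le_lt_trans h; exact: absval_ge0.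
  apply: (key x^-1); rewrite (absvalV vP) (absvalV v'P) ltf_pV2 ?posrE ?absval_gt0 //.
move=> lt.
have [x0|x0] := eqVneq x 0; first by rewrite x0 (absval0 vP) (absval0 v'P) ltxx in lt.
(* With v x >= 1, the least k such that v x ^+ m < w t ^+ k is positive, so its predecessor gives
   the opposite inequality. *)
wlog x1 : x lt x0 / 1 <= v x.
  move=> th; have vx0 : 0 < v x by rewrite absval_gt0.
  have t0 : t != 0 by rewrite -(absval_gt0 wP); apply: lt_trans t1.
  have [j hj] := @expr_unbounded _ _ (v x)^-1 t1.
  have wt0 : 0 < w (t ^+ j) by rewrite (absval_gt0 wP) expf_neq0.
  apply: (th (t ^+ j *: x)).
  - by rewrite vz v'z ltr_pM2l.
  - by rewrite scaler_eq0 negb_or expf_neq0.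
  - by rewrite vz -ler_pdivrMr // div1r (absvalX wP) ltW.
have vx0 : 0 < v x by apply: lt_le_trans x1.
have [m hm] : exists m, w t < (v' x / v x) ^+ m.
  by apply: expr_unbounded; rewrite ltr_pdivlMr // mul1r.
have ex : exists k, v x ^+ m < w t ^+ k by apply: expr_unbounded.
case: (ex_minnP ex) => -[|k] hk kmin.
  by have := exprn_ege1 m x1; rewrite leNgt hk.
have wk : w t ^+ k <= v x ^+ m.
  by rewrite leNgt; apply/negP => /kmin; rewrite ltnn.
have wt0 : 0 < w t by apply: lt_trans t1.
have wk0 : 0 < w (t ^+ k.+1) by rewrite (absvalX wP) exprn_gt0.
exists ((t ^+ k.+1)^-1 *: x ^+ m).
  by rewrite vz (absvalV wP) (absvalX vP) ltr_pdivrMl // mulr1 (absvalX wP).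
rewrite v'z (absvalV wP) (absvalX v'P) ltr_pdivlMl // mulr1 (absvalX wP) exprSr.
apply: le_lt_trans (ler_wpM2r (ltW wt0) wk) _.
by rewrite mulrC -ltr_pdivlMr ?exprn_gt0 // -expr_div_n.
Qed.

(** Weak approximation replaces each vector of each family by some z in F that is close to it at its
    own place and close to 0 at the other places. With more such z than the dimension there is a
    rational relation among them; at the place that owns its largest coefficient, the relation
    contradicts the [vfree] lower bound. *)
Lemma sum_vfree_le r (vs : 'I_r -> F -> R) (d : 'I_r -> nat)
    (y : forall i, 'I_(d i) -> F) :
    injective vs -> (forall i, absval (vs i)) ->
    (forall i, restrict_abs (vs i) = w) -> (forall i, vfree (vs i) (@y i)) ->
  (\sum_i d i <= \dim {:F})%N.
Proof.
move=> vs_inj vsP vsw yfree.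
have [r0|r0] := posnP r; first by move: vs d y vs_inj vsP vsw yfree; rewrite r0 => *;
  rewrite big_ord0.
have wP : absval w by rewrite -(vsw (Ordinal r0)); apply: restrict_absval.
have {yfree}/choice[c hc] : forall i, exists c, 0 < c /\ vfree_with (vs i) c (@y i).
  by move=> i; have [c c0 ci] := yfree i; exists c.
pose T : finType := {i : 'I_r & 'I_(d i)}.
have cardT : #|T| = (\sum_i d i)%N.
  rewrite /T card_tagged sumnE big_map big_enum /=.
  by apply: eq_bigr => i _; rewrite card_ord.
rewrite -cardT leqNgt; apply/negP => dimT.
pose Y (t : T) : F := y (tag t) (tagged t).
(* The relation has #|T| terms, each with error at most eps times the largest coefficient, so #|T|
   eps has to stay below every c i. *)
pose eps := \big[Num.min/1]_i c i / #|T|.+1%:R.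
have eps0 : 0 < eps.
  by rewrite divr_gt0 //; elim/big_ind: _ => // [a b a0 b0|i _]; rewrite ?lt_min ?a0 //;
    case: (hc i).
have epsc i : #|T|%:R * eps < c i.
  have le : eps <= c i / #|T|.+1%:R.
    by rewrite ler_wpM2r ?invr_ge0 // bigmin_le_cond.
  apply: le_lt_trans (ler_wpM2l _ le) _ => //.
  rewrite mulrCA gtr_pMr ?(proj1 (hc i)) // ltr_pdivrMr // mul1r ltr_nat //.
have approx (t : T) : exists z : F, forall i,
    vs i (((tag t == i)%:R : F) * Y t - z) <= eps.
  pose i0 := tag t; pose B := 1 + \sum_i vs i (Y t).
  have S0 : 0 <= \sum_i vs i (Y t) by apply: sumr_ge0 => i _; apply: absval_ge0.
  have B0 : 0 < B by rewrite ltr_wpDr.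
  have vsB i : vs i (Y t) <= B.
    rewrite /B (bigD1 i) //= addrCA lerDl addr_ge0 //.
    by apply: sumr_ge0 => k _; apply: absval_ge0.
  pose s := [seq vs i | i <- enum 'I_r & i != i0].
  have [] := @weak_approximation R F (vs i0) s (eps / B) (divr_gt0 eps0 B0) (vsP i0).
  - have [q wq] := w_nontrivial; exists (q *: 1).
    by rewrite absvalZ // vsw (absval1 (vsP i0)) mulr1.
  - by move=> v' /mapP[i _ ->].
  - move=> v' /mapP[i]; rewrite mem_filter => /andP[ii0 _] ->.
    by apply: absval_separate => //; apply: contraNN ii0 => /eqP/vs_inj ->.
  move=> u [u1 us]; exists (u * Y t) => i.
  rewrite -mulrBl (absvalM (vsP i)).
  have hle : vs i ((i0 == i)%:R - u) <= eps / B.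
    have [<-|ii0] := eqVneq i0 i; first by rewrite (absval_distC (vsP i0)) ltW.
    rewrite sub0r (absvalN (vsP i)) ltW //; apply: us; apply/mapP; exists i => //.
    by rewrite mem_filter eq_sym ii0 mem_enum.
  apply: le_trans (ler_pM (absval_ge0 (vsP i) _) (absval_ge0 (vsP i) _) hle (vsB i)) _.
  by rewrite divfK // gt_eqF.
have /choice[z hz] := approx.
have [a [t1 at1] a0] : exists2 a : T -> rat, exists t, a t != 0 & \sum_t a t *: z t = 0.
  apply: contrapT => indep; pose X := [tuple z (enum_val i) | i < #|T|].
  have fX : free X.
    apply/freeP => k k0 i; apply: contrapT => /eqP ki.
    apply: indep; exists (fun t => k (enum_rank t)).
      by exists (enum_val i); rewrite enum_valK.
    rewrite -{}[RHS]k0 (reindex (@enum_val T T)); last first.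
      by apply: onW_bij; apply: enum_val_bij.
    by apply: eq_bigr => j _; rewrite enum_valK -tnth_nth tnth_mktuple.
  move: fX; rewrite /free size_tuple => /eqP dX.
  by have := dimvS (subvf <<X>>%VS); rewrite dX leqNgt dimT.
case: (@Order.TotalTheory.arg_maxP _ _ T t1 xpredT (fun t => w (a t))) => // t0 _ tmax.
have at0 : 0 < w (a t0).
  by apply: lt_le_trans (tmax t1 isT); rewrite (absval_gt0 wP).
pose tg i (j : 'I_(d i)) : T := Tagged (fun i => 'I_(d i)) j.
pose i0 := tag t0; have := (hc i0).2 (fun j => a (tg i0 j)) (tagged t0).
rewrite vsw; have -> : tg i0 (tagged t0) = t0 by rewrite /i0; case: (t0).
have -> : \sum_j a (tg i0 j) *: y i0 j =
    \sum_t a t *: (((tag t == i0)%:R : F) * Y t - z t).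
  rewrite (eq_bigr (fun t => a t *: (((tag t == i0)%:R : F) * Y t) - a t *: z t)); last first.
    by move=> t _; rewrite scalerBr.
  rewrite sumrB a0 subr0.
  pose G i (j : 'I_(d i)) := a (tg i j) *: (((i == i0)%:R : F) * y i j).
  transitivity (\sum_i \sum_j @G i j).
    rewrite (bigD1 i0) //= [X in _ + X]big1 ?addr0.
      by apply: eq_bigr => j _; rewrite /G eqxx mul1r.
    move=> i /negPf ii0; rewrite big1 // => j _.
    by rewrite /G ii0 mul0r scaler0.
  rewrite sig_big_dep /=; apply: eq_bigr => -[i j] _ //.
move=> le.
have := lt_le_trans (_ : #|T|%:R * eps * w (a t0) < c i0 * w (a t0)) le.
rewrite ltr_pM2r // => /(_ (epsc i0)); rewrite ltNge => /negP; apply.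
apply: le_trans (absval_sum (vsP i0) _ _ _) _.
rewrite -mulrA mulr_natl -sumr_const; apply: ler_sum => t _.
rewrite absvalZ // vsw mulrC; apply: ler_pM => //; first exact: absval_ge0.
- exact: absval_ge0.
- exact: tmax.
Qed.

End PlacesAbove.

(** * Extension of the usual absolute values to algebraic numbers *)

Definition subring (B : set algC) : Prop :=
  [/\ B 1, forall x y, B x -> B y -> B (x - y) & forall x y, B x -> B y -> B (x * y)].

Section Subring.
Variable B : set algC.
Hypothesis BP : subring B.

Lemma subring1 : B 1. Proof. by case: BP. Qed.
Lemma subringB x y : B x -> B y -> B (x - y). Proof. by case: BP => _ + _; apply. Qed.
Lemma subringM x y : B x -> B y -> B (x * y). Proof. by case: BP => _ _; apply. Qed.
Lemma subring0 : B 0. Proof. by rewrite -(subrr 1); apply: subringB; apply: subring1. Qed.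
Lemma subringN x : B x -> B (- x).
Proof. by move=> Bx; rewrite -sub0r; apply: subringB => //; apply: subring0. Qed.
Lemma subringD x y : B x -> B y -> B (x + y).
Proof. by move=> Bx By; rewrite -(opprK y); apply: subringB => //; apply: subringN. Qed.
Lemma subring_sum I (r : seq I) (P : pred I) (f : I -> algC) :
  (forall i, P i -> B (f i)) -> B (\sum_(i <- r | P i) f i).
Proof. by move=> h; elim/big_ind: _ => //; [exact: subring0 | exact: subringD]. Qed.
Lemma subringX x n : B x -> B (x ^+ n).
Proof.
move=> Bx; elim: n => [|n IHn]; first by rewrite expr0; apply: subring1.
by rewrite exprS; apply: subringM.
Qed.
Lemma subring_nat n : B n%:R.
Proof.
elim: n => [|n IHn]; first exact: subring0.
by rewrite mulrSr; apply: subringD => //; apply: subring1.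
Qed.
Lemma subring_int (n : int) : B n%:~R.
Proof.
case: n => n; first exact: subring_nat.
by rewrite NegzE mulrNz; apply/subringN/subring_nat.
Qed.

Definition coefs_in (f : {poly algC}) : Prop := forall i, B f`_i.

Lemma coefs_in1 : coefs_in 1.
Proof. by move=> i; rewrite coef1; apply: subring_nat. Qed.
Lemma coefs_inC c : B c -> coefs_in c%:P.
Proof. by move=> Bc i; rewrite coefC; case: ifP => _ //; apply: subring0. Qed.
Lemma coefs_inX : coefs_in 'X.
Proof. by move=> i; rewrite coefX; apply: subring_nat. Qed.
Lemma coefs_inXn n : coefs_in 'X^n.
Proof. by move=> i; rewrite coefXn; apply: subring_nat. Qed.
Lemma coefs_inB f g : coefs_in f -> coefs_in g -> coefs_in (f - g).
Proof. by move=> Bf Bg i; rewrite coefB; apply: subringB. Qed.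
Lemma coefs_inD f g : coefs_in f -> coefs_in g -> coefs_in (f + g).
Proof. by move=> Bf Bg i; rewrite coefD; apply: subringD. Qed.
Lemma coefs_inM f g : coefs_in f -> coefs_in g -> coefs_in (f * g).
Proof. by move=> Bf Bg i; rewrite coefM; apply: subring_sum => j _; apply: subringM. Qed.
Lemma coefs_inZ c f : B c -> coefs_in f -> coefs_in (c *: f).
Proof. by move=> Bc Bf i; rewrite coefZ; apply: subringM. Qed.
Lemma coefs_in_sum I (r : seq I) (P : pred I) (f : I -> {poly algC}) :
  (forall i, P i -> coefs_in (f i)) -> coefs_in (\sum_(i <- r | P i) f i).
Proof. by move=> h j; rewrite coef_sum; apply: subring_sum => i Pi; apply: h. Qed.

Definition ring_adjoin (x : algC) : set algC :=
  [set z | exists2 f, coefs_in f & z = f.[x]].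

Lemma ring_adjoinP x : subring (ring_adjoin x).
Proof.
split=> [|_ _ [f Bf ->] [g Bg ->]|_ _ [f Bf ->] [g Bg ->]].
- by exists 1; [exact: coefs_in1 | rewrite hornerC].
- by exists (f - g); [exact: coefs_inB | rewrite hornerD hornerN].
- by exists (f * g); [exact: coefs_inM | rewrite hornerM].
Qed.

Lemma sub_ring_adjoin x : B `<=` ring_adjoin x.
Proof. by move=> c Bc; exists c%:P; rewrite ?hornerC //; apply: coefs_inC. Qed.

Lemma ring_adjoin_gen x : ring_adjoin x x.
Proof. by exists 'X; rewrite ?hornerX //; apply: coefs_inX. Qed.

End Subring.

(** * Maximal subrings without 1/p are valuation rings *)

Section ValuationRing.
Variable p : nat.
Hypothesis p_prime : prime p.
Let pC : algC := p%:R.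

Let p0 : pC != 0. Proof. by rewrite pnatr_eq0 -lt0n prime_gt0. Qed.

Lemma exists_max_subring : exists O : set algC, [/\ subring O, ~ O pC^-1 &
  forall B, subring B -> O `<=` B -> ~ B pC^-1 -> B `<=` O].
Proof.
pose P (B : set algC) := B = set0 \/ subring B /\ ~ B pC^-1.
have intP : P [set x | x \in Num.int].
  right; split; first by split=> [|x y|x y] /=; [exact: rpred1 | exact: rpredB | exact: rpredM].
  move=> /= /intrP[m] hm.
  have : (pC * m%:~R == 1%:~R) by rewrite -hm divff.
  rewrite /pC pmulrn -intrM eqr_int => /eqP h.
  have /eqP : (p * `|m| = 1)%N by rewrite -[p in LHS](absz_nat p) -abszM h.
  rewrite muln_eq1 => /andP[/eqP p1 _]; by move: p_prime; rewrite p1.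
have [|O [PO Omax]] := @Zorn_bigcup algC P.
  move=> F FP tot.
  have [[X0 [FX0 X0n]]|triv] := pselect (exists X, F X /\ X <> set0); last first.
    left; rewrite -subset0 => x [X FX Xx]; apply: triv; exists X; split=> // Xe.
    by rewrite Xe in Xx.
  have ringF X x : F X -> X x -> subring X /\ ~ X pC^-1.
    by move=> FX Xx; case: (FP X FX) => // Xe; rewrite Xe in Xx.
  right; split; last first.
    by move=> [X FX Xp]; have [] := ringF X _ FX Xp.
  have join x y : (\bigcup_(X in F) X) x -> (\bigcup_(X in F) X) y ->
      exists X, [/\ F X, subring X, X x & X y].
    move=> [X FX Xx] [Y FY Yy]; have [XY|YX] := tot _ _ FX FY.
      by exists Y; split=> //; [have [] := ringF Y _ FY Yy | apply: XY].
    by exists X; split=> //; [have [] := ringF X _ FX Xx | apply: YX].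
  split.
  - have /set0P[x X0x] : X0 != set0 by apply/eqP.
    by exists X0 => //; have [[]] := ringF _ _ FX0 X0x.
  - move=> x y Fx Fy; have [X [FX XP Xx Xy]] := join x y Fx Fy.
    by exists X => //; apply: subringB.
  - move=> x y Fx Fy; have [X [FX XP Xx Xy]] := join x y Fx Fy.
    by exists X => //; apply: subringM.
case: PO => [e0 | [OP ONp]].
  case: (Omax [set x | x \in Num.int]) => //; rewrite e0; split=> //.
  by move=> /(_ 1) /= h; apply: h; apply: rpred1.
exists O; split=> // B BP OB Bp; apply: contrapT => nBO.
by apply: (Omax B); [split | right; split].
Qed.

Variable O : set algC.
Hypotheses (OP : subring O) (Op : ~ O pC^-1).
Hypothesis Omax : forall B, subring B -> O `<=` B -> ~ B pC^-1 -> B `<=` O.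

Lemma max_adjoin x : ~ O x ->
  exists2 f, coefs_in O f & pC * f.[x] = 1.
Proof.
move=> Ox; have [|h] := pselect (ring_adjoin O x pC^-1).
  by move=> [f Of fx]; exists f => //; rewrite -fx divff.
by case: Ox; apply: (Omax (ring_adjoinP OP x) (@sub_ring_adjoin _ OP x) h (ring_adjoin_gen OP x)).
Qed.

(** If u = 1 - p c had its inverse outside O, then 1/p would be a polynomial in 1/u over O. Clearing
    denominators puts u^n / p in O, and u^n = 1 modulo p then puts 1/p itself in O. *)
Lemma one_sub_unit c : O c -> O (1 - pC * c)^-1.
Proof.
move=> Oc; set u := 1 - pC * c; apply: contrapT => /max_adjoin[f Of fu].
have u0 : u != 0.
  apply/eqP => /subr0_eq h; apply: Op.
  by rewrite -(mulKf p0 c) -h mulr1 in Oc.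
have Ou : O u by apply: subringB => //; [apply: subring1 | apply: subringM => //;
  apply: subring_nat].
have Oun : O (u ^+ size f * pC^-1).
  have -> : pC^-1 = f.[u^-1] by rewrite -[RHS](mulKf p0) fu mulr1.
  rewrite horner_coef mulr_sumr; apply: subring_sum => // i _.
  rewrite mulrCA; apply: subringM => //.
  have -> : u ^+ size f * u^-1 ^+ i = u ^+ (size f - i).
    by rewrite exprVn expfB_cond // (negPf u0) add0n ltnW.
  exact: subringX.
have [c' Oc' uc'] : exists2 c', O c' & u ^+ size f = 1 - pC * c'.
  elim: (size f) => [|n [c' Oc' IH]].
    by exists 0; [apply: subring0 | rewrite mulr0 subr0].
  exists (c' + c * (1 - pC * c')).
    by rewrite -IH; apply: subringD => //; apply: subringM => //; apply: subringX.
  by rewrite exprS IH /u; ring.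
apply: Op; have -> : pC^-1 = u ^+ size f * pC^-1 + c'.
  by rewrite uc'; field.
exact: subringD.
Qed.

(* Otherwise 1 = p f(x) = p g(1/x) with f and g over O of minimal degrees, and
   the relation of smaller degree lowers the degree of the other one. *)
Lemma max_valuation x : O x \/ O x^-1.
Proof.
apply: contrapT => /not_orP[Ox OVx].
have x0 : x != 0 by apply/eqP => x0; apply: Ox; rewrite x0; apply: subring0.
pose Q y n := `[< exists f, [/\ coefs_in O f, (size f <= n)%N & pC * f.[y] = 1] >].
have exQ y : ~ O y -> exists n, Q y n.
  by move=> /max_adjoin[f Of fy]; exists (size f); apply/asboolP; exists f.
(* The roles of x and 1/x are symmetric, so it suffices to shorten the longer of the two minimal
   relations. *)
suff key y n t : ~ O y -> y != 0 -> Q y n -> (forall k, Q y k -> (n <= k)%N) ->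
    Q y^-1 t -> (t <= n)%N -> False.
  case: (ex_minnP (exQ _ Ox)) => n Qn nmin; case: (ex_minnP (exQ _ OVx)) => t Qt tmin.
  have [tn|nt] := leqP t n; first exact: (key x n t).
  apply: (key x^-1 t n) => //; rewrite ?invr_eq0 ?invrK //; exact: ltnW.
move=> {Ox OVx x0} Oy y0 /asboolP[f [Of sf fy]] nmin /asboolP[g [Og sg gy]] tn.
case: n => [|n] in sf nmin tn *.
  move: sf fy; rewrite leqn0 size_poly_eq0 => /eqP ->; rewrite horner0 mulr0.
  by move/esym/eqP; rewrite oner_eq0.
pose u := (1 - pC * g`_0)^-1; have Ou : O u by apply: one_sub_unit.
have OpC : O pC by apply: subring_nat.
have u0 : 1 - pC * g`_0 != 0.
  apply/eqP => /subr0_eq h; apply: Op.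
  by rewrite -[pC^-1]mulr1 h mulKf.
(* Moving the constant term of 1 = p g(1/y) to the left gives the unit 1 - p g_0. Multiplying by its
   inverse u and by y^n expresses y^n as a polynomial in y of degree below n, which removes the
   leading term of f. *)
pose h := \sum_(1 <= j < t) (pC * u * g`_j) *: 'X^(n - j) : {poly algC}.
have Oh : coefs_in O h.
  apply: coefs_in_sum => // j _; apply: coefs_inZ => //.
    by apply: subringM => //; apply: subringM.
  exact: coefs_inXn.
have hy : h.[y] = y ^+ n.
  have gE : g.[y^-1] = g`_0 + \sum_(1 <= j < t) g`_j * y^-1 ^+ j.
    case: t => [|t] in sg tn h Oh *.
      move: sg; rewrite leqn0 size_poly_eq0 => /eqP ->.
      by rewrite horner0 coef0 big_geq // addr0.
    rewrite (horner_coef_wide _ sg) -(big_mkord xpredT (fun j => g`_j * y^-1 ^+ j)).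
    by rewrite big_nat_recl // expr0 mulr1 big_add1.
  have e1 : \sum_(1 <= j < t) pC * u * g`_j * y^-1 ^+ j = 1.
    transitivity (u * (pC * (g.[y^-1] - g`_0))).
      rewrite gE addrAC subrr add0r !mulr_sumr; apply: eq_bigr => j _; ring.
    by rewrite mulrBr gy mulVf.
  rewrite -[RHS]mulr1 -e1 mulr_sumr /h horner_sum.
  apply: eq_big_nat => j /andP[j1 jt]; rewrite hornerZ hornerXn.
  have jn : (j <= n)%N by rewrite -ltnS (leq_trans jt).
  rewrite mulrCA; congr (_ * _).
  by rewrite -{2}(subnK jn) exprD -mulrA exprVn divff ?mulr1 // expf_neq0.
have sh : (size h <= n)%N.
  rewrite /h big_nat_cond; elim/big_ind: _ => [|a b ha hb|j /andP[/andP[j1 jt] _]].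
  - by rewrite size_poly0.
  - by apply: leq_trans (size_polyD _ _) _; rewrite geq_max ha.
  apply: leq_trans (size_scale_leq _ _) _; rewrite size_polyXn.
  have : (j <= n)%N by rewrite -ltnS (leq_trans jt).
  by lia.
suff : (n.+1 <= n)%N by rewrite ltnn.
apply: nmin; apply/asboolP.
pose f' := \poly_(i < n) f`_i; exists (f' + f`_n *: h); split.
- apply: coefs_inD => //; last by apply: coefs_inZ.
  by move=> i; rewrite coef_poly; case: ifP => _ //; apply: subring0.
- apply: leq_trans (size_polyD _ _) _; rewrite geq_max size_poly /=.
  exact: leq_trans (size_scale_leq _ _) sh.
- rewrite -fy hornerD hornerZ hy (horner_coef_wide _ sf) big_ord_recr /= -/(f'.[y]).
  by rewrite horner_poly.
Qed.

(** A Bezout relation a b = 1 + c p makes a b invertible in O by [one_sub_unit], and 1/b = a / (a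
    b). *)
Lemma max_unit_nat b : coprime p b -> O b%:R^-1.
Proof.
move=> pb; have pgt : (0 < p)%N by apply: prime_gt0.
have b0 : (0 < b)%N by case: b pb => // ; rewrite /coprime gcdn0 => /eqP pp; move: p_prime;
  rewrite pp.
case: (egcdnP p b0) => a c e _.
have {e} e : (a * b = c * p + 1)%N by move: e; rewrite gcdnC (eqP pb).
have : O ((a * b)%N%:R : algC)^-1.
  rewrite e natrD natrM.
  have -> : (c%:R * p%:R + 1 : algC) = 1 - pC * - c%:R by rewrite /pC; ring.
  by apply: one_sub_unit; apply: subringN => //; apply: subring_nat.
move=> h; have -> : (b%:R^-1 : algC) = a%:R * (a * b)%N%:R^-1.
  have a0 : a != 0%N by move: e; case: (a) => //; rewrite mul0n addn1.
  rewrite natrM; field; rewrite !pnatr_eq0 a0 -lt0n b0 //.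
apply: subringM => //; exact: subring_nat.
Qed.

End ValuationRing.

(** * From the valuation ring to the p-adic absolute value on algC *)

Section PadicExtension.
Variables (R : realType) (p : nat).
Hypothesis p_prime : prime p.
Let pC : algC := p%:R.
Let p0 : pC != 0. Proof. by rewrite pnatr_eq0 -lt0n prime_gt0. Qed.

Variable O : set algC.
Hypotheses (OP : subring O) (Op : ~ O pC^-1) (Oval : forall x, O x \/ O x^-1).
Hypothesis Ocoprime : forall b, coprime p b -> O b%:R^-1.

Definition vunit (x : algC) := [/\ x != 0, O x & O x^-1].

Lemma vunitM x y : vunit x -> vunit y -> vunit (x * y).
Proof. by move=> [? ? ?] [? ? ?]; split; rewrite ?mulf_neq0 ?invfM //; apply: subringM. Qed.

Lemma vunitV x : vunit x -> vunit x^-1.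
Proof. by move=> [? ? ?]; split; rewrite ?invr_eq0 ?invrK. Qed.

Lemma vunitX x n : vunit x -> vunit (x ^+ n).
Proof. by move=> [? ? ?]; split; rewrite ?expf_neq0 -?exprVn //; apply: subringX. Qed.

Lemma vunitN1 : vunit (-1).
Proof. by split; rewrite ?invrN1 ?oppr_eq0 ?oner_neq0 //; apply: subringN => //;
  apply: subring1. Qed.

Lemma vunit_nat n : (0 < n)%N -> vunit (n%:R / pC ^ (logn p n)%:Z).
Proof.
move=> n0; have [m pm {1}->] := pfactor_coprime p_prime n0.
rewrite natrM natrX -exprnP mulfK ?expf_neq0 //.
split; [|exact: subring_nat | exact: Ocoprime].
rewrite pnatr_eq0; apply: contraL pm => /eqP ->.
by rewrite /coprime gcdn0; apply: contraL p_prime => /eqP ->.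
Qed.

Lemma vunit_int (n : int) : n != 0 -> vunit (n%:~R / pC ^ (logn p `|n|)%:Z).
Proof.
move=> n0; have {n0} : (0 < `|n|)%N by rewrite absz_gt0.
case: n => n n0; first exact: vunit_nat.
rewrite NegzE abszN mulrNz -mulN1r -mulrA; apply: vunitM; first exact: vunitN1.
exact: vunit_nat.
Qed.

Definition padic_val (q : rat) : int := (logn p `|numq q|)%:Z - (logn p `|denq q|)%:Z.

Lemma vunit_rat (q : rat) : q != 0 -> vunit (ratr q / pC ^ padic_val q).
Proof.
move=> q0; rewrite /ratr /padic_val expfzDr // -invr_expz.
have -> : ((numq q)%:~R / (denq q)%:~R / (pC ^ (logn p `|numq q|)%:Z / pC ^ (logn p `|denq q|)%:Z) =
  (numq q)%:~R / pC ^ (logn p `|numq q|)%:Z * ((denq q)%:~R / pC ^ (logn p `|denq q|)%:Z)^-1 :>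
    algC).
  by rewrite !invfM invrK; ring.
apply: vunitM; first by apply: vunit_int; rewrite numq_eq0.
by apply/vunitV/vunit_int.
Qed.

(** Membership of t z / t y in O says that t z is no larger than t y, which by [Oval] is a total
    preorder on nonzero elements. *)
Lemma vmax_exists (I : eqType) (s : seq I) (t : I -> algC) :
    s != [::] -> (forall y, y \in s -> t y != 0) ->
  exists2 y, y \in s & forall z, z \in s -> O (t z / t y).
Proof.
elim: s => // y s IHs _ s0.
have y0 : t y != 0 by apply: s0; rewrite mem_head.
have Oyy x : t x != 0 -> O (t x / t x) by move=> x0; rewrite divff //; apply: subring1.
case: s => [|x s] in IHs s0 *.
  by exists y; rewrite ?mem_head // => z; rewrite inE => /eqP ->; apply: Oyy.
have [//|u us|m ms mmax] := IHs; first by apply: s0; rewrite inE us orbT.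
have m0 : t m != 0 by apply: s0; rewrite inE ms orbT.
case: (Oval (t y / t m)) => [h|h].
  exists m; first by rewrite inE ms orbT.
  by move=> z; rewrite inE => /predU1P[->|/mmax].
exists y; first by rewrite mem_head.
move=> z; rewrite inE => /predU1P[->|/mmax hz]; first exact: Oyy.
rewrite invf_div in h; have -> : t z / t y = t z / t m * (t m / t y) by rewrite mulrA divfK.
exact: subringM.
Qed.

Lemma vnonunit_add x y : O x -> O y -> ~ vunit x -> ~ vunit y -> ~ vunit (x + y).
Proof.
move=> Ox Oy; wlog : x y Ox Oy / O (x / y).
  move=> th nx ny; case: (Oval (x / y)) => [h|h]; first exact: th.
  by rewrite addrC; apply: th => //; rewrite invf_div in h.
move=> Oxy nx ny [s0 _ Oxy1].
have [y0|y0] := eqVneq y 0.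
  by apply: nx; split=> //; move: s0 Oxy1; rewrite y0 addr0.
apply: ny; split=> //.
have -> : y^-1 = (x / y + 1) * (x + y)^-1.
  by rewrite -[X in _ + X](divff y0) -mulrDl mulrAC divff // mul1r.
by apply: subringM => //; apply: subringD => //; apply: subring1.
Qed.

(** After division by t i0 the other terms lie in O and sum to the unit -1, so they cannot all be
    non-units. *)
Lemma vunit_sum0 (I : finType) (t : I -> algC) i0 : t i0 != 0 ->
  \sum_i t i = 0 -> (forall i, O (t i / t i0)) -> exists2 i, i != i0 & vunit (t i / t i0).
Proof.
move=> t0 s0 tO; apply: contrapT => none.
have : ~ vunit (\sum_(i | i != i0) t i / t i0) /\ O (\sum_(i | i != i0) t i / t i0).
  elim/big_ind: _ => [|x y [nx Ox] [ny Oy]|i ii0].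
  - by split; [case=> /eqP | apply: subring0].
  - by split; [apply: vnonunit_add | apply: subringD].
  - by split=> // ti; apply: none; exists i.
case=> + _; apply.
have -> : \sum_(i | i != i0) t i / t i0 = -1.
  move: s0; rewrite (bigD1 i0) //= => /eqP; rewrite addrC addr_eq0 => /eqP s0.
  by rewrite -mulr_suml s0 mulNr divff.
exact: vunitN1.
Qed.

(* In the vanishing sum given by the minimal polynomial, two terms have the same
   maximal valuation. *)
Lemma vunit_torsion x : x != 0 ->
  exists (m : nat) (k : int), (0 < m)%N /\ vunit (x ^+ m / pC ^ k).
Proof.
move=> x0; have [q [_ mon_q] qP] := minCpolyP x.
have /eqP rq : root (map_poly ratr q : {poly algC}) x by rewrite qP.
have qn0 : q != 0 by apply: monic_neq0.
pose t (i : 'I_(size q)) : algC := ratr q`_i * x ^+ i.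
have t0 i : (t i != 0) = (q`_i != 0).
  by rewrite mulf_eq0 negb_or expf_neq0 // andbT fmorph_eq0.
have sum_t : \sum_i t i = 0.
  rewrite -[RHS]rq (@horner_coef_wide _ (size q)) ?size_poly //.
  by apply: eq_bigr => i _; rewrite coef_map.
have szq : (0 < size q)%N by rewrite size_poly_gt0.
pose s := [seq i <- enum 'I_(size q) | t i != 0].
have [| |i0 i0s imax] := @vmax_exists _ s t.
- have lt : ((size q).-1 < size q)%N by rewrite prednK.
  have : Ordinal lt \in s.
    by rewrite mem_filter mem_enum t0 /= -lead_coefE lead_coef_eq0 qn0.
  by case: s.
- by move=> y; rewrite mem_filter => /andP[].
have ti0 : t i0 != 0 by move: i0s; rewrite mem_filter => /andP[].
have tO i : O (t i / t i0).
  have [->|ti] := eqVneq (t i) 0; first by rewrite mul0r; apply: subring0.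
  by apply: imax; rewrite mem_filter ti mem_enum.
have [i ii0 ui] := vunit_sum0 ti0 sum_t tO.
have ti : t i != 0 by case: ui => + _ _; apply: contraNneq => ->; rewrite mul0r.
(* The two terms agree up to a unit and their rational coefficients are powers of p up to units;
   hence so is x^(i - i0). *)
have {ui} : vunit (x ^+ i / x ^+ i0 / pC ^ (padic_val q`_i0 - padic_val q`_i)).
  have h1 := @vunit_rat q`_i; have h2 := @vunit_rat q`_i0.
  rewrite -!t0 in h1 h2; have {}h1 := h1 ti; have {}h2 := h2 ti0.
  have := vunitM (vunitM ui (vunitV h1)) h2; congr vunit.
  have eD (a b : int) : pC ^ (a - b) = pC ^ a / pC ^ b by rewrite expfzDr // invr_expz.
  rewrite /t eD.
  have n1 : ratr q`_i != 0 :> algC by rewrite fmorph_eq0 -t0.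
  have n2 : ratr q`_i0 != 0 :> algC by rewrite fmorph_eq0 -t0.
  have n3 : pC ^ padic_val q`_i != 0 by apply: expfz_neq0.
  have n4 : pC ^ padic_val q`_i0 != 0 by apply: expfz_neq0.
  move: (ratr q`_i) (ratr q`_i0) (pC ^ padic_val _) (pC ^ padic_val _) n1 n2 n3 n4.
  move=> a b c d n1 n2 n3 n4.
  by field; rewrite n1 n2 n3 n4 !expf_neq0.
set k := _ - _ => ui.
case: (ltngtP i i0) => [lt|gt|/val_inj e]; last by rewrite e eqxx in ii0.
  exists (i0 - i)%N, (- k); rewrite subn_gt0; split=> //.
  have := vunitV ui; congr vunit; rewrite expfB // -invr_expz !invfM !invrK.
  by rewrite [_^-1 * _]mulrC.
exists (i - i0)%N, k; rewrite subn_gt0; split=> //.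
by rewrite expfB.
Qed.

(** The valuation normalised to be 1 at p. By [vunit_torsion] every nonzero x has a power equal to a
    power of p up to a unit, so rational values suffice. *)
Definition has_val (x : algC) (r : R) := exists (m : nat) (k : int),
  [/\ (0 < m)%N, vunit (x ^+ m / pC ^ k) & r = k%:~R / m%:R].

Lemma has_valM x y r s : has_val x r -> has_val y s -> has_val (x * y) (r + s).
Proof.
move=> [m [k [m0 uk ->]]] [n [l [n0 ul ->]]].
exists (m * n)%N, (k * n + l * m); split; first by rewrite muln_gt0 m0.
  have := vunitM (vunitX n uk) (vunitX m ul); congr vunit.
  rewrite exprMn expfzDr // invfM !expr_div_n -!exprM [(n * m)%N]mulnC -!exprz_exp.
  by rewrite -!exprnP exprMn exprVn; ring.
have nm : (m%:R != 0 :> R) by rewrite pnatr_eq0 -lt0n.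
have nn : (n%:R != 0 :> R) by rewrite pnatr_eq0 -lt0n.
by rewrite rmorphD !rmorphM /= -!pmulrn; field; rewrite nm nn.
Qed.

Lemma has_valV x r : has_val x r -> has_val x^-1 (- r).
Proof.
move=> [m [k [m0 uk ->]]]; exists m, (- k); split=> //.
  by have := vunitV uk; congr vunit; rewrite exprVn -invr_expz invfM.
by rewrite rmorphN mulNr.
Qed.

Lemma natp_unit n : O (pC ^- n) -> n = 0%N.
Proof.
case: n => // n h; case: Op; have -> : pC^-1 = pC ^+ n * pC ^- n.+1.
  by rewrite exprS invfM mulrCA divff ?mulr1 // expf_neq0.
by apply: subringM => //; apply: subringX => //; apply: subring_nat.
Qed.

Lemma has_val_ge0 x r : x != 0 -> has_val x r -> O x <-> 0 <= r.
Proof.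
move=> x0 [m [k [m0 [_ uk ukV] ->]]].
rewrite pmulr_lge0 ?invr_gt0 ?ltr0n // ler0z.
have xm0 : x ^+ m != 0 by rewrite expf_neq0.
have pk0 : pC ^ k != 0 by rewrite expfz_neq0.
split=> [Ox|k0].
  have : O (pC ^ k).
    have -> : pC ^ k = x ^+ m * (x ^+ m / pC ^ k)^-1 by rewrite invf_div mulrC divfK.
    by apply: subringM => //; apply: subringX.
  case: k {uk ukV pk0} => // k; rewrite NegzE -exprnN => /natp_unit.
  by [].
have Oxm : O (x ^+ m).
  rewrite -(divfK pk0 (x ^+ m)); apply: subringM => //.
  by case: k k0 {uk ukV pk0} => // k _; apply: subringX => //; apply: subring_nat.
(* Integral closedness: with 1/x in O, x is recovered from x^m by multiplying with powers of 1/x. *)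
case: (Oval x) => // Ox1; have -> : x = x ^+ m * x^-1 ^+ m.-1.
  by rewrite -{1}(prednK m0) exprS -mulrA exprVn divff ?mulr1 // expf_neq0.
by apply: subringM => //; apply: subringX.
Qed.

Lemma has_val_uniq x r s : x != 0 -> has_val x r -> has_val x s -> r = s.
Proof.
move=> x0 hr hs.
have h1 := has_valM hr (has_valV hs); have h2 := has_valM hs (has_valV hr).
rewrite divff // in h1 h2; apply/eqP; rewrite eq_le; apply/andP; split.
  by rewrite -subr_ge0; apply/(has_val_ge0 (oner_neq0 _) h2); exact: subring1.
by rewrite -subr_ge0; apply/(has_val_ge0 (oner_neq0 _) h1); exact: subring1.
Qed.

Lemma vunit_padic : exists v : algC -> R,
  [/\ absval v, forall q, v (ratr q) = padic_abs R p q &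
      forall x y, v (x + y) <= Num.max (v x) (v y)].
Proof.
have /choice[f hf] : forall x : algC, exists r, x != 0 -> has_val x r.
  move=> x; have [->|x0] := eqVneq x 0; first by exists 0.
  by have [m [k [m0 h]]] := vunit_torsion x0; exists (k%:~R / m%:R) => _; exists m, k.
pose v x := if x == 0 then 0 else (p%:R : R) `^ (- f x).
have pR1 : 1 < (p%:R : R) by rewrite ltr1n prime_gt1.
have pR0 : 0 < (p%:R : R) by apply: lt_trans pR1.
have v0 x : 0 <= v x by rewrite /v; case: ifP => // _; apply: powR_ge0.
have fM x y : x != 0 -> y != 0 -> f (x * y) = f x + f y.
  move=> x0 y0; have xy0 : x * y != 0 by rewrite mulf_neq0.
  exact: (has_val_uniq xy0 (hf _ xy0) (has_valM (hf _ x0) (hf _ y0))).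
have vM x y : v (x * y) = v x * v y.
  rewrite /v mulf_eq0; have [|x0] := eqVneq x 0; first by rewrite mul0r.
  have [|y0] := eqVneq y 0; first by rewrite mulr0.
  rewrite /= fM // opprD powRD //; apply/implyP => _; by rewrite gt_eqF.
have v1 x : x != 0 -> v x <= 1 <-> O x.
  move=> x0; rewrite (has_val_ge0 x0 (hf _ x0)) /v (negPf x0).
  rewrite /powR gt_eqF // -[leRHS]expR0 ler_expR mulNr oppr_le0.
  by rewrite pmulr_lge0 ?ln_gt0 //; split.
have v00 : v 0 = 0 by rewrite /v eqxx.
have vmax x y : v (x + y) <= Num.max (v x) (v y).
  wlog xy : x y / v x <= v y.
    move=> th; case/orP: (le_total (v x) (v y)) => h; first exact: th.
    by rewrite addrC maxC th.
  rewrite (max_idPr xy); have [y0|y0] := eqVneq y 0.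
    by rewrite {1}y0 addr0.
  have [xy0|xy0] := eqVneq (x + y) 0; first by rewrite xy0 v00.
  have xyE : x + y = (x / y + 1) * y by rewrite mulrDl divfK // mul1r.
  rewrite xyE vM ler_piMl //.
  have z0 : x / y + 1 != 0.
    by apply: contraNneq xy0 => z0; rewrite xyE z0 mul0r.
  apply/v1 => //; apply: subringD => //; last exact: subring1.
  have [->|x0] := eqVneq x 0; first by rewrite mul0r; apply: subring0.
  apply/v1; first by rewrite mulf_neq0 ?invr_eq0.
  have vy0 : 0 < v y by rewrite /v (negPf y0) powR_gt0.
  rewrite -(ler_pM2r vy0) -vM divfK // mul1r //.
exists v; split=> //.
  split=> // x; first last.
    by move=> y; apply: le_trans (vmax x y) _; rewrite ge_max lerDl lerDr !v0.
  split=> [|->]; rewrite ?v00 // /v; case: eqP => // _ /eqP.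
  by rewrite gt_eqF // powR_gt0.
move=> q; rewrite /v fmorph_eq0 /padic_abs; case: eqVneq => // q0.
have hq : has_val (ratr q) (padic_val q)%:~R.
  by exists 1%N, (padic_val q); split; rewrite ?divr1 //; apply: vunit_rat.
have qC0 : ratr q != 0 :> algC by rewrite fmorph_eq0.
rewrite (has_val_uniq qC0 (hf _ qC0) hq) -rmorphN /= powR_intmul ?ltW //.
by rewrite /padic_val opprB.
Qed.

End PadicExtension.

Lemma padic_extension (R : realType) p : prime p -> exists v : algC -> R,
  [/\ absval v, forall q, v (ratr q) = padic_abs R p q &
      forall x y, v (x + y) <= Num.max (v x) (v y)].
Proof.
move=> pp; have [V [VP Vp Vmax]] := exists_max_subring pp.
apply: (@vunit_padic R p pp V) => //.
- exact: max_valuation Vmax.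
- exact: max_unit_nat Vmax.
Qed.

(** * The archimedean absolute value through Dedekind cuts *)

Section ArchimedeanExtension.
Variable R : realType.
Implicit Types x y : algC.

(** Carries a nonnegative real algebraic number to the element of [R] with the same rational lower
    cut; applied to the modulus on [algC], it gives the absolute value with values in [R]. *)
Definition cut (x : algC) : R := sup [set ratr q | q in [set q : rat | ratr q <= x]].

Lemma cut_has_sup x : 0 <= x -> has_sup [set (ratr q : R) | q in [set q : rat | ratr q <= x]].
Proof.
move=> x0; split; first by exists (ratr 0), 0 => //=; rewrite rmorph0.
exists (ratr (Num.truncn x).+1%:R) => _ [q /= qx <-].
rewrite ler_rat -(ler_rat algC) (le_trans qx) // ratr_nat ltW //.
by case/andP: (truncn_itv x0).
Qed.

Lemma cut_ge x q : 0 <= x -> ratr q <= x -> ratr q <= cut x.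
Proof. by move=> x0 qx; apply: ub_le_sup; [case: (cut_has_sup x0) | exists q]. Qed.

Lemma cut_le x q : 0 <= x -> x <= ratr q -> cut x <= ratr q.
Proof.
move=> x0 xq; apply: ge_sup; first by case: (cut_has_sup x0).
by move=> _ [r /= rx <-]; rewrite ler_rat -(ler_rat algC) (le_trans rx).
Qed.

Lemma cut_homo x y : 0 <= x -> x <= y -> cut x <= cut y.
Proof.
move=> x0 xy; apply: ge_sup; first by case: (cut_has_sup x0).
move=> _ [r /= rx <-]; apply: cut_ge; [exact: le_trans xy | exact: le_trans rx xy].
Qed.

Lemma cut_ge0 x : 0 <= x -> 0 <= cut x.
Proof. by move=> x0; rewrite -[leLHS](rmorph0 (@ratr R)) cut_ge // rmorph0. Qed.

Lemma cut_approx x n : 0 <= x ->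
  exists q : rat, [/\ 0 <= q, ratr q <= x & x <= ratr (q + n.+1%:R^-1)].
Proof.
move=> x0; have xn0 : 0 <= x * n.+1%:R by rewrite mulr_ge0.
have /andP[h1 h2] := truncn_itv xn0.
exists ((Num.truncn (x * n.+1%:R))%:R / n.+1%:R); split.
- by rewrite divr_ge0.
- by rewrite rmorphM fmorphV /= !ratr_nat ler_pdivrMr.
- rewrite -[X in _ + X]mul1r -mulrDl natr1 rmorphM fmorphV /= !ratr_nat.
  by rewrite ler_pdivlMr // ltW.
Qed.

Lemma eq_of_close (a b C : R) : (forall n, `|a - b| <= C / n.+1%:R) -> a = b.
Proof.
move=> h; apply/eqP; rewrite -subr_eq0 -normr_le0 leNgt; apply/negP => d0.
have C0 : 0 <= C by have := h 0%N; rewrite divr1; apply: le_trans.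
have := h (Num.truncn (C / `|a - b|)); rewrite leNgt => /negP; apply.
rewrite ltr_pdivrMr // mulrC -ltr_pdivrMr //; exact: truncnS_gt.
Qed.

Lemma close_of_between (a b l u : R) : l <= a -> a <= u -> l <= b -> b <= u -> `|a - b| <= u - l.
Proof. by move=> *; rewrite ler_norml; apply/andP; split; lra. Qed.

Lemma cutD x y : 0 <= x -> 0 <= y -> cut (x + y) = cut x + cut y.
Proof.
move=> x0 y0; apply: (@eq_of_close _ _ 2) => n.
have [q [q0 qx xq]] := cut_approx n x0; have [r [r0 ry yr]] := cut_approx n y0.
have e : 2 / n.+1%:R = ratr (q + n.+1%:R^-1 + (r + n.+1%:R^-1)) - ratr (q + r) :> R.
  by rewrite !rmorphD /= fmorphV /= ratr_nat; ring.
rewrite e; apply: close_of_between.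
- by apply: cut_ge; rewrite ?addr_ge0 // rmorphD lerD.
- by apply: cut_le; rewrite ?addr_ge0 // rmorphD lerD.
- by rewrite rmorphD lerD // cut_ge.
- by rewrite rmorphD lerD // cut_le.
Qed.

Lemma cutM x y : 0 <= x -> 0 <= y -> cut (x * y) = cut x * cut y.
Proof.
(* With h = 1 / (n + 1), both sides lie between q r and (q + h)(r + h), whose difference (q + r + h)
   h is at most (cut x + cut y + 1) h. *)
move=> x0 y0; apply: (@eq_of_close _ _ (cut x + cut y + 1)) => n.
have [q [q0 qx xq]] := cut_approx n x0; have [r [r0 ry yr]] := cut_approx n y0.
have qn0 : 0 <= q + n.+1%:R^-1 by rewrite addr_ge0 ?invr_ge0.
have rn0 : 0 <= r + n.+1%:R^-1 by rewrite addr_ge0 ?invr_ge0.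
have cq := cut_ge x0 qx; have cr := cut_ge y0 ry.
have cq' := cut_le x0 xq; have cr' := cut_le y0 yr.
have cx0 := cut_ge0 x0; have cy0 := cut_ge0 y0.
apply: (@le_trans _ _ (ratr ((q + n.+1%:R^-1) * (r + n.+1%:R^-1)) - ratr (q * r))).
  apply: close_of_between.
  - by apply: cut_ge; rewrite ?mulr_ge0 // rmorphM ler_pM // ler0q.
  - by apply: cut_le; rewrite ?mulr_ge0 // rmorphM ler_pM.
  - by rewrite rmorphM ler_pM // ler0q.
  - by rewrite rmorphM ler_pM.
have -> : ratr ((q + n.+1%:R^-1) * (r + n.+1%:R^-1)) - ratr (q * r) =
    (ratr q + ratr r + n.+1%:R^-1) * n.+1%:R^-1 :> R.
  by rewrite !(rmorphM, rmorphD) /= fmorphV /= ratr_nat; ring.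
rewrite ler_wpM2r ?invr_ge0 // lerD ?lerD // invf_le1 // ler1n //.
Qed.

Lemma archimedean_extension : exists v : algC -> R,
  absval v /\ forall q, v (ratr q) = archimedean_abs R q.
Proof.
exists (fun z => cut `|z|); split; last first.
  move=> q; rewrite /archimedean_abs -ratr_norm; apply: le_anti; apply/andP.
  by split; [apply: cut_le | apply: cut_ge]; rewrite // ler0q.
have cut0 : cut 0 = 0.
  by apply: le_anti; rewrite cut_ge0 // andbT -(rmorph0 (@ratr R)) cut_le // rmorph0.
split=> [x|x|x y|x y].
- exact: cut_ge0.
- split=> [c0|->]; last by rewrite normr0.
  apply: contrapT => /eqP x0; have xgt0 : 0 < `|x| by rewrite normr_gt0.
  pose n := Num.truncn `|x|^-1.
  have h : ratr n.+1%:R^-1 <= `|x|.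
    rewrite fmorphV /= ratr_nat -[leRHS]invrK lef_pV2 ?posrE ?invr_gt0 // ltW //.
    by have /truncn_itv/andP[] : 0 <= `|x|^-1 by rewrite invr_ge0.
  have := cut_ge (ltW xgt0) h; rewrite c0 fmorphV /= ratr_nat.
  by rewrite leNgt invr_gt0 ltr0n.
- by rewrite normrM cutM.
- rewrite -cutD //; apply: cut_homo => //; exact: ler_normD.
Qed.

End ArchimedeanExtension.

(* [None] is the infinite place of Q. *)
Definition abs_at (R : realType) (o : option nat) : rat -> R :=
  if o is Some p then padic_abs R p else archimedean_abs R.

Definition is_place (o : option nat) := if o is Some p then prime p else true.

Lemma abs_at_extension (R : realType) o : is_place o -> exists v : algC -> R,
  [/\ absval v, forall q, v (ratr q) = abs_at R o q &
      o != None -> forall x y, v (x + y) <= Num.max (v x) (v y)].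
Proof.
case: o => [p|] /= op.
  by have [v [h1 h2 h3]] := padic_extension R op; exists v.
by have [v [h1 h2]] := archimedean_extension R; exists v.
Qed.

Lemma usual_absP (R : realType) w :
  usual_abs w <-> exists2 o, is_place o & w = abs_at R o.
Proof.
split; first by case=> [->|[p pp ->]]; [exists None | exists (Some p)].
by case=> -[p|] /= op ->; [right; exists p | left].
Qed.

Section RationalAbs.
Variable R : realType.

Lemma abs_at_absval o : is_place o -> absval (abs_at R o).
Proof.
move=> op; have [v [vP ve _]] := abs_at_extension R op.
have -> : abs_at R o = v \o ratr by apply/funext => q; rewrite /= ve.
exact: absval_comp vP.
Qed.

Lemma padic_abs_int p (n : int) : prime p -> n != 0 ->
  padic_abs R p n%:~R = (p%:R ^+ logn p `|n|)^-1.
Proof.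
move=> pp n0; rewrite /padic_abs intr_eq0 (negPf n0) numq_int denq_int.
by rewrite logn1 sub0r -invr_expz.
Qed.

Lemma padic_abs_nat p n : prime p -> (0 < n)%N -> padic_abs R p n%:R = (p%:R ^+ logn p n)^-1.
Proof. by move=> pp n0; rewrite pmulrn padic_abs_int // eqz_nat -lt0n. Qed.

Lemma abs_at_nontrivial o : is_place o -> exists t, 1 < abs_at R o t.
Proof.
move=> op; case: o op => [p|] op; last first.
  by exists 2; rewrite /= /archimedean_abs ger0_norm // ratr_nat ltr1n.
have pP := @abs_at_absval (Some p) op.
have pgt := prime_gt0 op.
exists p%:R^-1; rewrite (absvalV pP) [abs_at _ _]/= padic_abs_nat //.
by rewrite logn_prime // eqxx expr1 invrK ltr1n prime_gt1.
Qed.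

Lemma prod_logn (P : seq nat) n : (0 < n)%N -> uniq P -> {subset primes n <= P} ->
  (\prod_(p <- P) p ^ logn p n)%N = n.
Proof.
move=> n0 uP sP; rewrite [RHS](prod_prime_decomp n0) prime_decompE big_map /=.
rewrite (bigID (mem (primes n))) /= [X in (_ * X)%N]big1 ?muln1; last first.
  by move=> p; rewrite -logn_gt0 -eqn0Ngt => /eqP ->; rewrite expn0.
rewrite -big_filter; apply: perm_big; apply: uniq_perm; rewrite ?filter_uniq ?primes_uniq //.
by move=> p; rewrite mem_filter; apply: andb_idr; apply: sP.
Qed.

Lemma product_formula (P : seq nat) (q : rat) : q != 0 -> uniq P ->
    {subset primes `|numq q| <= P} -> {subset primes `|denq q| <= P} ->
    (forall p, p \in P -> prime p) ->
  archimedean_abs R q * \prod_(p <- P) padic_abs R p q = 1.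
Proof.
move=> q0 uP sn sd pP.
have n0 : (0 < `|numq q|)%N by rewrite absz_gt0 numq_eq0.
have d0 : (0 < `|denq q|)%N by rewrite absz_gt0.
have -> : \prod_(p <- P) padic_abs R p q = `|denq q|%:R / `|numq q|%:R.
  rewrite -[in RHS](prod_logn d0 uP sd) -[in RHS](prod_logn n0 uP sn) !natr_prod.
  rewrite -prodf_div big_seq [RHS]big_seq; apply: eq_bigr => p /pP pp.
  rewrite /padic_abs (negPf q0) !natrX expfzDr -?invr_expz //.
  by rewrite pnatr_eq0 -lt0n prime_gt0.
rewrite /archimedean_abs ratr_norm /ratr normf_div -!intr_norm -!natr_absz mulrA divfK ?divff //.
  by rewrite pnatr_eq0 -lt0n.
by rewrite pnatr_eq0 -lt0n.
Qed.

End RationalAbs.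

(** * Heights and conjugates *)

Section PlacesOfField.
Variables (R : realType) (F : fieldExtType rat).

Definition places_at (o : option nat) : set (F -> R) :=
  [set v | absval v /\ restrict_abs v = abs_at R o].

Lemma placesE : @places R F = \bigcup_(o in [set o | is_place o]) places_at o.
Proof.
apply/seteqP; split=> [v [vP /usual_absP[w wp vo]] | v [w /= wp [vP vo]]].
  by exists w.
by split=> //; apply/usual_absP; exists w.
Qed.

Lemma sum_vfree_seq_le o (s : seq (F -> R)) (d : (F -> R) -> nat) :
    is_place o -> uniq s -> (forall v, v \in s -> places_at o v) ->
    (forall v, v \in s -> exists y : 'I_(d v) -> F, vfree v y) ->
  (\sum_(v <- s) d v <= \dim {:F})%N.
Proof.
move=> op us sP yP; rewrite (big_nth (fun=> 0)) big_mkord.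
pose vs (i : 'I_(size s)) := s`_i : F -> R.
have vss i : vs i \in s by rewrite mem_nth.
have /cid[y hy] : exists y : forall i, 'I_(d (vs i)) -> F, forall i, vfree (vs i) (@y i).
  have h i : {y : 'I_(d (vs i)) -> F | vfree (vs i) y} by apply: cid; apply: yP.
  by exists (fun i => sval (h i)) => i; case: (h i).
apply: (@sum_vfree_le R F _ (abs_at_nontrivial R op) _ vs _ y) => //.
- by move=> i j /eqP; rewrite nth_uniq // => /eqP/val_inj.
- by move=> i; have [] := sP _ (vss i).
- by move=> i; have [] := sP _ (vss i).
Qed.

(** The one-element family 1 is [vfree] at every place, so the degree inequality bounds the number
    of places over o by the degree of F. *)
Lemma places_at_finite o : is_place o -> finite_set (places_at o).
Proof.
move=> op; apply: contrapT => inf.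
have [B BP cB] := infinite_set_fset (\dim {:F}).+1 inf.
have := @sum_vfree_seq_le o (finmap.enum_fset B) (fun=> 1%N) op (finmap.fset_uniq B) BP.
rewrite sum1_size => h; suff : (\dim {:F} < \dim {:F})%N by rewrite ltnn.
apply: leq_trans cB (h _) => v /BP[vP _].
exists (fun=> 1), 1 => // a i; rewrite mul1r big_ord1 absvalZ // (absval1 vP) mulr1.
by rewrite (ord1 i).
Qed.

Lemma padic_abs_le1 p c : prime p -> ~~ (p %| `|denq c|)%N -> padic_abs R p c <= 1.
Proof.
move=> pp pc; rewrite /padic_abs; case: eqP => // _.
have -> : logn p `|denq c| = 0%N.
  by apply/eqP; rewrite eqn0Ngt logn_gt0 mem_primes pp (negPf pc) andbF.
by rewrite sub0r -invr_expz invf_le1 ?exprn_gt0 ?exprn_ege1 ?ler1n ?ltr0n ?prime_gt0.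
Qed.

Lemma padic_absD p (a b : rat) : prime p -> padic_abs R p a <= 1 -> padic_abs R p b <= 1 ->
  padic_abs R p (a + b) <= 1.
Proof.
move=> pp ha hb; have [v [_ ve vm]] := @abs_at_extension R (Some p) pp.
rewrite -[padic_abs R p _]ve rmorphD /=; apply: le_trans (vm isT _ _) _.
by rewrite ge_max !ve /= ha.
Qed.

(* For p prime to the denominators of multiplication by x on a basis, the powers
   of x keep p-integral coordinates, so that v is bounded on them. *)
Lemma place_le1 (x : F) : exists D, forall p v, prime p -> (D < p)%N ->
  places_at (Some p) v -> v x <= 1.
Proof.
pose n := \dim {:F}; pose b := vbasis {:F}.
pose c (i j : 'I_n) : rat := coord b j (x * b`_i).
exists (\max_i \max_j `|denq (c i j)|)%N => p v pp Dp [vP vw].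
have cw i j : abs_at R (Some p) (c i j) <= 1.
  apply: padic_abs_le1 => //; apply/negP => /dvdn_leq.
  rewrite absz_gt0 denq_neq0 => /(_ isT); apply/negP; rewrite -ltnNge.
  apply: leq_ltn_trans Dp; apply: leq_trans (leq_bigmax i).
  exact: (leq_bigmax (F := fun j => `|denq (c i j)|%N) j).
have wP : absval (abs_at R (Some p)) by apply: abs_at_absval.
pose L y := exists2 a : 'I_n -> rat, forall j, abs_at R (Some p) (a j) <= 1 &
  y = \sum_j a j *: b`_j.
have Lx y : L y -> L (x * y).
  move=> [a ha ->]; exists (fun j => \sum_i a i * c i j).
    move=> j; elim/big_ind: _ => [|s t hs ht|i _]; first by rewrite (absval0 wP).
      exact: padic_absD.
    by rewrite (absvalM wP) mulr_ile1 // absval_ge0.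
  rewrite mulr_sumr; under eq_bigr => i _.
    rewrite -scalerAr (coord_vbasis (memvf (x * b`_i))) scaler_sumr; over.
  rewrite exchange_big; apply: eq_bigr => j _ /=; rewrite scaler_suml.
  by apply: eq_bigr => i _; rewrite scalerA.
pose B := \sum_(j < n) v b`_j.
have LB y : L y -> v y <= B.
  move=> [a ha ->]; apply: le_trans (absval_sum vP _ _ _) _; apply: ler_sum => j _.
  by rewrite absvalZ // vw ler_piMl // absval_ge0.
have n0 : (0 < n)%N by rewrite adim_gt0.
pose i0 := Ordinal n0.
have Lb N : L (x ^+ N * b`_i0).
  elim: N => [|N IHN]; last by rewrite exprS -mulrA; apply: Lx.
  rewrite mul1r; exists (fun j => (j == i0)%:R).
    by move=> j; case: eqP; rewrite ?(absval1 wP) ?(absval0 wP).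
  rewrite (bigD1 i0) //= ?eqxx ?scale1r big1 ?addr0 // => j /negPf ->.
  by rewrite scale0r.
have b0 : 0 < v b`_i0.
  rewrite absval_gt0 //; have /basis_free/free_not0 := vbasisP {:F}.
  by apply; apply: mem_nth; rewrite size_tuple.
rewrite leNgt; apply/negP => x1.
have [N hN] := @expr_unbounded R (v x) (B / v b`_i0) x1.
have := LB _ (Lb N); rewrite (absvalM vP) (absvalX vP) leNgt => /negP; apply.
by rewrite -ltr_pdivrMr.
Qed.

Definition local_factor (x : F) (v : F -> R) : R :=
  (Num.max 1 (v x)) `^ ((local_degree v)%:R / (\dim {:F})%:R).

Lemma local_factor_ge1 x v : 1 <= local_factor x v.
Proof.
rewrite /local_factor -[leLHS](powRr0 (Num.max 1 (v x))).
by rewrite ler_powR ?le_max ?lexx // divr_ge0.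
Qed.

(** Guards the definition of the height: a product over a set with infinite support would collapse
    to 1. Beyond the bound of [place_le1] all factors are 1, and finitely many places lie over each
    remaining place of Q. *)
Lemma local_factor_finite x :
  finite_set (@places R F `&` (local_factor x) @^-1` [set~ 1]).
Proof.
have [D hD] := place_le1 x.
pose I := [set o | o = None \/ exists2 p, (p <= D)%N & o = Some p /\ prime p].
apply: (@sub_finite_set _ _ (\bigcup_(o in I) places_at o)).
  move=> v []; rewrite placesE => -[[p |] /= op vo] hv; last by exists None => //; left.
  exists (Some p) => //; right; exists p => //; rewrite leqNgt; apply/negP => Dp.
  apply: hv; rewrite /local_factor (max_idPl _) ?powR1 //; exact: (hD p).
apply: bigcup_finite; last first.
  move=> o [->|[p pD [-> pp]]]; exact: places_at_finite.
apply: (@sub_finite_set _ _ ([set None] `|` [set Some p | p in `I_D.+1])).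
  by move=> o [->|[p pD [-> pp]]]; [left | right; exists p].
rewrite finite_setU; split; first exact: finite_set1.
by apply: finite_image; apply: finite_II.
Qed.

(** All local factors are at least 1, so omitting places only decreases the product. *)
Lemma field_height_ge (x : F) (s : seq (F -> R)) : uniq s ->
  (forall v, v \in s -> @places R F v) -> \prod_(v <- s) local_factor x v <= field_height R x.
Proof.
move=> us sP; rewrite /field_height -/(local_factor x).
set t := finite_support _ _ _.
have tE v : v \in t = (v \in @places R F `&` (local_factor x) @^-1` [set~ 1]).
  exact: in_finite_support (local_factor_finite x) v.
have ut : uniq t by apply: finite_support_uniq.
clearbody t.
have f0 v : 0 <= local_factor x v := le_trans ler01 (local_factor_ge1 x v).
rewrite (bigID (mem t)) /= [X in _ * X]big1_seq ?mulr1; last first.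
  move=> v /andP[/= vt vs]; apply: contrapT => v1; case/negP: vt.
  by rewrite tE; apply/mem_set; split; first exact: sP.
rewrite [leRHS](bigID (mem s)) /= -[leLHS]mulr1 ler_pM //.
- by apply: prodr_ge0.
- have pe : perm_eq [seq v <- s | v \in t] [seq v <- t | v \in s].
    by apply: uniq_perm; rewrite ?filter_uniq // => v; rewrite !mem_filter andbC.
  by rewrite -big_filter -[leRHS]big_filter (perm_big _ pe).
- apply: (big_ind (fun z => 1 <= z)) => // [a b a1 b1|v _]; last exact: local_factor_ge1.
  by rewrite -[leLHS]mulr1 ler_pM.
Qed.

End PlacesOfField.

(** * Determinants, local degrees and embeddings *)

Section Limits.
Variables (R : realType) (K : fieldType) (u : K -> R).
Hypothesis uP : absval u.

Definition tends (z : nat -> K) (l : K) : Prop :=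
  forall e : R, 0 < e -> exists N, forall n, (N <= n)%N -> u (z n - l) < e.

Lemma tends_cst l : tends (fun=> l) l.
Proof. by move=> e e0; exists 0%N => n _; rewrite subrr (absval0 uP). Qed.

Lemma tendsD z l z' l' : tends z l -> tends z' l' -> tends (fun n => z n + z' n) (l + l').
Proof.
move=> hz hz' e e0; have e2 : 0 < e / 2 by rewrite divr_gt0.
have [N hN] := hz _ e2; have [M hM] := hz' _ e2; exists (maxn N M) => n.
rewrite geq_max => /andP[Nn Mn]; rewrite opprD addrACA.
by apply: le_lt_trans (absvalD uP _ _) _; rewrite [ltRHS]splitr ltrD ?hN ?hM.
Qed.

Lemma tendsM z l z' l' : tends z l -> tends z' l' -> tends (fun n => z n * z' n) (l * l').
Proof.
move=> hz hz' e e0; pose B := u l + u l' + 1.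
have l0 := absval_ge0 uP l; have l0' := absval_ge0 uP l'.
have B0 : 0 < B by rewrite /B; lra.
have eB : 0 < e / (2 * B) by rewrite divr_gt0 // mulr_gt0.
have [N0 hN0] := hz _ ltr01.
have [N hN] := hz _ eB; have [M hM] := hz' _ eB; exists (maxn N0 (maxn N M)) => n.
rewrite !geq_max => /and3P[N0n Nn Mn].
have -> : z n * z' n - l * l' = z n * (z' n - l') + (z n - l) * l' by ring.
apply: le_lt_trans (absvalD uP _ _) _; rewrite !(absvalM uP).
have zB : u (z n) <= B.
  have := hN0 _ N0n; have := absval_near_ge uP l (z n).
  rewrite (absval_distC uP) /B; lra.
have h1 := hM _ Mn; have h2 := hN _ Nn.
have eE : e = B * (e / (2 * B)) + (e / (2 * B)) * B by field; rewrite gt_eqF.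
rewrite [ltRHS]eE; apply: ler_ltD.
  by apply: ler_pM => //; [exact: absval_ge0 | exact: absval_ge0 | exact: ltW].
apply: (@le_lt_trans _ _ (u (z n - l) * B)); last by rewrite ltr_pM2r.
by rewrite ler_wpM2l ?absval_ge0 // /B; lra.
Qed.

Lemma tends_big (I : Type) (r : seq I) (z : I -> nat -> K) (l : I -> K)
    (op : K -> K -> K) (idx : K) :
    (forall a b c d, tends a b -> tends c d -> tends (fun n => op (a n) (c n)) (op b d)) ->
    (forall i, tends (z i) (l i)) ->
  tends (fun n => \big[op/idx]_(i <- r) z i n) (\big[op/idx]_(i <- r) l i).
Proof.
move=> hop h; elim: r => [|i r IHr].
  rewrite big_nil; have -> : (fun n => \big[op/idx]_(i <- [::]) z i n) = fun=> idx.
    by apply/funext => n; rewrite big_nil.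
  exact: tends_cst.
rewrite big_cons; have -> : (fun n => \big[op/idx]_(j <- i :: r) z j n) =
    fun n => op (z i n) (\big[op/idx]_(j <- r) z j n).
  by apply/funext => n; rewrite big_cons.
exact: hop.
Qed.

Lemma tends_det s (A : nat -> 'M[K]_s) (M : 'M[K]_s) :
  (forall i j, tends (fun n => A n i j) (M i j)) -> tends (fun n => \det (A n)) (\det M).
Proof.
move=> h; apply: tends_big; first exact: tendsD.
move=> t; apply: tendsM; first exact: tends_cst.
by apply: tends_big; [exact: tendsM | move=> i; apply: h].
Qed.

End Limits.

(* If d < s, a nonzero Vandermonde determinant would be a limit of determinants
   of matrices of rank at most d. *)
Lemma embeddings_le_basis (R : realType) (F : fieldExtType rat) (v : F -> R)
    (u : algC -> R) (x : F) s (psi : 'I_s -> {rmorphism F -> algC}) d (e : 'I_d -> nat -> F) :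
    absval u -> injective (fun i => psi i x) -> (forall i y, v y = u (psi i y)) ->
  completion_basis v e -> (s <= d)%N.
Proof.
move=> uP inj vu [_ gen _]; rewrite leqNgt; apply/negP => ds.
case: s => [//|s] in psi inj vu ds *.
have vP : absval v.
  have -> : v = u \o psi ord0 by apply/funext => y; rewrite (vu ord0).
  exact: absval_comp.
have /choice[c hc] : forall j : 'I_s.+1, exists c : 'I_d -> nat -> rat,
    null_for v (fun k => x ^+ j - \sum_(i < d) c i k *: e i k).
  move=> j; have [|c _ hc] := gen (fun=> x ^+ j); last by exists c.
  by apply/cauchy_forP => eps eps0; exists 0%N => m n _ _; rewrite subrr (absval0 vP).
pose M : 'M[algC]_s.+1 := \matrix_(j, i) psi i (x ^+ j).
pose C k : 'M[algC]_(s.+1, d) := \matrix_(j, l) ratr (c j l k).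
pose E k : 'M[algC]_(d, s.+1) := \matrix_(l, i) psi i (e l k).
have CE k j i : (C k *m E k) j i = psi i (\sum_(l < d) c j l k *: e l k).
  rewrite mxE rmorph_sum; apply: eq_bigr => l _.
  by rewrite !mxE rmorphZ_num.
have lim : tends u (fun k => \det (C k *m E k)) (\det M).
  apply: (tends_det uP) => j i eps eps0.
  have [N hN] := (null_forP _ (absval_ge0 vP)).1 (hc j) eps eps0.
  exists N => k Nk; rewrite CE mxE -rmorphB -(vu i) (absval_distC vP); exact: hN.
have det0 k : \det (C k *m E k) = 0.
  apply/eqP; rewrite -[_ == 0]negbK -unitfE -unitmxE; apply/negP => /mxrank_unit h.
  by have := mulmx_max_rank (C k) (E k); rewrite h leqNgt ds.
have : \det M != 0.
  have -> : M = Vandermonde s.+1 (\row_i psi i x).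
    by apply/matrixP => j i; rewrite !mxE rmorphXn.
  rewrite det_Vandermonde; apply/prodf_neq0 => i _; apply/prodf_neq0 => j ij.
  rewrite !mxE subr_eq0; apply/negP => /eqP/inj ji.
  by rewrite ji ltnn in ij.
rewrite -(absval_gt0 uP) => M0; have [N /(_ N (leqnn N))] := lim _ M0.
by rewrite det0 sub0r (absvalN uP) ltxx.
Qed.

Section PlaceExt.
Variable R : realType.

(** One extension to [algC] is fixed for each place of Q; precomposing it with automorphisms lets
    conjugates stand in for places of a number field. *)
Definition place_ext (o : option nat) : algC -> R :=
  xget (fun=> 0) [set v : algC -> R | [/\ absval v, forall q, v (ratr q) = abs_at R o q &
      o != None -> forall x y, v (x + y) <= Num.max (v x) (v y)]].

Lemma place_extP o : is_place o -> [/\ absval (place_ext o),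
  forall q, place_ext o (ratr q) = abs_at R o q &
  o != None -> forall x y, place_ext o (x + y) <= Num.max (place_ext o x) (place_ext o y)].
Proof.
move=> /(abs_at_extension R) h.
exact: (@xgetPex _ (fun=> 0) [set v : algC -> R | [/\ absval v, forall q, v (ratr q) = abs_at R
  o q &
      o != None -> forall x y, v (x + y) <= Num.max (v x) (v y)]]).
Qed.

Lemma abs_at_inj o o' : is_place o -> is_place o' -> abs_at R o = abs_at R o' -> o = o'.
Proof.
have arch p : prime p -> abs_at R (Some p) <> abs_at R None.
  move=> pp /(congr1 (fun w => w p%:R)); rewrite /= padic_abs_nat ?prime_gt0 //.
  rewrite logn_prime // eqxx expr1 /archimedean_abs ger0_norm // ratr_nat => h.
  have : (p%:R^-1 < 1 :> R) by rewrite invf_lt1 ?ltr0n ?ltr1n ?prime_gt1 ?prime_gt0.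
  by rewrite h ltNge ler1n prime_gt0.
case: o => [p1|]; case: o' => [q1|] // pp qp.
- move=> /(congr1 (fun w => w p1%:R)) /=; rewrite !padic_abs_nat ?prime_gt0 //.
  rewrite !logn_prime // eqxx; case: (eqVneq q1 p1) => [-> //|_].
  rewrite expr0 invr1 expr1 => h.
  have : (p1%:R^-1 < 1 :> R) by rewrite invf_lt1 ?ltr0n ?ltr1n ?prime_gt1 ?prime_gt0.
  by rewrite h ltxx.
- by move=> h; case: (arch p1).
- by move=> /esym h; case: (arch q1).
Qed.

End PlaceExt.

Lemma size_minPoly_minCpoly (F : fieldExtType rat) (iota : {rmorphism F -> algC}) x :
  size (minPoly 1 x) = size (minCpoly (iota x)).
Proof.
have [p [Dp mon_p] pP] := minCpolyP (iota x).
have map_iota (q : {poly rat}) : map_poly iota (map_poly (in_alg F) q) = map_poly ratr q.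
  by rewrite -map_poly_comp; apply: eq_map_poly => a /=; rewrite rmorphZ_num rmorph1 mulr1.
have /polyOver1P[q Dq] := minPolyOver 1 x.
have q_mon : q \is monic by rewrite -(map_monic (in_alg F)) -Dq monic_minPoly.
have pq : p %| q.
  rewrite -pP -map_iota -Dq; apply: rmorph_root; exact: root_minPoly.
have qp : q %| p.
  rewrite -(dvdp_map (in_alg F)) -Dq; apply: minPoly_dvdp; first exact: alg_polyOver.
  rewrite -(fmorph_root iota) map_iota -Dp; exact: root_minCpoly.
have : p %= q by rewrite /eqp pq.
by rewrite eqp_monic // => /eqP e; rewrite Dp Dq e !size_map_poly.
Qed.

Section Key.
Variable R : realType.

Lemma weil_height_def a : exists (F : fieldExtType rat) (iota : {rmorphism F -> algC}) (x : F),
  [/\ iota x = a, <<1; x>>%VS = fullv, \dim {:F} = (size (minCpoly a)).-1 &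
      weil_height R a = field_height R x].
Proof.
rewrite /weil_height; case: num_field_exists => F [iota [s Ds genF]].
case: s Ds genF => [//|x [|//]] [Dx]; rewrite adjoin_seq1 => genF.
exists F, iota, x; split=> //.
by rewrite -genF dim_Fadjoin dimv1 muln1 -Dx -size_minPoly_minCpoly size_minPoly.
Qed.

(** The factors are grouped by the place of Q(a) that each conjugate induces. A place v occurs at
    most [local_degree v] times by [embeddings_le_basis], and the power of the height cancels the
    denominator of the exponent in [local_factor]. *)
Lemma weil_height_ge (a : algC) (W : seq (option nat)) m (nus : 'I_m -> {rmorphism algC -> algC}) :
    uniq W -> {in W, forall o, is_place o} -> injective (fun i => nus i a) ->
  \prod_(o <- W) \prod_i Num.max 1 (place_ext R o (nus i a)) <=
    weil_height R a ^+ (size (minCpoly a)).-1.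
Proof.
move=> uW WP unus; have [F [iota [x [Dx genF dimF ->]]]] := weil_height_def a.
pose pv o i : F -> R := fun y => place_ext R o (nus i (iota y)).
pose S := [seq pv o i | o <- W, i <- enum 'I_m].
have pvP o i : is_place o -> places_at o (pv o i).
  move=> op; have [eP eq _] := place_extP R op; split.
    exact: (absval_comp (nus i \o iota) eP).
  apply/funext => q; rewrite /restrict_abs /pv rmorphZ_num rmorph1 mulr1.
  by rewrite fmorph_rat eq.
have SP v : v \in S -> @places R F v.
  move=> /allpairsP[[w i] /= [/WP op _ ->]]; rewrite placesE; exists w => //.
  exact: pvP.
have dim0 : (0 < \dim {:F})%N by rewrite adim_gt0.
have -> : \prod_(o <- W) \prod_i Num.max 1 (place_ext R o (nus i a)) =
    \prod_(v <- S) Num.max 1 (v x).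
  rewrite /S big_allpairs_dep /=; apply: eq_bigr => o _.
  by rewrite big_enum /=; apply: eq_bigr => i _; rewrite /pv Dx.
have le := @field_height_ge R F x (undup S) (undup_uniq S).
have {}le := le (fun v vS => SP v (etrans (esym (mem_undup S v)) vS)).
have pr0 : 0 <= \prod_(v <- undup S) local_factor x v.
  by apply: prodr_ge0 => v _; apply: le_trans (local_factor_ge1 x v).
apply: le_trans (lerXn2r _ pr0 (le_trans pr0 le) le); rewrite -dimF -prodrXl.
rewrite -[leLHS]big_undup_iterop_count big_seq [leRHS]big_seq.
apply: ler_prod => v; rewrite mem_undup => vS.
rewrite -/((Num.max 1 (v x)) ^+ count_mem v S) exprn_ge0 ?le_max ?ler01 //=.
have -> : local_factor x v ^+ \dim {:F} = Num.max 1 (v x) ^+ local_degree v.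
  rewrite /local_factor -powR_mulrn ?powR_ge0 // -powRrM divfK ?pnatr_eq0 -?lt0n //.
  by rewrite powR_mulrn // le_max ler01.
apply: ler_weXn2l; first by rewrite le_max lexx.
have /allpairsP[[w i0] /= [oW _ Dv]] := vS.
have op := WP w oW; have [vo vw] := pvP w i0 op; rewrite -Dv in vo vw.
have [e he] := local_degreeP vo.
(* Only embeddings paired with the same o can induce v, because distinct places of Q have distinct
   absolute values. *)
have -> : count_mem v S = count (fun i => pv w i == v) (enum 'I_m).
  rewrite /S count_flatten -map_comp sumnE big_map (bigD1_seq w) //= count_map.
  rewrite big1_seq ?addn0 // => w' /andP[w'w w'W].
  rewrite count_map; apply/eqP; rewrite -leqn0 leqNgt -has_count.
  apply/negP => /hasP[j _ /= /eqP hv]; case/negP: w'w; apply/eqP.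
  apply: (@abs_at_inj R) => //; first exact: WP.
  by rewrite -vw -hv; case: (pvP w' j (WP _ w'W)).
rewrite -size_filter; pose I := [seq i <- enum 'I_m | pv w i == v]; rewrite -/I.
have uI : uniq I by rewrite filter_uniq ?enum_uniq.
have [uP _ _] := place_extP R op.
pose psi k : {rmorphism F -> algC} := nus (tnth (in_tuple I) k) \o iota.
apply: (@embeddings_le_basis R F v (place_ext R w) x _ psi _ e) => //.
  by move=> j k /=; rewrite Dx => /unus/(tuple_uniqP (in_tuple I) uI).
move=> j y /=; have := mem_tnth j (in_tuple I).
by rewrite mem_filter => /andP[/eqP <-].
Qed.

End Key.

(** * Finite Galois extensions inside algC *)

Lemma normal_closure_exists (s : seq algC) :
  exists (E : splittingFieldType rat) (iota : {rmorphism E -> algC}),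
    forall a, a \in s -> exists y, iota y = a.
Proof.
have /choice[q hq] : forall a : algC, exists q : {poly rat}, minCpoly a = map_poly ratr q.
  by move=> a; have [q [-> _] _] := minCpolyP a; exists q.
pose Q := \prod_(a <- s) q a.
have [r Dr] := closed_field_poly_normal (map_poly ratr Q : {poly algC}).
have lead1 : lead_coef (map_poly ratr Q : {poly algC}) = 1.
  apply/eqP; rewrite -monicE /Q rmorph_prod; apply: monic_prod => a _.
  by rewrite /= -hq minCpoly_monic.
rewrite lead1 scale1r in Dr.
have [E0 [iota [rr Drr genE]]] := num_field_exists r.
have splitE : SplittingField.axiom E0.
  exists (map_poly (in_alg E0) Q).
    by apply/polyOverP=> i; rewrite coef_map memvZ ?memv_line.
  exists rr => //; apply/eqpP; exists (1, 1); rewrite /= ?oner_eq0 // !scale1r.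
  apply: (map_poly_inj iota); rewrite -map_poly_comp.
  rewrite (eq_map_poly (g := ratr)); last first.
    by move=> c; rewrite /= rmorphZ_num rmorph1 mulr1.
  rewrite Dr -Drr big_map rmorph_prod /=; apply: eq_bigr => z _.
  by rewrite map_polyXsubC.
pose Em := FieldExt_isSplittingField.Build rat E0 splitE.
pose E : splittingFieldType rat := HB.pack E0 Em.
exists E, iota => a sa.
have : a \in r.
  rewrite -root_prod_XsubC -Dr /Q rmorph_prod (big_rem a sa) /= rootM -hq.
  by rewrite root_minCpoly.
by rewrite -Drr => /mapP[y _ ->]; exists y.
Qed.

Lemma weil_height_ge1 (R : realType) a : 1 <= weil_height R a.
Proof.
have [F [iota [x [_ _ _ ->]]]] := weil_height_def R a.
by have := @field_height_ge R F x [::] isT; rewrite big_nil; apply.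
Qed.

(* A finite normal extension of Q inside algC, its Galois group being listed by
   automorphisms of algC. *)
Record galois_system (R : realType) (E : set algC) g
    (gs : 'I_g -> {rmorphism algC -> algC}) : Prop := GaloisSystem {
    galois_size : (0 < g)%N;
    galois_id : exists i, forall a, E a -> gs i a = a;
    galois_subfield : subfield E;
    galois_stable : forall i a, E a -> E (gs i a);
    galois_reindex : forall (T : comNzRingType) (f : algC -> T) i a, E a ->
      \prod_j f (gs j (gs i a)) = \prod_j f (gs j a);
    galois_prod_poly : forall a, E a -> exists q : {poly rat},
      \prod_j ('X - (gs j a)%:P) = map_poly ratr q;
    galois_moves : forall (K : set algC) a (t : seq algC), subfield K ->
      (forall b, b \in t -> K b /\ E b) -> E a -> ~ K a ->
      exists2 i, (forall b, b \in t -> gs i b = b) & gs i a != a;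
    galois_height : forall (W : seq (option nat)) a, uniq W ->
      {in W, forall o, is_place o} -> E a ->
      \prod_(o <- W) \prod_i Num.max 1 (place_ext R o (gs i a)) <= weil_height R a ^+ g }.

Lemma prodr_const_seq (T : comNzRingType) (I : Type) (r : seq I) (c : T) :
  \prod_(i <- r) c = c ^+ size r.
Proof. by elim: r => [|i r IHr]; rewrite ?big_nil // big_cons IHr exprS. Qed.

Section Subfield.
Variable K : set algC.
Hypothesis Kf : subfield K.

Lemma subfieldV_div x y : K x -> K y -> K (x / y).
Proof. by case: Kf => _ _ h Kx Ky; apply/set_mem/h; apply/mem_set. Qed.

Lemma subfield_subring : subring K.
Proof.
case: (Kf) => h1 hB hD; have K1 : K 1 by apply/set_mem.
split=> // [x y Kx Ky|x y Kx Ky]; first by apply/set_mem/hB; apply/mem_set.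
by rewrite -[y]invrK -[y^-1]mul1r; do 2!apply: subfieldV_div => //.
Qed.

Lemma subfield_rat q : K (ratr q).
Proof. by apply: subfieldV_div; apply: subring_int subfield_subring _. Qed.

Lemma subfield_adjoin_seq (E : fieldExtType rat) (iota : {rmorphism E -> algC})
    (L : {subfield E}) (s : seq E) :
    (forall y, y \in L -> K (iota y)) -> (forall y, y \in s -> K (iota y)) ->
  forall y, y \in <<L & s>>%VS -> K (iota y).
Proof.
elim: s L => [|z s IHs] L KL Ks y; first by rewrite Fadjoin_nil; apply: KL.
rewrite adjoin_cons; apply: (IHs <<L; z>>%AS) => {y} [y /Fadjoin_polyP[p Lp ->]|y ys].
  rewrite horner_coef rmorph_sum; apply: (subring_sum subfield_subring) => i _.
  rewrite rmorphM rmorphXn; apply: (subringM subfield_subring).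
    by apply: KL; apply/polyOverP.
  by apply: (subringX subfield_subring); apply: Ks; rewrite mem_head.
by apply: Ks; rewrite inE ys orbT.
Qed.

End Subfield.

Section GaloisSystemOf.
Variables (R : realType) (E : splittingFieldType rat) (iota : {rmorphism E -> algC}).
Let G := 'Gal({:E} / 1)%g.

Lemma galois_full (K : {subfield E}) : galois K {:E}.
Proof.
rewrite /galois subvf normalFieldf andbT; apply/separableP => u _.
by apply: pcharf0_separable => p; rewrite pchar_lalg pchar_num.
Qed.

Lemma gal_fixed_rat y : (forall x, x \in G -> x y = y) -> y \in 1%VS.
Proof.
move=> fy; have /galois_fixedField <- := galois_full 1%AS.
by apply/fixedFieldP => //; apply: memvf.
Qed.

Lemma gal_reindex_prod (T : comNzRingType) (f : E -> T) z y : z \in G ->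
  \prod_(x in G) f (x (z y)) = \prod_(x in G) f (x y).
Proof.
move=> Gz; rewrite [RHS](reindex_inj (mulgI z)) /=.
by apply: eq_big => [x|x _]; rewrite ?groupMl // galM ?memvf.
Qed.

Lemma gal_minPoly_roots y : exists r : seq (gal_of {:E}),
  [/\ {subset r <= G}, uniq [seq x y | x : gal_of {:E} <- r],
      size r = (size (minPoly 1 y)).-1 &
      forall x, x \in G -> perm_eq [seq x (z y) | z : gal_of {:E} <- r] [seq z y | z : gal_of
        {:E} <- r]].
Proof.
have /galois_factors := galois_full 1%AS;
  move=> /(_ (sub1v _)) /(_ y (memvf y))[r [/fintype.subsetP rG ur Dp]].
exists r; split=> //; first by rewrite Dp size_prod_XsubC size_map.
move=> x Gx; have ux : uniq [seq x (z y) | z : gal_of {:E} <- r].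
  by rewrite (map_comp x (fun z : gal_of {:E} => z y)) map_inj_uniq //; apply: fmorph_inj.
have sub : {subset [seq x (z y) | z : gal_of {:E} <- r] <= [seq z y | z : gal_of {:E} <- r]}.
  move=> _ /mapP[z zr ->]; rewrite -root_prod_XsubC -Dp -galM ?memvf //.
  exact: (root_minPoly_gal (sub1v _) (groupM (rG _ zr) Gx) (memvf y)).
apply: uniq_perm => //.
by have [] := uniq_min_size ux sub; rewrite ?size_map.
Qed.

Lemma gal_extend : exists nu : gal_of {:E} -> {rmorphism algC -> algC},
  forall x y, nu x (iota y) = iota (x y).
Proof.
have h (x : gal_of {:E}) : {nu : {rmorphism algC -> algC} | forall y, nu (iota y) = iota (x y)}.
  have [nu Dnu] := extend_algC_subfield_aut iota (gal_repr x : {rmorphism E -> E}).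
  by exists nu => y; rewrite Dnu.
by exists (fun x => sval (h x)) => x y; case: (h x).
Qed.

Lemma galois_system_of : exists g (gs : 'I_g -> {rmorphism algC -> algC}),
  galois_system R (range iota) gs.
Proof.
have [nu Dnu] := gal_extend.
have prodE (T : comNzRingType) (f : algC -> T) y :
    \prod_(i < #|G|) f (nu (enum_val i) (iota y)) = \prod_(x in G) f (iota (x y)).
  by rewrite [RHS]big_enum_val /=; apply: eq_bigr => i _; rewrite Dnu.
exists #|G|, (fun i => nu (enum_val i)); split.
- by apply: cardG_gt0.
- exists (enum_rank_in (group1 [group of G]) 1%g) => _ [a _ <-].
  by rewrite enum_rankK_in ?group1 // Dnu gal_id.
- split=> [|x y /set_mem[a _ <-] /set_mem[b _ <-]|x y /set_mem[a _ <-] /set_mem[b _ <-]];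
  apply/mem_set.
  + by exists 1; rewrite ?rmorph1.
  + by exists (a - b); rewrite ?rmorphB.
  + by exists (a / b); rewrite ?fmorph_div.
- by move=> i _ [a _ <-]; rewrite Dnu; exists (enum_val i a).
- move=> T f i _ [a _ <-]; rewrite Dnu !prodE.
  exact: (gal_reindex_prod (fun y => f (iota y))) (enum_valP i).
- move=> _ [a _ <-]; rewrite (prodE {poly algC} (fun z => 'X - z%:P)).
  pose p := \prod_(x in G) ('X - (x a)%:P).
  have p1 : p \is a polyOver 1%VS.
    apply/polyOverP => k; apply: gal_fixed_rat => z Gz.
    rewrite -coef_map; congr ((polyseq _)`_k); rewrite rmorph_prod /=.
    rewrite (eq_bigr (fun x : gal_of {:E} => 'X - ((x * z)%g a)%:P)); last first.
      by move=> x _; rewrite map_polyXsubC galM ?memvf.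
    rewrite /p [RHS](reindex_inj (mulIg z)) /=.
    by apply: eq_bigl => x; rewrite groupMr.
  have /polyOver1P[q Dq] := p1; exists q.
  transitivity (map_poly iota p).
    by rewrite rmorph_prod /=; apply: eq_bigr => x _; rewrite map_polyXsubC.
  rewrite Dq -map_poly_comp; apply: eq_map_poly => c.
  by rewrite /= rmorphZ_num rmorph1 mulr1.
- move=> K _ t Kf Kt [a _ <-] nKa; apply: contrapT => none.
  have /choice[pre hpre] : forall b, exists y, b \in t -> iota y = b.
    move=> b; have [/Kt[_ [y _ <-]]|_] := boolP (b \in t); [by exists y | by exists 0].
  (* Contrapositive of the Galois correspondence: if every automorphism fixing t fixes a, then a
     lies in Q(t), which is contained in K. *)
  pose M := <<1 & [seq pre b | b <- t]>>%AS.
  have aM : a \in M.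
    have /galois_fixedField <- := galois_full M.
    apply/fixedFieldP; first exact: memvf.
    move=> x Gx; apply: contrapT => xa; apply: none.
    have Gx1 : x \in G by apply: fintype.subsetP Gx; apply: galS; apply: sub1v.
    exists (enum_rank_in Gx1 x); rewrite enum_rankK_in //; last first.
      by rewrite Dnu (inj_eq (fmorph_inj _)); apply/eqP.
    move=> b bt; rewrite -(hpre b bt) Dnu; congr (iota _).
    by apply: fixed_gal Gx _; rewrite ?subvf // seqv_sub_adjoin // map_f.
  apply: nKa; apply: (subfield_adjoin_seq Kf) aM => [y /vlineP[q ->]|_ /mapP[b bt ->]].
    by rewrite rmorphZ_num rmorph1 mulr1; apply: subfield_rat.
  by rewrite hpre //; case: (Kt b bt).
- move=> W _ uW WP [a _ <-].
  pose f z := \prod_(o <- W) Num.max 1 (place_ext R o (iota z)).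
  have f0 z : 0 <= f z by apply: prodr_ge0 => o _; rewrite le_max ler01.
  have [r [rG ur szr perm_r]] := gal_minPoly_roots a.
  rewrite exchange_big /=.
  rewrite (prodE R (fun z => \prod_(o <- W) Num.max 1 (place_ext R o z))).
  pose Q := \prod_(x in G) f (x a); rewrite -[leLHS]/Q.
  pose P := \prod_(x <- r) f (x a).
  have n0 : (0 < size r)%N by rewrite szr size_minPoly.
  (* In place of a count of stabiliser cosets, the double product over G and over the conjugates of
     a is evaluated in both orders. *)
  have QP : Q ^+ size r = P ^+ #|G|.
    transitivity (\prod_(x in G) \prod_(z <- r) f (x (z a))).
      rewrite exchange_big /= -prodr_const_seq big_seq [RHS]big_seq.
      apply: eq_bigr => z zr; exact: esym (gal_reindex_prod f a (rG _ zr)).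
    rewrite -prodr_const; apply: eq_bigr => x Gx.
    rewrite -(big_map (fun z : gal_of {:E} => x (z a)) xpredT f).
    by rewrite (perm_big _ (perm_r x Gx)) big_map.
  have PH : P <= weil_height R (iota a) ^+ size r.
    rewrite szr (size_minPoly_minCpoly iota) /P /f exchange_big /=.
    have := @weil_height_ge R (iota a) W (size r) (fun i => nu (tnth (in_tuple r) i)) uW WP.
    have -> : \prod_(o <- W) \prod_(i < size r) Num.max 1 (place_ext R o (nu (tnth (in_tuple r)
      i) (iota a))) =
       \prod_(o <- W) \prod_(x <- r) Num.max 1 (place_ext R o (iota (x a))).
      apply: eq_bigr => o _; rewrite [RHS](big_tnth _ _ r).
      by apply: eq_bigr => i _; rewrite Dnu.
    apply; move=> i j /=; rewrite !Dnu => /fmorph_inj h; apply: val_inj => /=; apply/eqP.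
    rewrite -(nth_uniq 0 _ _ ur) ?size_map ?ltn_ord //.
    rewrite !(nth_map (tnth (in_tuple r) i)) ?ltn_ord // -!(tnth_nth _ (in_tuple r)).
    by apply/eqP.
  have H1 := weil_height_ge1 R (iota a); have H0 := le_trans ler01 H1.
  have Q0 : 0 <= Q by apply: prodr_ge0 => x _; apply: f0.
  have HG0 : 0 <= weil_height R (iota a) ^+ #|G| by rewrite exprn_ge0.
  rewrite -(ler_pXn2r n0) ?nnegrE //.
  rewrite QP exprAC; apply: lerXn2r PH; rewrite ?nnegrE ?exprn_ge0 //.
  by apply: prodr_ge0.
Qed.

End GaloisSystemOf.

Lemma galois_system_exists (R : realType) (s : seq algC) :
  exists (E : set algC) g (gs : 'I_g -> {rmorphism algC -> algC}),
    galois_system R E gs /\ forall a, a \in s -> E a.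
Proof.
have [E [iota sE]] := normal_closure_exists s.
have [g [gs gsP]] := galois_system_of R iota.
exists (range iota), g, gs; split=> // a /sE[y <-]; by exists y.
Qed.

(** Multiplying by X - w turns each coefficient into some x - w y with x and y old coefficients. The
    constant c, 2 in [arch_step] and 1 in [ultra_step], treats both kinds of place at once. *)
Lemma coef_prod_XsubC_le (R : realType) (K : fieldType) (u : K -> R) (c : R)
    (g : nat) (z : 'I_g -> K) :
    absval u -> 1 <= c ->
    (forall B x y w, u x <= B -> u y <= B -> u (x - w * y) <= c * Num.max 1 (u w) * B) ->
  forall k, u (\prod_j ('X - (z j)%:P))`_k <= c ^+ g * \prod_j Num.max 1 (u (z j)).
Proof.
move=> uP c1 step; elim: g z => [|g IHg] z k.
  rewrite !big_ord0 mulr1 expr0 coef1; case: eqP => _; first by rewrite (absval1 uP).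
  by rewrite (absval0 uP).
rewrite !big_ord_recl mulrBl coefB coefXM coefCM.
set q := \prod_(i < g) ('X - _); set M := \prod_(i < g) _.
have h i : u q`_i <= c ^+ g * M by apply: IHg.
rewrite exprS mulrACA; apply: step => //.
by case: eqP => _ //; apply: le_trans (h 0%N); rewrite (absval0 uP) absval_ge0.
Qed.

Lemma arch_step (R : realType) (K : fieldType) (u : K -> R) : absval u ->
  forall B x y w, u x <= B -> u y <= B -> u (x - w * y) <= 2 * Num.max 1 (u w) * B.
Proof.
move=> uP B x y w xB yB; apply: le_trans (absvalB uP _ _) _; rewrite (absvalM uP).
have B0 : 0 <= B by apply: le_trans yB; apply: absval_ge0.
have h1 : 1 <= Num.max 1 (u w) by rewrite le_max lexx.
have h2 : u w <= Num.max 1 (u w) by rewrite le_max lexx orbT.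
have h3 : u w * u y <= Num.max 1 (u w) * B.
  by apply: ler_pM => //; apply: absval_ge0.
have h4 : B <= Num.max 1 (u w) * B by rewrite ler_peMl.
lra.
Qed.

Lemma ultra_step (R : realType) (K : fieldType) (u : K -> R) : absval u ->
    (forall x y, u (x + y) <= Num.max (u x) (u y)) ->
  forall B x y w, u x <= B -> u y <= B -> u (x - w * y) <= 1 * Num.max 1 (u w) * B.
Proof.
move=> uP um B x y w xB yB; apply: le_trans (um _ _) _.
rewrite (absvalN uP) (absvalM uP) mul1r.
have B0 : 0 <= B by apply: le_trans yB; apply: absval_ge0.
rewrite ge_max; apply/andP; split.
  by apply: le_trans xB _; rewrite ler_peMl // le_max lexx.
by apply: ler_pM => //; rewrite ?absval_ge0 // le_max lexx orbT.
Qed.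

(** The primes dividing the denominator contribute exactly the denominator, so it is at most C; the
    infinite place gives |c| <= C, and the numerator is at most C^2. *)
Lemma rat_bounded_finite (R : realType) (C : R) :
  finite_set [set c : rat | forall W, uniq W -> {in W, forall o, is_place o} ->
    \prod_(o <- W) Num.max 1 (abs_at R o c) <= C].
Proof.
pose n := Num.truncn (C * C).
apply: (@sub_finite_set _ _ [set (-1) ^+ x.1 * (x.2.1)%:R / (x.2.2)%:R
  | x in [set: bool] `*` (`I_n.+1 `*` `I_n.+1)]); last first.
  apply: finite_image; apply: finite_setX; first exact: finite_finset.
  by apply: finite_setX; apply: finite_II.
move=> c hc.
have hinf : `|ratr c| <= C :> R.
  have W1 : {in [:: None], forall o, is_place o} by move=> o; rewrite inE => /eqP ->.
  have := hc [:: None] isT W1; rewrite big_seq1 ge_max => /andP[_].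
  by rewrite /= /archimedean_abs ratr_norm.
have C1 : 1 <= C.
  by have := hc [::] isT; rewrite big_nil; apply.
have den : `|denq c|%:R <= C.
  pose W := [seq Some p | p <- primes `|denq c|].
  have uW : uniq W by rewrite map_inj_uniq ?primes_uniq // => x y [].
  have WP : {in W, forall o, is_place o}.
    by move=> _ /mapP[p + ->]; rewrite mem_primes => /andP[].
  apply: le_trans (hc W uW WP); rewrite big_map.
  have d0 : (0 < `|denq c|)%N by rewrite absz_gt0.
  rewrite -[in leLHS](@prod_logn (primes `|denq c|) _ d0) ?primes_uniq //.
  rewrite natr_prod big_seq [leRHS]big_seq; apply: ler_prod => p.
  rewrite mem_primes => /and3P[pp _ pd]; rewrite natrX exprn_ge0 //= le_max.
  apply/orP; right; rewrite /padic_abs.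
  have [c0|c0] := eqVneq c 0; first by move: pd pp; rewrite c0 (_ : denq 0 = 1) // dvdn1 => /eqP ->.
  have -> : logn p `|numq c| = 0%N.
    apply/eqP; rewrite eqn0Ngt logn_gt0 mem_primes pp /= negb_and; apply/orP; right.
    apply/negP => pn; have /eqP g1 := coprime_num_den c.
    have : (p %| gcdn `|numq c| `|denq c|)%N by rewrite dvdn_gcd pn.
    by rewrite g1 dvdn1 => /eqP p1; move: pp; rewrite p1.
  by rewrite subr0.
have C0 : 0 <= C by apply: le_trans C1.
have CC : C <= C * C by rewrite ler_peMl.
have num : `|numq c|%:R <= C * C.
  have -> : `|numq c|%:R = `|ratr c| * `|denq c|%:R :> R.
    rewrite /ratr normf_div -!intr_norm -!natr_absz divfK //.
    by rewrite pnatr_eq0 -lt0n absz_gt0.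
  by apply: ler_pM.
exists (numq c < 0, (`|numq c|%N, `|denq c|%N)) => /=.
  split=> //; split=> /=; rewrite ltnS /n truncn_ge_nat ?mulr_ge0 //.
  exact: le_trans den CC.
rewrite -[RHS]divq_num_den; congr (_ / _).
  by rewrite [numq c in RHS]intEsign rmorphM rmorph_sign.
by rewrite pmulrn absz_denq.
Qed.

Lemma roots_finite (q : {poly rat}) : q != 0 ->
  finite_set [set a : algC | root (map_poly ratr q) a].
Proof.
move=> q0; have [r Dr] := closed_field_poly_normal (map_poly ratr q : {poly algC}).
apply: (@sub_finite_set _ _ [set` r]); last exact: finite_seq.
move=> a /=; rewrite Dr rootZ ?root_prod_XsubC //.
by rewrite lead_coef_eq0 map_poly_eq0.
Qed.

(** * Heights in a fixed finite Galois extension *)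

Section GaloisSystemTheory.
Variables (R : realType) (E : set algC) (g : nat) (gs : 'I_g -> {rmorphism algC -> algC}).
Hypothesis gsP : galois_system R E gs.

Lemma galois_root a (q : {poly rat}) : E a -> \prod_j ('X - (gs j a)%:P) = map_poly ratr q ->
  q != 0 /\ root (map_poly ratr q) a.
Proof.
move=> Ea Dq; have [i gi] := galois_id gsP; split; last first.
  by rewrite -Dq (bigD1 i) //= rootM gi // root_XsubC eqxx.
rewrite -(map_poly_eq0 (ratr : {rmorphism rat -> algC})) -Dq.
by apply/prodf_neq0 => j _; rewrite polyXsubC_eq0.
Qed.

Lemma galois_coef_bound a (q : {poly rat}) k W : E a -> uniq W ->
    {in W, forall o, is_place o} -> \prod_j ('X - (gs j a)%:P) = map_poly ratr q ->
  \prod_(o <- W) Num.max 1 (abs_at R o q`_k) <= (2 * weil_height R a) ^+ g.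
Proof.
move=> Ea uW WP Dq.
pose c (o : option nat) : R := if o is None then 2 else 1.
have cle o : is_place o -> Num.max 1 (abs_at R o q`_k) <=
    c o ^+ g * \prod_j Num.max 1 (place_ext R o (gs j a)).
  move=> op; have [uP ue um] := place_extP R op.
  have c1 : 1 <= c o by case: (o) => //=; rewrite ler1n.
  rewrite ge_max; apply/andP; split.
    rewrite -[leLHS]mulr1; apply: ler_pM => //; first exact: exprn_ege1.
    by apply: (big_ind (fun z => 1 <= z)) => // [x y x1 y1|j _];
      [rewrite -[leLHS]mulr1 ler_pM | rewrite le_max lexx].
  rewrite -ue -coef_map -Dq; apply: coef_prod_XsubC_le => //.
  case: o op uP ue um c1 => [p|] op uP ue um c1; last exact: arch_step.
  exact: ultra_step uP (um isT).
apply: (@le_trans _ _ (\prod_(o <- W) (c o ^+ g * \prod_j Num.max 1 (place_ext R o (gs j a))))).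
  rewrite big_seq [leRHS]big_seq; apply: ler_prod => o oW.
  by rewrite le_max ler01 /= cle // WP.
rewrite big_split /= exprMn.
have prod0 o : 0 <= \prod_j Num.max 1 (place_ext R o (gs j a)).
  by apply: prodr_ge0 => j _; rewrite le_max ler01.
apply: ler_pM.
- by apply: prodr_ge0 => o _; rewrite exprn_ge0 //; case: (o).
- by apply: prodr_ge0.
- rewrite prodrXl; apply: lerXn2r; rewrite ?nnegrE //.
    by apply: prodr_ge0 => o _; case: (o).
  have [h|h] := boolP (None \in W); last first.
    rewrite big1_seq ?ler1n // => -[p|] //= hW; by rewrite hW in h.
  by rewrite (bigD1_seq None) //= big1 ?mulr1 // => -[p|].
exact: (galois_height gsP uW WP Ea).
Qed.

(** Northcott's argument on characteristic polynomials: by [galois_coef_bound] each coefficient lies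
    in a finite set of rationals, which leaves finitely many polynomials and so finitely many
    roots. *)
Lemma galois_northcott X : finite_set [set a | E a /\ weil_height R a <= X].
Proof.
pose S := [set c : rat | forall W, uniq W -> {in W, forall o, is_place o} ->
    \prod_(o <- W) Num.max 1 (abs_at R o c) <= (2 * X) ^+ g].
have fS : finite_set S := @rat_bounded_finite R _.
apply: (@sub_finite_set _ _ (\bigcup_(q in [set q : {poly rat} |
    [/\ q != 0, (size q <= g.+1)%N & forall k, S q`_k]]) [set a | root (map_poly ratr q) a])).
  move=> a [Ea Ha]; have [q Dq] := galois_prod_poly gsP Ea.
  have [q0 qa] := galois_root Ea Dq; exists q => //; split=> //.
    by rewrite -(size_map_poly (ratr : {rmorphism rat -> algC})) -Dq -big_enum /=
      size_prod_XsubC size_enum_ord.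
  move=> k W uW WP; apply: le_trans (galois_coef_bound k Ea uW WP Dq) _.
  have H0 := weil_height_ge1 R a.
  by apply: lerXn2r; rewrite ?nnegrE; lra.
apply: bigcup_finite => [|q [q0 _ _]]; last exact: roots_finite.
have fP := @finite_finset {ffun 'I_g.+1 -> 'I_(size (finmap.enum_fset (fset_set S)))} setT.
apply: (@sub_finite_set _ _ [set \poly_(i < g.+1) (finmap.enum_fset (fset_set S))`_(f (inord i))
    | f in [set: {ffun 'I_g.+1 -> 'I_(size (finmap.enum_fset (fset_set S)))}]]); last first.
  exact: finite_image.
move=> q [q0 sq Sq].
have qS k : q`_k \in finmap.enum_fset (fset_set S).
  by rewrite in_fset_set //; apply/mem_set/Sq.
have idx (i : 'I_g.+1) : (seq.index (q`_i)%R (finmap.enum_fset (fset_set S)) < size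
  (finmap.enum_fset (fset_set S)))%N.
  by rewrite index_mem.
exists [ffun i => Ordinal (idx i)] => //; apply/polyP => i; rewrite coef_poly.
case: ifP => [ig|]; last by move=> /negbT; rewrite -leqNgt => gi;
  rewrite nth_default // (leq_trans sq).
by rewrite ffunE /= inordK // nth_index.
Qed.

(* The product formula for the norm of [a - sigma a]; the trivial bound by
   maxima at each place is improved by [theta] above [p]. *)
Lemma galois_gap a i p theta : E a -> gs i a != a -> prime p -> 0 < theta ->
    (forall j, place_ext R (Some p) (gs j (a - gs i a)) <=
      theta * (Num.max 1 (place_ext R (Some p) (gs j a)) *
               Num.max 1 (place_ext R (Some p) (gs j (gs i a))))) ->
  1 <= 2 * theta * weil_height R a ^+ 2.
Proof.
move=> Ea ga pp th0 hp; set b := a - gs i a.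
have Eb : E b.
  by apply: (subringB (subfield_subring (galois_subfield gsP))) => //; apply: (galois_stable gsP).
have [q Dq] := galois_prod_poly gsP Eb.
have Nq : \prod_j gs j b = ratr ((-1) ^+ g * q`_0).
  rewrite rmorphM rmorph_sign -coef_map -Dq -horner_coef0 horner_prod.
  rewrite -[in (-1) ^+ g](card_ord g) -prodr_const -big_split /=; apply: eq_bigr => j _.
  by rewrite !hornerE mulN1r opprK.
set n := _ * q`_0 in Nq.
have n0 : n != 0.
  suff : ratr n != 0 :> algC by rewrite fmorph_eq0.
  by rewrite -Nq; apply/prodf_neq0 => j _; rewrite fmorph_eq0 subr_eq0 eq_sym.
pose P := undup (p :: primes `|numq n| ++ primes `|denq n|).
have PP r : r \in P -> prime r.
  rewrite mem_undup inE mem_cat => /predU1P[-> //|].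
  by case/orP; rewrite mem_primes => /andP[].
have pf := @product_formula R P n n0 (undup_uniq _) _ _ PP.
have {}pf : archimedean_abs R n * \prod_(r <- P) padic_abs R r n = 1.
  by apply: pf => r hr; rewrite mem_undup inE mem_cat hr ?orbT.
pose W := None :: [seq Some r | r <- P].
have uW : uniq W.
  rewrite /W /= map_inj_uniq ?undup_uniq ?andbT; last by move=> x y [].
  by apply/negP => /mapP[].
have WP : {in W, forall o, is_place o}.
  by move=> o; rewrite inE => /predU1P[-> //|/mapP[r /PP rp ->]].
(* The constant of the estimate for |a - sigma a| at o: 2 from the triangle inequality at infinity,
   1 from the ultrametric one, and theta at p. *)
pose k (o : option nat) : R := if o is Some r then if r == p then theta else 1 else 2.
have k0 o : 0 <= k o by case: o => [r|] //=; case: eqP => // _; apply: ltW.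
pose m o j := Num.max 1 (place_ext R o (gs j a)).
pose m' o j := Num.max 1 (place_ext R o (gs j (gs i a))).
have m1 o j : 1 <= m o j by rewrite le_max lexx.
have m1' o j : 1 <= m' o j by rewrite le_max lexx.
have bound o j : is_place o -> place_ext R o (gs j b) <= k o * (m o j * m' o j).
  move=> op; have [uP ue um] := place_extP R op.
  have x1 := m1 o j; have y1 := m1' o j.
  have x2 : place_ext R o (gs j a) <= m o j by rewrite le_max lexx orbT.
  have y2 : place_ext R o (gs j (gs i a)) <= m' o j by rewrite le_max lexx orbT.
  have x3 : m o j <= m o j * m' o j by rewrite ler_peMr // (le_trans ler01).
  have y3 : m' o j <= m o j * m' o j by rewrite ler_peMl // (le_trans ler01).
  rewrite /b rmorphB.
  case: o op uP ue um x1 y1 x2 y2 x3 y3 => [r|] /= op uP ue um x1 y1 x2 y2 x3 y3.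
    case: eqVneq => [->|rp]; first by rewrite -rmorphB; apply: hp.
    rewrite mul1r; apply: le_trans (um isT _ _) _; rewrite (absvalN uP) ge_max.
    by rewrite (le_trans x2) //= (le_trans y2).
  by apply: le_trans (absvalB uP _ _) _; lra.
have : \prod_(o <- W) abs_at R o n = 1 by rewrite big_cons big_map.
move=> pfW.
have le1 : 1 <= \prod_(o <- W) (k o ^+ g * (\prod_j m o j * \prod_j m' o j)).
  rewrite -[leLHS]pfW big_seq [leRHS]big_seq; apply: ler_prod => o oW.
  have op := WP _ oW; have [uP ue um] := place_extP R op.
  rewrite -ue absval_ge0 //= -Nq (absval_prod uP) -big_split /=.
  rewrite -[in k o ^+ g](card_ord g) -prodr_const -big_split /=.
  by apply: ler_prod => j _; rewrite absval_ge0 //= bound.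
have prodk : \prod_(o <- W) k o ^+ g = (2 * theta) ^+ g.
  rewrite prodrXl big_cons big_map (bigD1_seq p) ?undup_uniq //=; last first.
    by rewrite mem_undup mem_head.
  by rewrite eqxx big1 ?mulr1 // => r /negPf ->.
(* The conjugates of sigma a are those of a up to order, so both products of maxima are bounded by
   the same power of the height; this is the origin of the square. *)
have mm' : \prod_(o <- W) \prod_j m' o j = \prod_(o <- W) \prod_j m o j.
  apply: eq_bigr => o _.
  exact: (galois_reindex gsP (fun z => Num.max 1 (place_ext R o z)) i Ea).
rewrite !big_split /= prodk mm' in le1.
have H0 := le_trans ler01 (weil_height_ge1 R a).
have HW := galois_height gsP uW WP Ea.
have HW0 : 0 <= \prod_(o <- W) \prod_j m o j.
  by apply: prodr_ge0 => o _; apply: prodr_ge0 => j _; apply: le_trans (m1 o j).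
have th2 : 0 <= 2 * theta * weil_height R a ^+ 2.
  by rewrite mulr_ge0 ?exprn_ge0 // mulr_ge0 // ltW.
rewrite -(ler_pXn2r (galois_size gsP)) ?nnegrE // expr1n; apply: le_trans le1 _.
rewrite [leRHS]exprMn ler_wpM2l ?exprn_ge0 ?mulr_ge0 ?(ltW th0) //.
have -> : (weil_height R a ^+ 2) ^+ g = weil_height R a ^+ g * weil_height R a ^+ g.
  by rewrite -exprM -exprD addnn mul2n.
by apply: ler_pM => //; apply: HW.
Qed.

End GaloisSystemTheory.

(** * Radical towers *)

(** Inverting positive integers alone already yields the fraction field of a ring of algebraic
    numbers, by [qspanV]. *)
Definition qspan (A : set algC) : set algC :=
  [set z | exists2 m : nat, (0 < m)%N & A (m%:R * z)].

Section Qspan.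
Variable A : set algC.
Hypothesis AP : subring A.

Lemma sub_qspan : A `<=` qspan A.
Proof. by move=> x Ax; exists 1%N => //; rewrite mul1r. Qed.

Lemma qspan_subring : subring (qspan A).
Proof.
split=> [|x y [m m0 mx] [n n0 ny]|x y [m m0 mx] [n n0 ny]].
- by apply: sub_qspan; apply: subring1.
- exists (m * n)%N; first by rewrite muln_gt0 m0.
  have -> : (m * n)%N%:R * (x - y) = n%:R * (m%:R * x) - m%:R * (n%:R * y).
    by rewrite natrM; ring.
  by apply: subringB => //; apply: subringM => //; apply: subring_nat.
- exists (m * n)%N; first by rewrite muln_gt0 m0.
  have -> : (m * n)%N%:R * (x * y) = (m%:R * x) * (n%:R * y) by rewrite natrM; ring.
  exact: subringM.
Qed.

Lemma qspan_div_nat z n : qspan A z -> qspan A (z / n%:R).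
Proof.
move=> [m m0 mz]; have [->|n0] := posnP n.
  by rewrite invr0 mulr0; apply: subring0 qspan_subring.
exists (m * n)%N; first by rewrite muln_gt0 m0.
rewrite natrM mulrACA divff ?mulr1 //.
by rewrite pnatr_eq0 -lt0n.
Qed.

Lemma qspan_rat q : qspan A (ratr q).
Proof.
have -> : ratr q = (numq q)%:~R / `|denq q|%:R :> algC.
  by rewrite /ratr natr_absz gtr0_norm.
by apply: qspan_div_nat; apply: sub_qspan; apply: subring_int.
Qed.

(** The minimal polynomial of z has nonzero constant term, so dividing its relation by z writes 1/z
    as a rational polynomial in z. *)
Lemma qspanV z : qspan A z -> qspan A z^-1.
Proof.
move=> Az; have [->|z0] := eqVneq z 0; first by rewrite invr0; apply: subring0 qspan_subring.
have [q [_ mon_q] qP] := minCpolyP z.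
have q0 : q`_0 != 0.
  apply/negP => /eqP q00; have /factor_theorem[q1 Dq] : root q 0 by rewrite /root horner_coef0 q00.
  have q1z : root (map_poly ratr q1 : {poly algC}) z.
    have : root (map_poly ratr q : {poly algC}) z by rewrite qP.
    rewrite Dq rmorphM rootM => /orP[//|].
    by rewrite /= map_polyXsubC rmorph0 root_XsubC (negPf z0).
  move: q1z; rewrite qP => /dvdp_leq.
  have q10 : q1 != 0 by apply: contraTneq mon_q => q10;
    rewrite Dq q10 mul0r monicE lead_coef0 eq_sym oner_eq0.
  by move=> /(_ q10); rewrite {1}Dq size_Mmonic ?monicXsubC // size_XsubC addn2 ltnn.
have : (map_poly ratr q : {poly algC}).[z] = 0 by apply/eqP; rewrite -/(root _ _) qP.
rewrite (@horner_coef_wide _ (size q).+1) ?size_map_poly //.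
rewrite big_ord_recl mulr1 coef_map /=; set S := \sum_(i < _) _ => e.
pose T := \sum_(i < size q) (map_poly ratr q : {poly algC})`_i.+1 * z ^+ i.
have ST : S = z * T.
  by rewrite mulr_sumr; apply: eq_bigr => i _; rewrite exprS; ring.
have -> : z^-1 = - (ratr q`_0)^-1 * T.
  have r0 : ratr q`_0 != 0 :> algC by rewrite fmorph_eq0.
  apply: (mulfI z0); rewrite divff // mulrCA -ST.
  have -> : S = - ratr q`_0 by apply/eqP; rewrite -addr_eq0 addrC; apply/eqP.
  by rewrite mulrNN mulVf.
rewrite -fmorphV -rmorphN.
apply: (subringM qspan_subring); first exact: qspan_rat.
apply: (subring_sum qspan_subring) => i _; apply: (subringM qspan_subring).
  by rewrite coef_map; apply: qspan_rat.
exact: (subringX qspan_subring).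
Qed.

Lemma qspan_subfield : subfield (qspan A).
Proof.
split=> [|x y /set_mem Ax /set_mem Ay|x y /set_mem Ax /set_mem Ay]; apply/mem_set.
- exact: subring1 qspan_subring.
- exact: (subringB qspan_subring).
- by apply: (subringM qspan_subring) => //; apply: qspanV.
Qed.

End Qspan.

(** * Frobenius congruences modulo p *)

Section Congruence.
Variables (B : set algC) (p : nat).
Hypothesis BP : subring B.

Definition cong (x y : algC) : Prop := exists2 z, B z & x - y = p%:R * z.

Lemma cong_refl x : cong x x.
Proof. by exists 0; [exact: subring0 | rewrite subrr mulr0]. Qed.

Lemma cong_sym x y : cong x y -> cong y x.
Proof. by move=> [z Bz e]; exists (- z); [exact: subringN | rewrite mulrN -e opprB]. Qed.

Lemma cong_trans y x z : cong x y -> cong y z -> cong x z.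
Proof.
move=> [a Ba e] [b Bb e']; exists (a + b); first exact: subringD.
by rewrite mulrDr -e -e' addrA subrK.
Qed.

Lemma congD x y x' y' : cong x y -> cong x' y' -> cong (x + x') (y + y').
Proof.
move=> [a Ba e] [b Bb e']; exists (a + b); first exact: subringD.
by rewrite mulrDr -e -e' opprD addrACA.
Qed.

Lemma congM x y x' y' : B x -> B y' -> cong x y -> cong x' y' -> cong (x * x') (y * y').
Proof.
move=> Bx By' [a Ba e] [b Bb e']; exists (x * b + a * y').
  by apply: subringD => //; apply: subringM.
have -> : x * x' - y * y' = x * (x' - y') + (x - y) * y' by ring.
by rewrite e e'; ring.
Qed.

Lemma congX x y n : B x -> B y -> cong x y -> cong (x ^+ n) (y ^+ n).
Proof.
move=> Bx By xy; elim: n => [|n IHn]; first by rewrite !expr0; apply: cong_refl.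
by rewrite !exprS; apply: congM => //; apply: subringX.
Qed.

Hypothesis p_prime : prime p.

Lemma cong_exprp x y : B x -> B y -> cong ((x + y) ^+ p) (x ^+ p + y ^+ p).
Proof.
move=> Bx By; have p0 : (0 < p)%N by apply: prime_gt0.
have split_sum (f : nat -> algC) :
    \sum_(i < p.+1) f i = f 0%N + \sum_(i < p.-1) f i.+1 + f p.
  by case: p p0 => // n _; rewrite big_ord_recl big_ord_recr addrA.
rewrite exprDn (split_sum (fun i => x ^+ (p - i) * y ^+ i *+ 'C(p, i))).
rewrite subn0 bin0 subnn binn !mulr1n !expr0 mulr1 mul1r.
exists (\sum_(i < p.-1) (x ^+ (p - i.+1) * y ^+ i.+1) *+ ('C(p, i.+1) %/ p)).
  apply: subring_sum => // i _; rewrite -mulr_natr; apply: subringM => //; last exact: subring_nat.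
  by apply: subringM => //; apply: subringX.
rewrite mulr_sumr; set S := \sum_(i < _) _.
have -> : x ^+ p + S + y ^+ p - (x ^+ p + y ^+ p) = S by ring.
apply: eq_bigr => i _; rewrite mulr_natl -mulrnA divnK //.
by apply: prime_dvd_bin => //=; rewrite -[ltnRHS](prednK p0) ltnS.
Qed.

Lemma cong_exprpX x y f : B x -> B y ->
  cong ((x + y) ^+ (p ^ f)) (x ^+ (p ^ f) + y ^+ (p ^ f)).
Proof.
move=> Bx By; elim: f => [|f IHf]; first by rewrite expn0 !expr1; apply: cong_refl.
rewrite !expnSr !exprM; apply: cong_trans (cong_exprp _ _); try exact: subringX.
apply: congX IHf; first by apply: subringX => //; apply: subringD.
by apply: subringD => //; apply: subringX.
Qed.

End Congruence.

(* For N a power of p this says that A / pA is a reduced finite F_p-algebra,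
   which forces the p-adic value group of the fraction field of A to be that of
   Q, i.e. p to be unramified. *)
Definition frob (p N : nat) (A : set algC) : Prop := forall y, A y -> cong A p (y ^+ N) y.

Lemma cong_sub (A B : set algC) p x y : A `<=` B -> cong A p x y -> cong B p x y.
Proof. by move=> AB [z Az e]; exists z => //; apply: AB. Qed.

Lemma frob_int p f : prime p -> frob p (p ^ f) [set x | x \in Num.int].
Proof.
move=> pp y /= /intrP[m ->]; set Z := [set x : algC | _].
have ZP : subring Z by split=> [|x z|x z] /=; [exact: rpred1 | exact: rpredB | exact: rpredM].
have le (n : nat) : (n <= n ^ p)%N.
  by case: n => // n; rewrite -{1}(expn1 n.+1) leq_pexp2l // prime_gt0.
have fermatX (n : nat) : cong Z p (n%:R ^+ (p ^ f)) n%:R.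
  elim: f => [|f IHf]; first by rewrite expn0 expr1; apply: cong_refl.
  rewrite expnSr exprM; apply: (cong_trans ZP) (_ : cong Z p (n%:R ^+ p) n%:R).
    by apply: congX => //; [apply: subringX => // |]; apply: subring_nat.
  have := fermat_little n pp; move=> /eqP; rewrite eqn_mod_dvd //.
  move=> /dvdnP[k hk]; exists k%:R; first exact: subring_nat.
  by rewrite -natrX -natrB // hk natrM mulrC.
have pgt : (0 < p)%N by apply: prime_gt0.
have mr : cong Z p (m%:~R) (`|(m %% p)%Z|%N%:R).
  exists (m %/ p)%Z%:~R; first exact: subring_int.
  rewrite natr_absz ger0_norm ?modz_ge0 ?eqz_nat -?lt0n // {1}(divz_eq m p).
  by rewrite rmorphD rmorphM /= addrK mulrC.
apply: (cong_trans ZP) (cong_sym ZP mr).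
apply: (cong_trans ZP) (fermatX _).
by apply: congX => //; [apply: subring_int | apply: subring_nat].
Qed.

(** Raising to the power p^f respects sums and products modulo p, so the congruence only has to be
    checked on A and on theta. *)
Lemma frob_adjoin A p f theta : subring A -> prime p -> frob p (p ^ f) A ->
    cong (ring_adjoin A theta) p (theta ^+ (p ^ f)) theta ->
  frob p (p ^ f) (ring_adjoin A theta).
Proof.
move=> AP pp fA ft _ [h Ah ->]; have BP := ring_adjoinP AP theta.
have AB := @sub_ring_adjoin _ AP theta.
have Bt := ring_adjoin_gen AP theta.
elim/poly_ind: h Ah => [|h c IHh] Ah.
  rewrite horner0 expr0n -[_ == 0%N]negbK -lt0n expn_gt0 prime_gt0 //=; exact: cong_refl.
have Ac : A c by have := Ah 0%N; rewrite coefD coefMX coefC eqxx add0r.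
have {}Ah : coefs_in A h.
  by move=> i; have := Ah i.+1; rewrite coefD coefMX coefC /= addr0.
have Bh : ring_adjoin A theta h.[theta] by exists h.
rewrite hornerMXaddC; apply: (cong_trans BP).
  by apply: cong_exprpX => //; [apply: subringM | apply: AB].
apply: congD => //; last by apply: cong_sub AB _; apply: fA.
by rewrite exprMn; apply: congM => //; [apply: subringX | apply: IHh].
Qed.

(** If p^f - 1 = t d (p - 1), then theta^(p^f - 1) = q^((p - 1) t), which is 1 modulo p by
    Fermat. *)
Lemma cong_root A p f theta d q : subring A -> prime p -> (d * p.-1 %| (p ^ f).-1)%N ->
  theta ^+ d = q%:R -> coprime p q -> cong (ring_adjoin A theta) p (theta ^+ (p ^ f)) theta.
Proof.
move=> AP pp /dvdnP[t ht] tq pq; have BP := ring_adjoinP AP theta.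
have N0 : (0 < p ^ f)%N by rewrite expn_gt0 prime_gt0.
have qt : (q ^ (p.-1 * t) = 1 %[mod p])%N.
  rewrite expnM -modnXm -totient_prime // Euler_exp_totient ?modnXm ?exp1n //.
  by rewrite coprime_sym.
have q0 : (0 < q)%N by case: q pq {tq qt} => //; rewrite /coprime gcdn0 => /eqP p1; move: pp;
  rewrite p1.
have qt0 : (1 <= q ^ (p.-1 * t))%N by rewrite expn_gt0 q0.
have /eqP := qt; rewrite eqn_mod_dvd // => /dvdnP[k hk].
exists (theta * k%:R).
  by apply: subringM => //; [apply: ring_adjoin_gen | apply: subring_nat].
rewrite -(prednK N0) exprS ht [X in theta ^+ X]mulnC -mulnA exprM tq -natrX.
rewrite -{2}[theta]mulr1 -mulrBr -[X in _ - X]/(1%:R) -natrB // hk natrM; ring.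
Qed.

(** * Ultrametric estimates above p *)

Section Ultrametric.
Variables (R : realType) (u : algC -> R) (p : nat).
Hypotheses (uP : absval u) (um : forall x y, u (x + y) <= Num.max (u x) (u y)).
Hypothesis p_prime : prime p.
Hypothesis up : forall q, u (ratr q) = padic_abs R p q.

Let pR0 : 0 < (p%:R : R). Proof. by rewrite ltr0n prime_gt0. Qed.

Lemma ultra_le B x y : u x <= B -> u y <= B -> u (x + y) <= B.
Proof. by move=> xB yB; apply: le_trans (um x y) _; rewrite ge_max xB. Qed.

Lemma ultra_sum_le (I : Type) (r : seq I) (P : pred I) (t : I -> algC) B : 0 <= B ->
  (forall i, P i -> u (t i) <= B) -> u (\sum_(i <- r | P i) t i) <= B.
Proof.
move=> B0 tB; elim/big_ind: _ => //; first by rewrite (absval0 uP).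
by move=> x y; apply: ultra_le.
Qed.

Lemma ultra_nat_le1 n : u n%:R <= 1.
Proof.
elim: n => [|n IHn]; first by rewrite (absval0 uP).
by rewrite mulrSr; apply: ultra_le => //; rewrite (absval1 uP).
Qed.

Lemma ultra_nat n : (0 < n)%N -> u n%:R = (p%:R ^+ logn p n)^-1.
Proof. by move=> n0; rewrite -(ratr_nat algC) up padic_abs_nat. Qed.

Lemma ultra_p : u p%:R = p%:R^-1.
Proof. by rewrite ultra_nat ?prime_gt0 // logn_prime // eqxx. Qed.

Lemma ultra_int_le1 x : x \in Num.int -> u x <= 1.
Proof.
move=> /intrP[[n|n] ->]; first exact: ultra_nat_le1.
by rewrite NegzE mulrNz (absvalN uP); apply: ultra_nat_le1.
Qed.

Lemma ultra_adjoin_le1 A theta : (forall x, A x -> u x <= 1) -> u theta <= 1 ->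
  forall x, ring_adjoin A theta x -> u x <= 1.
Proof.
move=> A1 t1 _ [h Ah ->]; rewrite horner_coef; apply: ultra_sum_le => // i _.
rewrite (absvalM uP); apply: mulr_ile1; rewrite ?(absval_ge0 uP) //; first exact: A1.
by rewrite (absvalX uP) exprn_ile1 // (absval_ge0 uP).
Qed.

(* Multiplying x by the unit x^(N-1) - 1 produces a multiple of p. *)
Lemma unramified_val A N : (1 < N)%N -> frob p N A -> (forall x, A x -> u x <= 1) ->
  forall x, A x -> x != 0 -> exists k : nat, u x = (p%:R ^+ k)^-1.
Proof.
move=> N1 fA A1 x Ax x0.
have p1 : 1 < (p%:R : R) by rewrite ltr1n prime_gt1.
have [M] := @expr_unbounded R p%:R (u x)^-1 p1.
rewrite -(absval_gt0 uP) in x0; elim: M x Ax x0 => [|M IHM] x Ax x0 hM.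
  by move: hM; rewrite expr0 invf_lt1 // ltNge A1.
have [ux|ux] := ltP (u x) 1; last first.
  by exists 0%N; rewrite expr0 invr1; apply/eqP; rewrite eq_le ux A1.
have [z Az e] := fA x Ax.
have e2 : (x ^+ N.-1 - 1) * x = p%:R * z.
  by rewrite -e mulrBl mul1r -exprSr prednK // ltnW.
have us : u (x ^+ N.-1 - 1) = 1.
  have lt : u (x ^+ N.-1) < 1 by rewrite (absvalX uP) exprn_ilt1 ?absval_ge0 // -lt0n;
    case: N N1 {fA e e2} => [|[]].
  apply/eqP; rewrite eq_le; apply/andP; split.
    by apply: ultra_le; [apply: ltW | rewrite (absvalN uP) (absval1 uP)].
  have := um (x ^+ N.-1) (1 - x ^+ N.-1); rewrite addrC subrK (absval1 uP) (absval_distC uP).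
  by rewrite le_max leNgt lt.
have ez : u z = p%:R * u x.
  have := congr1 u e2; rewrite !(absvalM uP) us ultra_p mul1r => ->.
  by rewrite mulrA divff ?mul1r // gt_eqF.
have z0 : 0 < u z by rewrite ez mulr_gt0.
have [k hk] : exists k : nat, u z = (p%:R ^+ k)^-1.
  apply: IHM => //; rewrite ez invfM mulrC ltr_pdivrMr //.
  by rewrite -exprSr.
by exists k.+1; rewrite exprS invfM -hk ez mulrA mulVf ?mul1r // gt_eqF.
Qed.

Lemma qspan_val A N : (1 < N)%N -> frob p N A -> (forall x, A x -> u x <= 1) ->
  forall x, qspan A x -> x != 0 -> exists k : int, u x = p%:R ^ k.
Proof.
move=> N1 fA A1 x [m m0 Amx] x0.
have mn0 : m%:R != 0 :> algC by rewrite pnatr_eq0 -lt0n.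
have [k hk] := unramified_val N1 fA A1 Amx (mulf_neq0 mn0 x0).
exists ((logn p m)%:Z - k%:Z).
rewrite expfzDr ?gt_eqF // -invr_expz -!exprnP -hk (absvalM uP) ultra_nat //.
by rewrite mulVKf // expf_neq0 // gt_eqF.
Qed.

Lemma ultra_dominant (I : finType) (t : I -> algC) i0 :
  (forall i, i != i0 -> u (t i) < u (t i0)) -> u (\sum_i t i) = u (t i0).
Proof.
move=> dom; have [t0|t0] := eqVneq (u (t i0)) 0.
  rewrite t0; apply/eqP; rewrite eq_le absval_ge0 // andbT; apply: ultra_sum_le => // i _.
  have [->|/dom] := eqVneq i i0; first by rewrite t0.
  by rewrite t0; apply: ltW.
rewrite (bigD1 i0) //=; set S := \sum_(i | _) _.
have Slt : u S < u (t i0).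
  apply: (big_ind (fun z => u z < u (t i0))) => // [|x y hx hy].
    by rewrite (absval0 uP) lt_def t0 absval_ge0.
  by apply: le_lt_trans (um x y) _; rewrite gt_max hx.
apply/eqP; rewrite eq_le; apply/andP; split; first by apply: ultra_le => //; apply: ltW.
have := um (t i0 + S) (- S); rewrite addrK (absvalN uP) le_max => /orP[//|].
by rewrite leNgt Slt.
Qed.

Lemma ultra_sum_ge (I : finType) (t : I -> algC) :
    (forall i j, i != j -> t i != 0 -> u (t i) != u (t j)) ->
  forall i, u (t i) <= u (\sum_j t j).
Proof.
move=> dist i; case: (@Order.TotalTheory.arg_maxP _ _ I i xpredT (fun j => u (t j))) => // i0 _
  imax.
have [t0|t0] := eqVneq (t i0) 0.
  by apply: le_trans (imax i isT) _; rewrite /= t0 (absval0 uP) absval_ge0.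
rewrite (@ultra_dominant _ _ i0); first exact: imax.
move=> j ji0; have le : u (t j) <= u (t i0) by apply: imax.
by rewrite lt_def le andbT; apply: dist => //; rewrite eq_sym.
Qed.

(* The values of the terms of a are r ^ n with exponents n that are distinct
   mod d, so none of them cancels; a - a' only involves terms with d not
   dividing n, hence with value at most r or at least r^-1. *)
Lemma kummer_gap (K : set algC) d (c : nat -> algC) (pi pi' a a' : algC) r :
    (forall x, K x -> x != 0 -> exists k : int, u x = p%:R ^ k) -> (0 < d)%N ->
    (forall j, K (c j)) -> pi ^+ d = p%:R -> pi' ^+ d = p%:R -> 0 < r -> r ^+ d = p%:R^-1 ->
    a = \sum_(j < d) c j * pi ^+ j -> a' = \sum_(j < d) c j * pi' ^+ j ->
  u (a - a') <= r * (Num.max 1 (u a) * Num.max 1 (u a')).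
Proof.
move=> Kval d0 Kc pid pid' r0 rd aE a'E.
have upi z : z ^+ d = p%:R -> u z = r.
  move=> zd; apply: (pexpIrn d0); rewrite ?nnegrE ?absval_ge0 ?(ltW r0) //.
  by rewrite -(absvalX uP) zd ultra_p rd.
have r1 : r < 1.
  rewrite -(expr_lt1 d0) ?(ltW r0) // rd invf_lt1 //.
  by rewrite ltr1n prime_gt1.
have r1' : r != 1 by rewrite lt_eqF.
have val j z : z ^+ d = p%:R -> c j != 0 ->
    exists k : int, u (c j * z ^+ j) = r ^ (j%:Z - d%:Z * k).
  move=> zd cj; have [k hk] := Kval _ (Kc j) cj; exists k.
  rewrite (absvalM uP) (absvalX uP) (upi z zd) hk expfzDr ?gt_eqF // mulrC; congr (_ * _).
  by rewrite -mulrN -exprz_exp -exprnP rd exprz_inv opprK.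
have dist z : z ^+ d = p%:R -> forall i j : 'I_d, i != j -> c i * z ^+ i != 0 ->
    u (c i * z ^+ i) != u (c j * z ^+ j).
  move=> zd i j ij ti.
  have ci : c i != 0 by apply: contraNneq ti => ->; rewrite mul0r.
  have [cj|cj] := eqVneq (c j) 0.
    by rewrite cj mul0r (absval0 uP) absval_eq0.
  have [k ->] := val i z zd ci; have [l ->] := val j z zd cj.
  apply: contraNneq ij => /(ieexprIz r0 r1') e; apply/eqP/val_inj => /=.
  have := ltn_ord i; have := ltn_ord j; move: e.
  move: (nat_of_ord i) (nat_of_ord j) => m n e nd md.
  have {}e : m%:Z - n%:Z = d%:Z * (k - l) by lia.
  have kl : k - l = 0 by nia.
  by move: e; rewrite kl mulr0; lia.
have ge_a (j : 'I_d) : u (c j * pi ^+ j) <= u a.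
  by rewrite aE; exact: ultra_sum_ge (dist pi pid) j.
have ge_a' (j : 'I_d) : u (c j * pi' ^+ j) <= u a'.
  by rewrite a'E; exact: ultra_sum_ge (dist pi' pid') j.
set M := _ * Num.max 1 (u a').
have M1 : 1 <= M.
  by rewrite /M -[leLHS]mulr1; apply: ler_pM; rewrite ?ler01 // le_max lexx.
have M0 : 0 <= r * M by rewrite mulr_ge0 ?(ltW r0) // (le_trans ler01).
rewrite aE a'E -sumrB; apply: ultra_sum_le => // j _.
have same : u (c j * pi' ^+ j) = u (c j * pi ^+ j).
  by rewrite !(absvalM uP) !(absvalX uP) (upi _ pid) (upi _ pid').
have [j0|j0] := eqVneq (j : nat) 0%N; first by rewrite j0 !expr0 subrr (absval0 uP).
have [cj|cj] := eqVneq (c j) 0; first by rewrite cj !mul0r subrr (absval0 uP).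
apply: (@le_trans _ _ (u (c j * pi ^+ j))).
  by apply: ultra_le => //; rewrite (absvalN uP) same.
have [k hk] := val j pi pid cj.
(* Since 0 < j < d, the exponent is not divisible by d, in particular not zero. *)
have n0 : j%:Z - d%:Z * k != 0.
  apply/eqP => e; have := ltn_ord j; move: e j0.
  move: (nat_of_ord j) => m e /eqP m0 md.
  have k0 : k = 0 by nia.
  by move: e; rewrite k0 mulr0; lia.
set n := _ - _ in hk n0.
have [npos|nneg] := ltP 0 n.
  apply: (@le_trans _ _ r); last by rewrite ler_peMr ?(ltW r0).
  rewrite hk; case: n npos {hk n0} => // -[//|n] _.
  by rewrite -exprnP exprS ler_piMr ?(ltW r0) // exprn_ile1 // ltW.
(* For a negative exponent the term T is at least 1/r. As T is also bounded by both maxima, T <= r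
   T^2 <= r M. *)
have big : r^-1 <= u (c j * pi ^+ j).
  rewrite hk; have {nneg n0 hk} : n < 0 by rewrite lt_def eq_sym n0.
  case: n => // n _; rewrite NegzE -exprnN exprS invfM ler_peMr ?invr_ge0 ?(ltW r0) //.
  by rewrite invf_ge1 ?exprn_gt0 // exprn_ile1 // ltW.
set T := u _ in big *.
have T0 : 0 < T by apply: lt_le_trans big; rewrite invr_gt0.
have TT : T * T <= M.
  rewrite /M; apply: ler_pM; rewrite ?(ltW T0) // le_max ?ge_a ?orbT //.
  by rewrite /T -same ge_a' orbT.
apply: (@le_trans _ _ (r * (T * T))); last by rewrite ler_pM2l.
rewrite mulrA ler_peMl ?(ltW T0) //.
by rewrite -(ler_pM2l (_ : 0 < r^-1)) ?invr_gt0 // mulKf ?gt_eqF // mulr1.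
Qed.

End Ultrametric.

Section Tower.
Variables (P dg : nat -> nat).

Definition rad i : algC := (dg i).-root (P i)%:R.

(** Rings of algebraic integers rather than fields, since congruences modulo p carry no information
    in a field. The field K_i is [qspan (tower i)]. *)
Fixpoint tower i : set algC :=
  if i is i'.+1 then ring_adjoin (tower i') (rad i) else [set x | x \in Num.int].

Lemma tower_subring i : subring (tower i).
Proof.
elim: i => [|i IHi] /=; last exact: ring_adjoinP.
by split=> [|x z|x z] /=; [exact: rpred1 | exact: rpredB | exact: rpredM].
Qed.

Lemma tower_mono i j : (i <= j)%N -> tower i `<=` tower j.
Proof.
move=> /subnK <-; elim: (j - i)%N => [//|k IHk] x /IHk kx.
by rewrite addSn; apply: sub_ring_adjoin => //; apply: tower_subring.
Qed.

Lemma tower_rad i : (0 < i)%N -> tower i (rad i).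
Proof. by case: i => //= i _; apply: ring_adjoin_gen; apply: tower_subring. Qed.

Lemma tower_ind i (B : set algC) : subring B ->
  (forall k, (0 < k <= i)%N -> B (rad k)) -> tower i `<=` B.
Proof.
move=> BP; elim: i => [|i IHi] Brad x /=.
  by move=> /intrP[m ->]; apply: subring_int.
move=> [h Ah ->]; rewrite horner_coef; apply: subring_sum => // k _.
apply: subringM => //; last by apply: subringX => //; apply: Brad; rewrite leqnn.
apply: IHi; last exact: Ah.
by move=> l /andP[l0 li]; apply: Brad; rewrite l0 ltnW.
Qed.

Lemma qspan_sub A B : A `<=` B -> subfield B -> qspan A `<=` B.
Proof.
move=> AB Bf x [m m0 Amx]; have -> : x = m%:R * x / m%:R.
  by rewrite mulrAC divff ?mul1r // pnatr_eq0 -lt0n.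
apply: subfieldV_div => //; first exact: AB.
by apply: subring_nat; apply: subfield_subring.
Qed.

Lemma adjoin_tower : adjoin [set rad i | i in [set i | (1 <= i)%N]] `<=`
  [set x | exists i, qspan (tower i) x].
Proof.
apply: smallest_sub; last first.
  by move=> _ [i /= i1 <-]; exists i; apply: sub_qspan; apply: tower_rad.
have join x y : (exists i, qspan (tower i) x) -> (exists i, qspan (tower i) y) ->
    exists i, qspan (tower i) x /\ qspan (tower i) y.
  move=> [i xi] [j yj]; exists (maxn i j); split.
    case: xi => m m0 xi; exists m => //; exact: tower_mono (leq_maxl _ _) _ xi.
  case: yj => m m0 yj; exists m => //; exact: tower_mono (leq_maxr _ _) _ yj.
have sf i := qspan_subfield (tower_subring i).
split=> [|x y /set_mem hx /set_mem hy|x y /set_mem hx /set_mem hy]; apply/mem_set.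
- by exists 0%N; apply: subring1; apply: subfield_subring.
- have [i [xi yi]] := join x y hx hy; exists i.
  by apply: subringB => //; apply: subfield_subring.
- have [i [xi yi]] := join x y hx hy; exists i.
  by apply: subfieldV_div.
Qed.

Hypothesis dg0 : forall i, (0 < i)%N -> (0 < dg i)%N.

Lemma radE i : (0 < i)%N -> rad i ^+ dg i = (P i)%:R.
Proof. by move=> i0; rewrite /rad rootCK // dg0. Qed.

Lemma tower_frob p j : prime p ->
    (forall k, (0 < k <= j)%N -> coprime p (P k) /\ coprime p (dg k)) ->
  exists f, (1 < p ^ f)%N /\ frob p (p ^ f) (tower j).
Proof.
(* With f the totient of D, Euler's theorem gives D | p^f - 1, so one exponent serves all the
   radicals. Coprimality of p to the degrees makes D prime to p. *)
move=> pp cop; pose D := (p.-1 * \prod_(1 <= k < j.+1) dg k)%N.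
have pD : coprime p D.
  rewrite coprimeMr; apply/andP; split.
    by have p1 := prime_gt1 pp; rewrite prime_coprime // gtnNdvd //; lia.
  rewrite big_nat_cond; apply: (big_ind (fun n => coprime p n)).
  - exact: coprimen1.
  - by move=> a b pa pb; rewrite coprimeMr pa.
  - by move=> k /andP[/andP[k0 kj] _]; case: (cop k); rewrite ?k0.
have D0 : (0 < D)%N.
  by rewrite lt0n; apply: contraL pD => /eqP ->; rewrite /coprime gcdn0;
    apply: contraL pp => /eqP ->.
pose f := totient D; have f0 : (0 < f)%N by rewrite totient_gt0.
have N1 : (1 < p ^ f)%N by rewrite -(exp1n f) ltn_exp2r // prime_gt1.
have DN : (D %| (p ^ f).-1)%N.
  have /eqP := Euler_exp_totient pD; rewrite eqn_mod_dvd ?expn_gt0 ?prime_gt0 //.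
  by rewrite subn1.
exists f; split=> //.
have sub k : (0 < k <= j)%N -> (dg k * p.-1 %| (p ^ f).-1)%N.
  move=> /andP[k0 kj]; apply: dvdn_trans DN; rewrite /D mulnC dvdn_pmul2l; last first.
    by rewrite -subn1 subn_gt0 prime_gt1.
  by rewrite (bigD1_seq k) ?mem_index_iota ?iota_uniq ?k0 //= dvdn_mulr.
have {DN} : forall i, (i <= j)%N -> frob p (p ^ f) (tower i); last exact.
elim=> [|i IHi] ij; first exact: frob_int.
apply: frob_adjoin => //; [exact: tower_subring | exact/IHi/ltnW |].
by apply: cong_root (sub i.+1 _) (radE _) _ => //; [exact: tower_subring | case: (cop i.+1)].
Qed.

(** Horner induction: multiplying by the radical shifts the coefficients, and its [dg i.+1]-th power
    wraps around to the integer [P i.+1]. *)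
Lemma tower_top_expansion i x : qspan (tower i.+1) x ->
  exists2 c : nat -> algC, forall j, qspan (tower i) (c j) &
    x = \sum_(j < dg i.+1) c j * rad i.+1 ^+ j.
Proof.
have AP := tower_subring i; set A := tower i in AP *; set pi := rad i.+1.
have [d Dd] : exists d, dg i.+1 = d.+1 by exists (dg i.+1).-1; rewrite prednK // dg0.
have pid : pi ^+ d.+1 = (P i.+1)%:R by rewrite -Dd radE.
suff red y : ring_adjoin A pi y -> exists2 c : nat -> algC, forall j, A (c j) &
    y = \sum_(j < dg i.+1) c j * pi ^+ j.
  move=> [m m0 /red[c Ac Dc]]; exists (fun j => c j / m%:R).
    by move=> j; apply: qspan_div_nat => //; apply: sub_qspan.
  have mn0 : m%:R != 0 :> algC by rewrite pnatr_eq0 -lt0n.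
  apply: (mulfI mn0); rewrite Dc mulr_sumr; apply: eq_bigr => j _.
  by field.
rewrite Dd => -[h Ah ->].
elim/poly_ind: h Ah => [|h b IHh] Ah.
  exists (fun=> 0); first by move=> _; apply: subring0.
  by rewrite horner0 big1 // => j _; rewrite mul0r.
have Ab : A b by have := Ah 0%N; rewrite coefD coefMX coefC eqxx add0r.
have [|c Ac Dc] := IHh.
  by move=> k; have := Ah k.+1; rewrite coefD coefMX coefC /= addr0.
exists (fun j => if j is j'.+1 then c j' else c d * (P i.+1)%:R + b).
  case=> [|j] //; apply: subringD => //; apply: subringM => //; exact: subring_nat.
rewrite hornerMXaddC Dc big_ord_recr [RHS]big_ord_recl /= -pid expr0 mulr1.
rewrite mulrDl mulr_suml exprSr [RHS]addrC -mulrA !addrA; congr (_ + _ + _).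
by apply: eq_bigr => j _; rewrite exprSr mulrA.
Qed.

Hypothesis P_prime : forall i, (0 < i)%N -> prime (P i).
Hypothesis P_mono : forall i j, (0 < i)%N -> (i < j)%N -> (P i < P j)%N.
Hypothesis dg_le : forall i, (0 < i)%N -> (dg i <= P i)%N.

Variable R : realType.

(** The chosen automorphism fixes K_i, so x and its image have the same coefficients in expansions
    along two [dg i.+1]-th roots of p. This is the setting of [kummer_gap], whose bound at every
    conjugate feeds [galois_gap] with theta = r. *)
Lemma tower_gap i x (r : R) : qspan (tower i.+1) x -> ~ qspan (tower i) x ->
  0 < r -> r ^+ dg i.+1 = (P i.+1)%:R^-1 -> 1 <= 2 * r * weil_height R x ^+ 2.
Proof.
move=> Kx nKx r0 rd; set p := P i.+1 in rd *.
have pp : prime p by apply: P_prime.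
have [E [g [gs [gsP sE]]]] := galois_system_exists R [seq rad k | k <- iota 1 i.+1].
have Ef := galois_subfield gsP; have ER := subfield_subring Ef.
have Erad k : (0 < k <= i.+1)%N -> E (rad k).
  by move=> k0; apply: sE; apply: map_f; rewrite mem_iota add1n ltnS.
have Ex : E x by apply: (qspan_sub (tower_ind ER Erad) Ef).
have Kf := qspan_subfield (tower_subring i).
have [| l fix_l move_l] := galois_moves gsP (t := [seq rad k | k <- iota 1 i]) Kf _ Ex nKx.
  move=> _ /mapP[k + ->]; rewrite mem_iota add1n ltnS => /andP[k0 ki]; split.
    by apply: sub_qspan; apply: tower_mono ki _ _; apply: tower_rad.
  by apply: Erad; rewrite k0 ltnW.
have fixK y : qspan (tower i) y -> gs l y = y.
  apply: (@qspan_sub _ [set y | gs l y = y]).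
    apply: tower_ind => [|k k0] /=.
      by split=> [|a b /= ha hb|a b /= ha hb]; rewrite /= ?rmorph1 ?rmorphB ?rmorphM /= ?ha ?hb.
    by apply: fix_l; apply: map_f; rewrite mem_iota add1n ltnS.
  split=> [|a b /set_mem /= ha /set_mem /= hb|a b /set_mem /= ha /set_mem /= hb];
    apply/mem_set; by rewrite /= ?rmorph1 ?rmorphB ?fmorph_div /= ?ha ?hb.
have [c Kc Dx] := tower_top_expansion Kx.
(* The earlier primes are smaller than p, and each earlier degree is at most its own prime. *)
have cop k : (0 < k <= i)%N -> coprime p (P k) /\ coprime p (dg k).
  move=> /andP[k0 ki]; have lt : (P k < p)%N by apply: P_mono.
  split; rewrite prime_coprime // gtnNdvd //; first by rewrite prime_gt0 // P_prime.
    exact: dg0.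
  exact: leq_ltn_trans (dg_le k0) lt.
have [f [N1 fA]] := tower_frob pp cop.
apply: (galois_gap gsP Ex move_l pp r0) => j.
have [uP ue um] := @place_extP R (Some p) pp.
(* Composition with [gs j] again extends the p-adic absolute value, so one argument treats all
   conjugates. *)
pose u := place_ext R (Some p) \o gs j.
have uP' : absval u by apply: absval_comp.
have um' a b : u (a + b) <= Num.max (u a) (u b) by rewrite /u /= rmorphD um.
have ue' q : u (ratr q) = padic_abs R p q by rewrite /u /= fmorph_rat ue.
have A1 y : tower i y -> u y <= 1.
  have B : forall k, (k <= i)%N -> forall y, tower k y -> u y <= 1; last exact: B (leqnn i) y.
  elim=> [|k IHk] ki {}y; first exact: (ultra_int_le1 uP' um').
  apply: (ultra_adjoin_le1 uP' um') => //; first exact/IHk/ltnW.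
  rewrite -(@expr_le1 _ (dg k.+1)) ?dg0 ?(absval_ge0 uP') //.
  by rewrite -(absvalX uP') radE // (ultra_nat_le1 uP' um').
apply: (@kummer_gap R u p uP' um' pp ue' (qspan (tower i)) (dg i.+1) c (rad i.+1)
         (gs l (rad i.+1)) x (gs l x)) => //.
- exact: (qspan_val uP' um' pp ue' N1 fA A1).
- exact: dg0.
- exact: radE.
- by rewrite -rmorphXn radE // rmorph_nat.
- rewrite Dx rmorph_sum; apply: eq_bigr => k _.
  by rewrite rmorphM rmorphXn fixK.
Qed.

Lemma northcott_radicals :
    (forall C : R, exists n, forall i, (n <= i)%N -> C ^+ dg i < (P i)%:R) ->
  northcott R (adjoin [set rad i | i in [set i | (1 <= i)%N]]).
Proof.
move=> growth X X0; pose Y := Num.max 1 X.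
have Y1 : 1 <= Y by rewrite le_max lexx.
have XY : X <= Y by rewrite le_max lexx orbT.
(* The gap for height at most Y reads p <= (2 Y^2)^d, which fails for every index from n on. *)
have [n hn] := growth (2 * Y ^+ 2).
have [E [g [gs [gsP sE]]]] := galois_system_exists R [seq rad k | k <- iota 1 n].
apply: sub_finite_set (galois_northcott gsP X) => x [/adjoin_tower ex Hx]; split=> //.
have Ef := galois_subfield gsP; have ER := subfield_subring Ef.
have Erad k : (0 < k <= n)%N -> E (rad k).
  by move=> k0; apply: sE; apply: map_f; rewrite mem_iota add1n ltnS.
suff : qspan (tower n) x by apply: (qspan_sub (tower_ind ER Erad) Ef).
have ex' : exists i, `[< qspan (tower i) x >].
  by case: ex => i hi; exists i; apply/asboolP.
(* The least i with x in K_i supplies the hypothesis of [tower_gap] that x is not in the preceding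
   field. *)
case: (ex_minnP ex') => i /asboolP xi imin.
have up k : (k <= n)%N -> qspan (tower k) x -> qspan (tower n) x.
  by move=> kn [m m0 h]; exists m => //; apply: tower_mono kn _ h.
have [/up|] := leqP i n; first exact.
case: i xi imin => // i xi imin ni; exfalso.
have nxi : ~ qspan (tower i) x.
  by move=> h; have := imin i (asboolT h); rewrite ltnn.
pose p : R := (P i.+1)%:R.
have p0 : 0 < p by rewrite ltr0n prime_gt0 // P_prime.
pose r := p^-1 `^ ((dg i.+1)%:R^-1).
have r0 : 0 < r by rewrite powR_gt0 // invr_gt0.
have d0 : (dg i.+1)%:R != 0 :> R by rewrite pnatr_eq0 -lt0n dg0.
have rd : r ^+ dg i.+1 = p^-1.
  by rewrite /r -powR_mulrn ?powR_ge0 // -powRrM mulVf // powRr1 // invr_ge0 ltW.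
have gap := tower_gap xi nxi r0 rd.
have H1 := weil_height_ge1 R x.
have le : 1 <= r * (2 * Y ^+ 2).
  apply: le_trans gap _; have -> : r * (2 * Y ^+ 2) = 2 * r * Y ^+ 2 by ring.
  rewrite ler_wpM2l ?mulr_ge0 ?(ltW r0) //.
  by rewrite lerXn2r ?nnegrE //; lra.
have C0 : 0 <= 2 * Y ^+ 2 by rewrite mulr_ge0 // exprn_ge0 //; lra.
have := exprn_ege1 (dg i.+1) le; rewrite exprMn rd -ler_pdivrMl ?invr_gt0 // mulr1 invrK.
by rewrite leNgt (hn i.+1 (ltnW ni)).
Qed.

End Tower.

(** * The fields of the theorem *)

Lemma nth_primeS i : (nth_prime i < nth_prime i.+1)%N /\ prime (nth_prime i.+1).
Proof.
rewrite /nth_prime iterS /next_prime; case: ex_minnP => p /andP[lt pp] _.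
by split.
Qed.

Lemma nth_prime_prime i : prime (nth_prime i).
Proof. by case: i => // i; case: (nth_primeS i). Qed.

Lemma nth_prime_mono i j : (i < j)%N -> (nth_prime i < nth_prime j)%N.
Proof.
elim: j => // j IHj; rewrite ltnS leq_eqVlt => /predU1P[->|/IHj h].
  by case: (nth_primeS j).
by apply: ltn_trans h _; case: (nth_primeS j).
Qed.

Lemma nth_prime_gt i : (i.+1 < nth_prime i)%N.
Proof.
elim: i => // i IHi; apply: leq_ltn_trans IHi _.
by case: (nth_primeS i).
Qed.

Lemma nth_prime_inj : injective nth_prime.
Proof.
by move=> i j e; case: (ltngtP i j) => // /nth_prime_mono; rewrite e ltnn.
Qed.

Section RootDegree.
Variables (R : realType) (i : nat).
Hypothesis i0 : (0 < i)%N.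
Let p : R := (nth_prime i)%:R.
Let s : R := Num.sqrt (ln p).
Let d := root_degree R i.

(** From exp(-1/6) >= 5/6 one gets 1/e >= (5/6)^6 > 1/3; six is the least n for which (1 - 1/n)^n
    reaches 1/3. *)
Lemma expR1_le3 : expR 1 <= 3 :> R.
Proof.
have h : 5 / 6 <= expR (- (1 / 6)) :> R.
  by apply: le_trans (expR_ge1Dx _); lra.
have h6 : (5 / 6) ^+ 6 <= expR (- (1 / 6)) ^+ 6 :> R.
  by apply: lerXn2r; rewrite ?nnegrE ?expR_ge0 // divr_ge0.
have e : expR (- (1 / 6)) ^+ 6 = (expR 1)^-1 :> R.
  by rewrite -expRM_natl -expRN; congr expR; field.
rewrite e -[leRHS]div1r ler_pdivlMr ?expR_gt0 // in h6; lra.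
Qed.

(** For i >= 1 the prime is at least 3 >= e, which makes every root degree positive; the prime 2 at
    index 0 would give degree 0. *)
Lemma nth_prime_ln : 1 <= ln p.
Proof.
rewrite -[leLHS](expRK 1) ler_ln ?posrE ?expR_gt0 ?ltr0n //; last first.
  by rewrite prime_gt0 // nth_prime_prime.
apply: le_trans expR1_le3 _; rewrite ler_nat.
by apply: leq_trans (nth_prime_gt i); rewrite ltnS.
Qed.

Lemma sqrt_ln_sqr : s ^+ 2 = ln p.
Proof. by rewrite sqr_sqrtr // (le_trans ler01) // nth_prime_ln. Qed.

Lemma sqrt_ln_ge1 : 1 <= s.
Proof. by rewrite -sqrtr1 ler_wsqrtr // nth_prime_ln. Qed.

Lemma root_degree_itv : (1 <= d)%N /\ d%:R <= s < d.+1%:R.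
Proof.
have s0 : 0 <= s by apply: le_trans sqrt_ln_ge1.
split; last exact: truncn_itv.
by rewrite /d /root_degree truncn_gt0 sqrt_ln_ge1.
Qed.

(** The chain is d <= s <= s^2 = ln p <= p - 1. Strictness lets d + 1, the degree used for [L2],
    still be at most p. *)
Lemma root_degree_lt : (d < nth_prime i)%N.
Proof.
have [_ /andP[ds _]] := root_degree_itv.
have s1 := sqrt_ln_ge1; have e := sqrt_ln_sqr.
have lnp : ln p <= p - 1.
  have := @le_ln1Dx R (p - 1); rewrite addrCA subrr addr0; apply.
  by rewrite ltrBrDl subrr ltr0n prime_gt0 // nth_prime_prime.
have ss : s <= s ^+ 2 by rewrite expr2 ler_peMl //; lra.
rewrite -(ltr_nat R) -/p; lra.
Qed.

End RootDegree.

(** Since d + 1 <= 2 s, the power is at most exp(2 s ln c), which is below p = exp(s^2) once s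
    exceeds 2 ln c. Allowing any e i <= d + 1 serves both fields. *)
Lemma root_degree_growth (R : realType) (e : nat -> nat) (C : R) :
    (forall i, (e i <= (root_degree R i).+1)%N) ->
  exists n, forall i, (n <= i)%N -> C ^+ e i < (nth_prime i)%:R.
Proof.
move=> he; pose c := 1 + `|C|; have c1 : 1 <= c by rewrite /c lerDl.
have c0 : 0 < c by apply: lt_le_trans c1.
pose L := 2 * ln c; have L0 : 0 <= L by rewrite mulr_ge0 // ln_ge0.
(* From this index on p_i > i > exp(L^2), hence s > L; the successor also forces i >= 1. *)
exists (Num.truncn (expR (L ^+ 2))).+1 => i hi.
have i0 : (0 < i)%N by apply: leq_ltn_trans hi.
have [d1 /andP[ds sd]] := root_degree_itv R i0; have s1 := sqrt_ln_ge1 R i0.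
have es := sqrt_ln_sqr R i0; have he' := he i.
set d := root_degree R i in d1 ds sd he'; set p := nth_prime i in s1 es ds sd *.
set s := Num.sqrt _ in s1 es ds sd.
have p0 : 0 < p%:R :> R by rewrite ltr0n prime_gt0 // nth_prime_prime.
have Lp : L ^+ 2 < ln (p%:R : R).
  rewrite -[ltLHS](expRK (L ^+ 2)) ltr_ln ?posrE ?expR_gt0 //.
  apply: lt_le_trans (truncnS_gt _) _; rewrite ler_nat (leq_trans hi) //.
  by apply: ltnW; apply: ltn_trans (nth_prime_gt i).
have Ls : L < s.
  by rewrite -es in Lp; rewrite -(ltr_pXn2r (isT : (0 < 2)%N)) ?nnegrE //; lra.
have le1 : C ^+ e i <= c ^+ e i.
  apply: le_trans (ler_norm _) _; rewrite normrX; apply: lerXn2r; rewrite ?nnegrE //.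
    exact: ltW.
  by rewrite /c lerDr.
have le2 : c ^+ e i <= c ^+ d.+1 by apply: ler_weXn2l.
apply: le_lt_trans (le_trans le1 le2) _.
rewrite -(lnK p0) -[c in ltLHS](lnK c0) -expRM_natl ltr_expR -es.
have dd : d.+1%:R <= 2 * s.
  by rewrite -(natr1 d) mulr_natl mulr2n lerD.
apply: (@le_lt_trans _ _ (2 * s * ln c)); first by rewrite ler_wpM2r // ln_ge0.
rewrite expr2 -mulrA mulrCA ltr_pM2l ?(lt_le_trans ltr01 s1) //; exact: Ls.
Qed.

(** At finite places |x|^n = |p| <= 1 makes the factor 1; at infinite places |x| = p^(1/n), and the
    exponents add up to at most 1/n because the local degrees sum to at most the degree. *)
Lemma weil_height_root_le (R : realType) (x : algC) (n p : nat) :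
  (0 < n)%N -> (0 < p)%N -> x ^+ n = p%:R -> weil_height R x <= (p%:R : R) `^ (n%:R^-1).
Proof.
move=> n0 p0 xn; have [F [iota [y [Dy _ _ ->]]]] := weil_height_def R x.
have yn : y ^+ n = p%:R.
  by apply: (fmorph_inj iota); rewrite rmorphXn Dy xn rmorph_nat.
pose D := (\dim {:F})%:R : R.
have D0 : 0 < D by rewrite ltr0n adim_gt0.
have p1 : 1 <= p%:R :> R by rewrite ler1n.
have bound1 : 1 <= p%:R `^ n%:R^-1 :> R.
  by rewrite -[leLHS](powRr0 p%:R) ler_powR // invr_ge0.
have wv v : @places R F v -> absval v /\ v y ^+ n = restrict_abs v p%:R.
  move=> [vP _]; split=> //; rewrite -(absvalX vP) yn /restrict_abs.
  by rewrite scaler_nat.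
have arch v : @places R F v -> restrict_abs v = abs_at R None ->
    local_factor y v = p%:R `^ (n%:R^-1 * ((local_degree v)%:R / D)).
  move=> vpl vw; have [vP vy] := wv v vpl; rewrite /local_factor -/D [RHS]powRrM.
  have -> : v y = p%:R `^ n%:R^-1.
    apply: (pexpIrn n0); rewrite ?nnegrE ?(absval_ge0 vP) ?powR_ge0 //.
    rewrite vy vw -powR_mulrn ?powR_ge0 // -powRrM mulVf ?pnatr_eq0 -?lt0n // powRr1 //.
    by rewrite /= /archimedean_abs ger0_norm // ratr_nat.
  by rewrite (max_idPr bound1).
have nonarch v : @places R F v -> restrict_abs v <> abs_at R None -> local_factor y v = 1.
  move=> vpl nvw; have [vP vy] := wv v vpl; rewrite /local_factor (max_idPl _) ?powR1 //.
  case: vpl => _ /usual_absP[[q|] /= qp vw]; last by case: nvw.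
  rewrite -(expr_le1 n0) ?(absval_ge0 vP) // vy vw padic_abs_nat //.
  by rewrite invf_le1 ?exprn_gt0 ?ltr0n ?prime_gt0 // exprn_ege1 // ler1n prime_gt0.
rewrite /field_height -/(local_factor y).
set t := finite_support _ _ _.
have tpl v : v \in t -> @places R F v.
  rewrite /t; case: finite_supportP => [//|X XP _ _ vX]; exact: XP.
have ut : uniq t by apply: finite_support_uniq.
clearbody t; pose A (v : F -> R) := `[< restrict_abs v = abs_at R None >].
rewrite (bigID A) /= [X in _ * X]big1_seq ?mulr1; last first.
  by move=> v /andP[/asboolP nA /tpl vpl]; apply: nonarch.
rewrite -big_filter; set ta := [seq v <- t | A v].
have taP v : v \in ta -> places_at None v /\ @places R F v.
  rewrite mem_filter => /andP[/asboolP vw /tpl vpl]; split=> //.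
  by split=> //; case: (wv v vpl).
have sum_le : (\sum_(v <- ta) local_degree v <= \dim {:F})%N.
  apply: (@sum_vfree_seq_le R F None ta (@local_degree R F)) => //.
  - by rewrite filter_uniq.
  - by move=> v /taP[].
  (* A completion basis consists of sequences; its terms at a late index N form a [vfree] family of
     the same size inside F. *)
  - move=> v /taP[[vP _] _]; have [e [e1 _ e3]] := local_degreeP vP.
    have [c [c0 [N hN]]] := completion_basis_vfree vP e1 e3.
    by exists (fun i => e i N), c => //; apply: hN.
have -> : \prod_(v <- ta) local_factor y v =
    \prod_(v <- ta) p%:R `^ (n%:R^-1 * ((local_degree v)%:R / D)).
  rewrite big_seq [RHS]big_seq; apply: eq_bigr => v /taP[[_ vw] vpl].
  exact: arch.
have powR_sum (f : (F -> R) -> R) : \prod_(v <- ta) p%:R `^ f v = p%:R `^ (\sum_(v <- ta) f v) :> R.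
  elim: (ta) => [|v r IHr]; first by rewrite !big_nil powRr0.
  by rewrite !big_cons IHr -powRD // (gt_eqF (lt_le_trans ltr01 p1)) implybT.
rewrite powR_sum ler_powR // -mulr_sumr -mulr_suml -natr_sum.
rewrite ler_piMr ?invr_ge0 // ler_pdivrMr // mul1r ler_nat.
exact: sum_le.
Qed.

Lemma subfield_adjoin_set (S : set algC) : subfield (adjoin S).
Proof.
split=> [|x y /set_mem xS /set_mem yS|x y /set_mem xS /set_mem yS]; apply/mem_set => K [Kf SK].
- exact: subring1 (subfield_subring Kf).
- by apply: (subringB (subfield_subring Kf));
  [exact: (xS K (conj Kf SK)) | exact: (yS K (conj Kf SK))].
- by apply: subfieldV_div => //; [exact: (xS K (conj Kf SK)) | exact: (yS K (conj Kf SK))].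
Qed.

(** * Infinitely many elements of small height in the composite *)

Section Composite.
Variable R : realType.

(** As 1/d - 1/(d + 1) = 1/(d (d + 1)), this quotient is a root of p_i of degree d (d + 1). *)
Definition ratio i : algC :=
  (root_degree R i).-root (nth_prime i)%:R / (root_degree R i).+1.-root (nth_prime i)%:R.

Lemma ratio_compositum i : (0 < i)%N -> compositum (L1 R) (L2 R) (ratio i).
Proof.
move=> i0; apply: (subfieldV_div (subfield_adjoin_set _)).
  move=> K [_ LK]; apply: LK; left=> M [_ SM]; apply: SM; by exists i.
move=> K [_ LK]; apply: LK; right=> M [_ SM]; apply: SM; by exists i.
Qed.

Lemma ratioX i : (0 < i)%N ->
  ratio i ^+ (root_degree R i * (root_degree R i).+1) = (nth_prime i)%:R.
Proof.
move=> i0; have [d0 _] := root_degree_itv R i0; set d := root_degree R i in d0 *.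
rewrite /ratio -/d expr_div_n exprM rootCK // mulnC exprM rootCK // exprS mulfK //.
by rewrite expf_neq0 // pnatr_eq0 -lt0n prime_gt0 // nth_prime_prime.
Qed.

(** The logarithm of the bound is ln p / (d (d + 1)) < (d + 1) / d <= 2. *)
Lemma ratio_height i : (0 < i)%N -> weil_height R (ratio i) <= expR 2.
Proof.
move=> i0; have [d0 /andP[_ sd]] := root_degree_itv R i0.
have p0 : (0 < nth_prime i)%N by rewrite prime_gt0 // nth_prime_prime.
have es := sqrt_ln_sqr R i0; have s1 := sqrt_ln_ge1 R i0.
set d := root_degree R i in d0 sd.
have m0 : (0 < d * d.+1)%N by rewrite muln_gt0 d0.
apply: le_trans (weil_height_root_le R m0 p0 (ratioX i0)) _.
rewrite /powR pnatr_eq0 -[_ == 0%N]negbK -lt0n p0 /= ler_expR mulrC ler_pdivrMr ?ltr0n //.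
rewrite -es natrM -natr1; rewrite -natr1 in sd; set s := Num.sqrt _ in sd s1 *.
have d1 : 1 <= d%:R :> R by rewrite ler1n.
nra.
Qed.

(** Equal ratios raised to the product of both degrees give an equality between powers of p_i and
    p_j, so the two primes coincide. *)
Lemma ratio_inj i j : (0 < i)%N -> (0 < j)%N -> ratio i = ratio j -> i = j.
Proof.
move=> i0 j0 e; apply: nth_prime_inj.
pose m k := (root_degree R k * (root_degree R k).+1)%N.
have m0 k : (0 < k)%N -> (0 < m k)%N.
  by move=> k0; rewrite muln_gt0; case: (root_degree_itv R k0) => ->.
have : (nth_prime i)%:R ^+ m j = (nth_prime j)%:R ^+ m i :> algC.
  by rewrite -(ratioX i0) -(ratioX j0) -/(m i) -/(m j) -!exprM e mulnC.
rewrite -!natrX => /eqP; rewrite eqr_nat => /eqP h.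
have : (nth_prime i %| nth_prime j ^ m i)%N by rewrite -h dvdn_exp // m0.
rewrite Euclid_dvdX ?nth_prime_prime // => /andP[+ _].
by rewrite dvdn_prime2 ?nth_prime_prime // => /eqP.
Qed.

Lemma compositum_not_northcott : ~ northcott R (compositum (L1 R) (L2 R)).
Proof.
move=> /(_ (expR 2) (expR_gt0 _)) /finite_seqP[s Ds].
pose t := [seq ratio i | i <- iota 1 (size s).+1].
have ut : uniq t.
  rewrite map_inj_in_uniq ?iota_uniq // => i j; rewrite !mem_iota => /andP[i0 _] /andP[j0 _].
  exact: ratio_inj.
have ts : {subset t <= s}.
  move=> _ /mapP[i + ->]; rewrite mem_iota => /andP[i0 _].
  suff : [set` s] (ratio i) by [].
  by rewrite -Ds; split; [apply: ratio_compositum | apply: ratio_height].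
by have := uniq_leq_size ut ts; rewrite size_map size_iota ltnn.
Qed.

Lemma northcott_nth_prime_radicals (e : nat -> nat) :
    (forall i, (0 < i)%N -> (0 < e i)%N) -> (forall i, (e i <= (root_degree R i).+1)%N) ->
  northcott R (adjoin [set (e i).-root (nth_prime i)%:R | i in [set i | (1 <= i)%N]]).
Proof.
move=> e0 he; apply: (@northcott_radicals nth_prime e) => //.
- by move=> i _; apply: nth_prime_prime.
- by move=> i j _; apply: nth_prime_mono.
- by move=> i i0; apply: leq_trans (he i) (root_degree_lt R i0).
- by move=> C; apply: root_degree_growth he.
Qed.

End Composite.

Theorem theorem5 (R : realType) :
  ~ (forall K L : set algC, subfield K -> subfield L ->
       northcott R K -> northcott R L -> northcott R (compositum K L)) /\
  [/\ northcott R (L1 R), northcott R (L2 R) &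
      ~ northcott R (compositum (L1 R) (L2 R))].
Proof.
have N1 : northcott R (L1 R).
  apply: northcott_nth_prime_radicals => [i i0|i]; last exact: leqnSn.
  by case: (root_degree_itv R i0).
have N2 : northcott R (L2 R) by apply: northcott_nth_prime_radicals.
have N12 := @compositum_not_northcott R; split; last by split.
by move=> h; apply: N12; apply: h => //; apply: subfield_adjoin_set.
Qed.
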